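(* Let $\Gamma$ be a star graph of degree $d>2$ with edge lengths $l_1,\dots,l_d>0$, let $\nu\in\mathbb R\setminus\{0\}$, $\sigma\in\mathbb N$, and fix a Dirichlet or Neumann condition at each boundary vertex. Let $\phi_{(q_* )}\in\Phi_{\mathrm{star}}$ for some $q_*\in Q$, and suppose $\phi_{(q_* )}$ vanishes at the central vertex. Then: (1) There exists a local spectral curve $\gamma:\mathbb R\to Q$ which passes through $q_*$. (2) For all $q$ on $\gamma$ sufficiently close to $q_*$, the change in nodal count is $$Z(\phi_{(q)})-Z(\phi_{(q_* )})=\mathrm{sgn}^2\big(\phi_{(q)}(0)\big)\left[-1+\frac d2-\frac12\,\mathrm{sgn}\big(\phi_{(q)}(0)\big)\sum_{j=1}^d\mathrm{sgn}\big(\partial_x\phi_{(q_* ),j}(0)\big)\right],$$ where $Z(\phi)\in\mathbb N$ is the number of zeros (nodes) of $\phi$ in the interior of $\Gamma$. Moreover: (3) If there are only Dirichlet conditions at the boundary vertices, $\nu>0$, and the edge lengths satisfy $\sum_{j=1}^d\zeta_j(n_j/l_j)^{1+1/\sigma}=0$ for some $\zeta_j\in\{-1,1\}$ and $n_j\in\mathbb N$, $j=1,\dots,d$, then there exists $\phi_{(q_* )}\in\Phi_{\mathrm{star}}$ with $\mu_*=0$ (where $\mu_*$ is the first coordinate of $q_*$), $\phi_{(q_* )}(0)=0$, $\zeta_j=\mathrm{sgn}(\partial_x\phi_{(q_* ),j}(0))$ for all $j$, and interior nodal count $Z(\phi_{(q_* )})=1-d+\sum_{j=1}^dn_j$. (4)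 If, in addition to the assumptions in (3), $\sum_{j=1}^d\zeta_j(n_j/l_j)^{-1+1/\sigma}\neq0$, then through the $q_*$ of (3) passes a local spectral curve $\gamma$ such that for all $q_+,q_-$ on $\gamma$ sufficiently close to $q_*$ with $\mu_+>0>\mu_-$ (where $\mu_\pm$ is the first coordinate of $q_\pm$), one has $$|Z(\phi_{(q_+)})-Z(\phi_{(q_-)})|=\Big|\sum_{j=1}^d\zeta_j\Big|.$$
   Context: $\mathbb N=\{1,2,3,\dots\}$; $\mathrm{sgn}(0)=0$. Star graph: $d>2$ intervals (edges) of lengths $l_j>0$ joined at one common endpoint, the central vertex; the other endpoints are the boundary vertices. On edge $j$ use the coordinate $x_j\in[0,l_j]$ with $x_j=0$ at the central vertex and $x_j=l_j$ at the boundary vertex. For $\phi:\Gamma\to\mathbb R$, $\phi_j$ denotes its restriction to edge $j$, and $\phi(0)$ its value at the central vertex. ''Interior of $\Gamma$'' means $\Gamma$ without the boundary vertices (the central vertex is an interior point, counted once). Equation on the star: for $j=1,\dots,d$, $$\mu\phi_j=-\partial_x^2\phi_j-(\sigma+1)\nu\phi_j^{2\sigma+1},\qquad \mu\in\mathbb R,\ \phi_j\in C^2([0,l_j],\mathbb R),$$ with the Neumann condition at the central vertex, $\phi_1(0)=\phi_j(0)$ for $j=2,\dots,d$ and $\sum_{j=1}^d\partial_x\phi_j(0)=0$, and at each boundary vertex the prescribed Dirichlet ($\phi_j(l_j)=0$) or Neumann ($\partial_x\phi_j(l_j)=0$) condition. $\Phi_{\mathrm{star}}$: the set of $\phi\ne0$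 which solve this problem (for the fixed $\nu,\sigma$ and some $\mu$) and attain at least one zero on $\Gamma$. Parameter set $P\subset\mathbb R^2$: with $\alpha_0:=|\mu/\nu|^{1/(2\sigma)}$, $\alpha_{\mathrm c}:=|\mu/((\sigma+1)\nu)|^{1/(2\sigma)}$, if $\nu>0$ then $P=\{(\mu,\alpha):\mu>0,\alpha>0\}\cup\{(\mu,\alpha):\mu\le0,\alpha>\alpha_0\}$; if $\nu<0$ then $P=\{(\mu,\alpha):\mu>0,\ 0<\alpha<\alpha_{\mathrm c}\}$. $Q\subset\mathbb R^{d+1}$: the set of points $q=(\mu,\alpha_1,\dots,\alpha_d)$ with $(\mu,\alpha_j)\in P$ for all $j$. Parametrization: a solution $\phi\in\Phi_{\mathrm{star}}$ with spectral parameter $\mu$ is assigned the point $\Lambda_{\mathrm{star}}(\phi)=(\mu,\|\phi_1\|_\infty,\dots,\|\phi_d\|_\infty)$, and $\phi_{(q)}$ denotes the solution with $\Lambda_{\mathrm{star}}(\phi_{(q)})=q\in Q$. It is determined by $q$ up to a sign on each edge: on edge $j$, $\phi_{(q),j}$ is the restriction to $[0,l_j]$ of the periodic, zero-attaining solution on the ray $(-\infty,l_j]$ of the same equation with parameter $\mu$, satisfying the boundary condition at $x_j=l_j$ and having sup-norm $\alpha_j$ (this ray solution is unique up to sign). For $q$ near a reference point $q_*$ the signs are fixed by those of $\phi_{(q_* )}$: on an edge with a Neumann condition, $\mathrm{sgn}(\phi_{(q),j}(l_j))=\mathrm{sgn}(\phi_{(q_* ),j}(l_j))$; on an edge with a Dirichlet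 condition, $\mathrm{sgn}(\partial_x\phi_{(q),j}(l_j))=\mathrm{sgn}(\partial_x\phi_{(q_* ),j}(l_j))$. Local spectral curve: a continuous map $\gamma:\mathbb R\to Q$ such that $\phi_{(\gamma(\tau))}\in\Phi_{\mathrm{star}}$ for all $\tau\in\mathbb R$. It passes through $q_*$ if $q_*$ is in its image; ''$q$ on $\gamma$'' means $q$ is in the image of $\gamma$. *)

(* Defs.v *)
From Stdlib Require Import Reals.
From mathcomp Require Import all_boot.
From Coquelicot Require Import Coquelicot.

Set Implicit Arguments.
Unset Strict Implicit.
Unset Printing Implicit Defensive.

Open Scope R_scope.

Notation "\sumR_ ( j < d ) F" := (\big[Rplus/0]_(j < d) F)
  (at level 41, F at level 41, j, d at level 50,
   format "\sumR_ ( j  <  d )  F").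

Definition segment (l x : R) : Prop := 0 <= x <= l.
Definition left_ray (l x : R) : Prop := x <= l.

(* Derivative relative to the domain [D]: one-sided at an endpoint of [D]. *)
Definition Derive_on (D : R -> Prop) (f : R -> R) (x : R) : R :=
  iota (fun v : R => D_in f (fun _ => v) D x).

Definition Derive2_on (D : R -> Prop) (f : R -> R) : R -> R :=
  Derive_on D (Derive_on D f).

Definition C2_on (D : R -> Prop) (f : R -> R) : Prop :=
  forall x, D x ->
    [/\ D_in f (Derive_on D f) D x,
        D_in (Derive_on D f) (Derive2_on D f) D x &
        continue_in (Derive2_on D f) D x].

Definition sup_norm (D : R -> Prop) (f : R -> R) : R :=
  real (Lub_Rbar (fun y => exists2 x, D x & y = Rabs (f x))).

Inductive boundary_condition := Dirichlet | Neumann.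

Definition solves_on (nu : R) (sigma : nat) (D : R -> Prop) (mu : R)
    (f : R -> R) : Prop :=
  C2_on D f /\
  forall x, D x ->
    mu * f x = - Derive2_on D f x - (INR sigma + 1) * nu * f x ^ (2 * sigma + 1).

Definition satisfies_bc (D : R -> Prop) (l : R) (b : boundary_condition)
    (f : R -> R) : Prop :=
  match b with
  | Dirichlet => f l = 0
  | Neumann => Derive_on D f l = 0
  end.

(* Real power of a nonnegative base with [0 ^ y = 0]; Stdlib's [Rpower 0 y]
   equals 1. *)
Definition nonneg_power (x y : R) : R :=
  if Req_EM_T x 0 then 0 else Rpower x y.

Definition alpha_0 (nu : R) (sigma : nat) (mu : R) : R :=
  nonneg_power (Rabs (mu / nu)) (1 / (2 * INR sigma)).

Definition alpha_c (nu : R) (sigma : nat) (mu : R) : R :=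
  nonneg_power (Rabs (mu / ((INR sigma + 1) * nu))) (1 / (2 * INR sigma)).

Definition in_P (nu : R) (sigma : nat) (mu alpha : R) : Prop :=
  (0 < nu /\
     ((0 < mu /\ 0 < alpha) \/ (mu <= 0 /\ alpha_0 nu sigma mu < alpha))) \/
  (nu < 0 /\ 0 < mu /\ 0 < alpha < alpha_c nu sigma mu).

(* A point [q = (mu, alpha_1, ..., alpha_d)] is a pair [(mu, alpha)] with
   [alpha : 'I_d -> R]; Coquelicot's uniform structure on this type is that of
   the maximum norm on R^(d+1). *)
Definition in_Q (nu : R) (sigma d : nat) (q : R * ('I_d -> R)) : Prop :=
  forall j, in_P nu sigma q.1 (q.2 j).

(* A function on the star is a family [phi : 'I_d -> R -> R], of which only the
   values [phi j x] with [0 <= x <= l j] matter. *)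

(* For a function that is continuous at the central vertex the value there may
   be read off on any edge; the first one is used. *)
Definition center (d : nat) (d_gt2 : (2 < d)%N) (phi : 'I_d -> R -> R) : R :=
  phi (Ordinal (ltnW (ltnW d_gt2))) 0.

Definition center_slope (d : nat) (l : 'I_d -> R) (phi : 'I_d -> R -> R)
    (j : 'I_d) : R :=
  Derive_on (segment (l j)) (phi j) 0.

Definition solves_star (nu : R) (sigma d : nat) (l : 'I_d -> R)
    (bc : 'I_d -> boundary_condition) (mu : R) (phi : 'I_d -> R -> R) : Prop :=
  [/\ forall j, solves_on nu sigma (segment (l j)) mu (phi j),
      forall i j, phi i 0 = phi j 0,
      \sumR_(j < d) center_slope l phi j = 0 &
      forall j, satisfies_bc (segment (l j)) (l j) (bc j) (phi j)].

Definition in_Phi_star (nu : R) (sigma d : nat) (l : 'I_d -> R)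
    (bc : 'I_d -> boundary_condition) (phi : 'I_d -> R -> R) : Prop :=
  [/\ exists mu, solves_star nu sigma l bc mu phi,
      exists j x, segment (l j) x /\ phi j x <> 0 &
      exists j x, segment (l j) x /\ phi j x = 0].

Definition Lambda_star (d : nat) (l : 'I_d -> R) (mu : R)
    (phi : 'I_d -> R -> R) : R * ('I_d -> R) :=
  (mu, fun j => sup_norm (segment (l j)) (phi j)).

Definition ray_solution (nu : R) (sigma : nat) (l : R) (b : boundary_condition)
    (mu alpha : R) (u : R -> R) : Prop :=
  [/\ solves_on nu sigma (left_ray l) mu u,
      satisfies_bc (left_ray l) l b u,
      exists2 T, 0 < T & forall x, left_ray l x -> u (x - T) = u x,
      exists2 x, left_ray l x & u x = 0 &
      sup_norm (left_ray l) u = alpha].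

(* [phi] is phi_(q) for some choice of the sign on each edge.  The sup-norm
   [alpha_j] is required both of the solution on the ray and of its restriction
   to the edge; the two differ only on an edge so short that the solution does
   not reach its maximum there, which cannot happen near a point [q] whose
   solution vanishes at the centre. *)
Definition is_phi_upto_signs (nu : R) (sigma d : nat) (l : 'I_d -> R)
    (bc : 'I_d -> boundary_condition) (q : R * ('I_d -> R))
    (phi : 'I_d -> R -> R) : Prop :=
  (forall j, exists2 u, ray_solution nu sigma (l j) (bc j) q.1 (q.2 j) u &
     forall x, segment (l j) x -> phi j x = u x) /\
  Lambda_star l q.1 phi = q.

Definition same_signs (d : nat) (l : 'I_d -> R) (bc : 'I_d -> boundary_condition)
    (phi phi' : 'I_d -> R -> R) : Prop :=
  forall j,
    match bc j with
    | Neumann => sign (phi j (l j)) = sign (phi' j (l j))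
    | Dirichlet => sign (Derive_on (segment (l j)) (phi j) (l j)) =
                   sign (Derive_on (segment (l j)) (phi' j) (l j))
    end.

(* [phi] is phi_(q), with the signs fixed by the reference function
   [phi_ref]; this determines [phi] on the star. *)
Definition is_phi (nu : R) (sigma d : nat) (l : 'I_d -> R)
    (bc : 'I_d -> boundary_condition) (phi_ref : 'I_d -> R -> R)
    (q : R * ('I_d -> R)) (phi : 'I_d -> R -> R) : Prop :=
  is_phi_upto_signs nu sigma l bc q phi /\ same_signs l bc phi_ref phi.

Definition local_spectral_curve (nu : R) (sigma d : nat) (l : 'I_d -> R)
    (bc : 'I_d -> boundary_condition) (phi_ref : 'I_d -> R -> R)
    (gamma : R -> R * ('I_d -> R)) : Prop :=
  (forall tau, continuous gamma tau) /\
  forall tau, in_Q nu sigma (gamma tau) /\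
    exists2 phi, is_phi nu sigma l bc phi_ref (gamma tau) phi &
      in_Phi_star nu sigma l bc phi.

Definition on_curve (d : nat) (gamma : R -> R * ('I_d -> R))
    (q : R * ('I_d -> R)) : Prop :=
  exists tau, gamma tau = q.

(* [None] is the central vertex, [Some (j, x)] the point at distance [x] from
   it on the open edge [j]. *)
Definition interior_node (d : nat) (d_gt2 : (2 < d)%N) (l : 'I_d -> R)
    (phi : 'I_d -> R -> R) (p : option ('I_d * R)) : Prop :=
  match p with
  | None => center d_gt2 phi = 0
  | Some (j, x) => 0 < x < l j /\ phi j x = 0
  end.

Definition nodal_count (d : nat) (d_gt2 : (2 < d)%N) (l : 'I_d -> R)
    (phi : 'I_d -> R -> R) (Z : nat) : Prop :=
  exists s : seq (option ('I_d * R)),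
    [/\ List.NoDup s, size s = Z &
        forall p, List.In p s <-> interior_node d_gt2 l phi p].

(* Main.v *)
(* On an edge every periodic zero-attaining solution is
   [phi = alpha * sin theta] with [theta' = sqrt h], where
   [h = mu + nu * alpha ^ (2 * sigma) * (1 + sin theta ^ 2 + ... +
   sin theta ^ (2 * sigma))]; the parameter set P is exactly where [h > 0].
   A solution vanishing at the centre has its phase there in [PI * N].  Near
   such a point, for fixed [mu], both the central value (with the sign of [nu]
   and of the phase) and the absolute central slope are strictly increasing in
   [alpha].  Hence prescribing a common central value [v] determines the
   amplitudes, the sum of the central slopes is strictly monotone in [v], and
   the Neumann condition yields a curve [mu |-> (v, alpha_1, ..., alpha_d)].
   Nodes are the points where the phase is a multiple of [PI], so a node enters
   or leaves edge [j] through the centre according to the sign of [v] and of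
   the slope of edge [j] there.
   For [mu = 0] all edges are rescalings of one equation, and the derivative in
   [mu] of the slope sum along [v = 0] is a multiple of
   [(sigma - 2) * sum zeta_j (n_j / l_j) ^ (- 1 + 1 / sigma)]: if it does not
   vanish, [v] changes sign with [mu].  For [sigma = 2] the factor vanishes and
   the constant curve satisfies (4), since no point on it has [mu <> 0]. *)
Require Import Defs.
From Stdlib Require Import Reals Lra Lia ZArith FunctionalExtensionality Classical.
From mathcomp Require Import all_boot.
From Coquelicot Require Import Coquelicot.
From HB Require Import structures.

Set Implicit Arguments.
Unset Strict Implicit.
Unset Printing Implicit Defensive.

(** The phase equation is autonomous and of first order, so it is solved by inverting the integral
    of [/ sqrt h]: no existence theorem for differential equations is needed, and dependence on the
    parameters follows by comparing integrands. Uniqueness is still required, since a ray solution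
    is given only abstractly; energy conservation from a peak fixes its data at the boundary up to
    sign, and a Gronwall estimate does the rest.

    Nothing is differentiated in the amplitude. The implicit function argument uses strict
    monotonicity and continuity alone, and monotonicity of the slope comes from the energy: its
    square is the potential at the peak minus the potential at the central value, and near a central
    zero the second term varies too little to matter.

    The curve is not differentiated in [mu] either. At each small [mu] there is an explicit
    competitor with the same half wave numbers and [v = 0]; its slope sum, nonzero for [mu <> 0] in
    the situation of (4) when [sigma <> 2], tells on which side of 0 the root [v] lies. *)

HB.instance Definition _ := Monoid.isComLaw.Build R 0 Rplus
  (fun x y z => esym (Rplus_assoc x y z)) Rplus_comm Rplus_0_l.

(** * Finite sums, continuity, and a monotone implicit function theorem *)

Lemma sumR_scal (d : nat) (c : R) (f : 'I_d -> R) :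
  \sumR_(j < d) (c * f j) = c * \sumR_(j < d) f j.
Proof.
by elim/big_rec2: _ => [|j y x _ ->]; ring.
Qed.

Lemma sumR_le (d : nat) (f g : 'I_d -> R) :
  (forall j, f j <= g j) -> \sumR_(j < d) f j <= \sumR_(j < d) g j.
Proof.
by move=> H; elim/big_rec2: _ => [|j y x _ ?]; [lra | move: (H j); lra].
Qed.

Lemma sumR_lt (d : nat) (f g : 'I_d -> R) :
  (0 < d)%N -> (forall j, f j < g j) -> \sumR_(j < d) f j < \sumR_(j < d) g j.
Proof.
case: d f g => // d f g _ H; rewrite !big_ord_recl.
have := H ord0.
have : \sumR_(i < d) f (lift ord0 i) <= \sumR_(i < d) g (lift ord0 i).
  by apply: sumR_le => j; apply: Rlt_le.
by lra.
Qed.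

Lemma continuous_sumR (T : UniformSpace) (d : nat) (f : 'I_d -> T -> R) (x : T) :
  (forall j, continuous (f j) x) ->
  continuous (fun t => \sumR_(j < d) f j t) x.
Proof.
elim: d f => [|d IH] f H.
  by apply: (continuous_ext (fun _ => 0)) => [t|];
    [rewrite big_ord0 | exact: continuous_const].
apply: (continuous_ext
  (fun t => plus (f ord0 t) (\sumR_(j < d) f (lift ord0 j) t))) => [t|].
  by rewrite big_ord_recl.
by apply: continuous_plus => //; apply: IH.
Qed.

Lemma locally_weaken (T : UniformSpace) (x : T) (P Q : T -> Prop) :
  locally x P -> (forall t, P t -> Q t) -> locally x Q.
Proof. by move=> [e He] HPQ; exists e => y /He /HPQ. Qed.

Lemma locally_all (T : UniformSpace) (x : T) (P : T -> Prop) :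
  (forall t, P t) -> locally x P.
Proof. exact: filter_forall. Qed.

Lemma locally_and (T : UniformSpace) (x : T) (P Q : T -> Prop) :
  locally x P -> locally x Q -> locally x (fun t => P t /\ Q t).
Proof. exact: filter_and. Qed.

Lemma filter_forall_ord (T : Type) (F : (T -> Prop) -> Prop) (d : nat)
    (P : 'I_d -> T -> Prop) :
  Filter F -> (forall j, F (P j)) -> F (fun t => forall j, P j t).
Proof.
move=> FF; elim: d P => [|d IH] P H; first by apply: filter_forall => t [].
have K := @filter_and _ F FF _ _ (H ord0) (IH (fun j => P (lift ord0 j)) (fun j => H _)).
apply: (@filter_imp _ F FF _ _ _ K) => t [H0 H1] j.
by case: (unliftP ord0 j) => [k ->|->].
Qed.

Lemma continuous_ball (T U : UniformSpace) (f : T -> U) (x : T) (e : posreal) :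
  continuous f x -> locally x (fun t => ball (f x) e (f t)).
Proof. move=> H; exact: (proj1 (filterlim_locally f (f x)) H e). Qed.

Lemma continuous_fct (T : UniformSpace) (d : nat) (f : T -> 'I_d -> R) (x : T) :
  (forall j, continuous (fun t => f t j) x) -> continuous f x.
Proof.
move=> H; apply: (proj2 (filterlim_locally f (f x))) => eps.
have K j : locally x (fun t => ball (f x j) eps (f t j)).
  exact: (continuous_ball eps (H j)).
exact: filter_forall_ord K.
Qed.

Lemma continuous_pair (T U V : UniformSpace) (f : T -> U) (g : T -> V) (x : T) :
  continuous f x -> continuous g x -> continuous (fun t => (f t, g t)) x.
Proof.
move=> Hf Hg.
apply: (proj2 (filterlim_locally (fun t => (f t, g t)) (f x, g x))) => eps.
have Hf' := continuous_ball eps Hf.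
have Hg' := continuous_ball eps Hg.
apply: (locally_weaken (locally_and Hf' Hg')). by move=> t [? ?].
Qed.

Lemma continuous_lt (T : UniformSpace) (f g : T -> R) (x : T) :
  continuous f x -> continuous g x -> f x < g x ->
  locally x (fun t => f t < g t).
Proof.
move=> Hf Hg H.
have e0 : 0 < (g x - f x) / 2 by lra.
have Hf' := continuous_ball (mkposreal _ e0) Hf.
have Hg' := continuous_ball (mkposreal _ e0) Hg.
apply: (locally_weaken (locally_and Hf' Hg')) => t.
rewrite /ball /= /AbsRing_ball /abs /minus /plus /opp /=.
by move=> [/Rabs_def2 ? /Rabs_def2 ?]; lra.
Qed.

Lemma continuous_near (T : UniformSpace) (f : T -> R) (x : T) (e : R) :
  continuous f x -> 0 < e -> locally x (fun t => Rabs (f t - f x) < e).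
Proof.
move=> Hf e0; exact: (continuous_ball (mkposreal _ e0) Hf).
Qed.

Lemma continuous_bound_near (T : UniformSpace) (f g : T -> R) (x : T) :
  locally x (fun t => Rabs (f t - f x) <= g t) -> continuous g x -> g x = 0 ->
  continuous f x.
Proof.
move=> H Hg g0; apply: (proj2 (filterlim_locally f (f x))) => eps.
apply: (locally_weaken (locally_and H (continuous_near Hg (cond_pos eps)))) => t.
rewrite g0 /ball /= /AbsRing_ball /abs /minus /plus /opp /=.
by move=> [h1 /Rabs_def2 h2]; apply: Rle_lt_trans h1 _; lra.
Qed.

(** Strict monotonicity replaces an invertible derivative. The intermediate value theorem gives the
    root; for its continuity at [p] it suffices that the signs of [f] at the two fixed heights
    [g p - e] and [g p + e] persist near [p], so separate continuity in each variable is enough. *)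
Lemma monotone_implicit (T : UniformSpace) (f : T -> R -> R) (p0 : T) (x0 r : R) :
  0 < r -> f p0 x0 = 0 ->
  locally p0 (fun p =>
    (forall x y, x0 - r < x -> x < y -> y < x0 + r -> f p x < f p y) /\
    (forall x, x0 - r < x < x0 + r ->
       continuous (f p) x /\ continuous (fun p => f p x) p)) ->
  exists g : T -> R,
    g p0 = x0 /\
    locally p0 (fun p => [/\ x0 - r < g p < x0 + r, f p (g p) = 0 &
      continuous g p]).
Proof.
move=> r0 f0 Hloc.
pose P p x := x0 - r < x < x0 + r /\ f p x = 0.
pose mono p := forall x y, x0 - r < x -> x < y -> y < x0 + r -> f p x < f p y.
have uniq p x y : mono p -> P p x -> P p y -> x = y.
  move=> Hm [Px fx] [Py fy].
  case: (Rtotal_order x y) => [xy|[//|xy]].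
    by have := Hm x y; lra.
  by have := Hm y x; lra.
pose g p : R := iota (P p).
have gP p x : mono p -> P p x -> g p = x.
  by move=> Hm Px; apply: iota_unique => // y Py; apply: (uniq p).
have [Hm0 Hc0] := locally_singleton _ _ Hloc.
have root : locally p0 (fun p => P p (g p)).
  have lo : f p0 (x0 - r / 2) < 0 by rewrite -f0; apply: Hm0; lra.
  have hi : 0 < f p0 (x0 + r / 2) by rewrite -f0; apply: Hm0; lra.
  have L1 : locally p0 (fun p => f p (x0 - r / 2) < 0).
    apply: (continuous_lt (f := fun p => f p (x0 - r / 2)) (g := fun _ => 0)) => //.
      by apply: (Hc0 _ _).2; lra.
    exact: continuous_const.
  have L2 : locally p0 (fun p => 0 < f p (x0 + r / 2)).
    apply: (continuous_lt (f := fun _ => 0) (g := fun p => f p (x0 + r / 2))) => //.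
      exact: continuous_const.
    by apply: (Hc0 _ _).2; lra.
  apply: (locally_weaken (locally_and Hloc (locally_and L1 L2))).
  move=> p [[Hm Hc] [h1 h2]].
  have lohi : x0 - r / 2 < x0 + r / 2 by lra.
  have cont a : x0 - r / 2 <= a <= x0 + r / 2 -> continuity_pt (f p) a.
    move=> aI; apply/continuity_pt_filterlim.
    by apply: (Hc _ _).1; lra.
  have [z [zI fz]] := Ranalysis5.IVT_interv _ _ _ cont lohi h1 h2.
  have Pz : P p z by split; [lra|].
  by rewrite (gP _ _ Hm Pz).
exists g; split; first by apply: gP => //; split; [lra|].
have Hboth := locally_and Hloc root.
apply: (locally_weaken (locally_and Hboth (locally_locally _ _ Hboth))).
move=> p [[[Hm Hc] [gI fg]] Hp]; split=> //.
apply: (proj2 (filterlim_locally g (g p))) => eps.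
set e := Rmin (eps / 2) (Rmin ((g p - (x0 - r)) / 2) ((x0 + r - g p) / 2)).
have e0 : 0 < e.
  have epos := cond_pos eps.
  by rewrite /e; repeat apply: Rmin_pos; lra.
have e1 : e <= eps / 2 by exact: Rmin_l.
have e2 : e <= (g p - (x0 - r)) / 2.
  by apply: Rle_trans (Rmin_r _ _) _; exact: Rmin_l.
have e3 : e <= (x0 + r - g p) / 2.
  by apply: Rle_trans (Rmin_r _ _) _; exact: Rmin_r.
have L1 : locally p (fun p' => f p' (g p - e) < 0).
  apply: (continuous_lt (f := fun p' => f p' (g p - e)) (g := fun _ => 0)).
  - by apply: (Hc _ _).2; lra.
  - exact: continuous_const.
  - by rewrite -fg; apply: Hm; lra.
have L2 : locally p (fun p' => 0 < f p' (g p + e)).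
  apply: (continuous_lt (f := fun _ => 0) (g := fun p' => f p' (g p + e))).
  - exact: continuous_const.
  - by apply: (Hc _ _).2; lra.
  - by rewrite -fg; apply: Hm; lra.
apply: (locally_weaken (locally_and Hp (locally_and L1 L2))).
move=> p' [[[Hm' _] [gI' fg']] [h1 h2]].
rewrite /ball /= /AbsRing_ball /abs /minus /plus /opp /=.
apply: Rabs_def1.
  case: (Rlt_le_dec (g p') (g p + e)) => h; first by have := cond_pos eps; lra.
  case: (Rle_lt_or_eq_dec _ _ h) => [h'|h']; last by move: h2; rewrite h'; lra.
  by have := Hm' _ _ _ h'; lra.
case: (Rlt_le_dec (g p - e) (g p')) => h; first by have := cond_pos eps; lra.
case: (Rle_lt_or_eq_dec _ _ h) => [h'|h']; last by move: h1; rewrite -h'; lra.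
by have := Hm' _ _ _ h'; lra.
Qed.

(** * Derivatives relative to a domain *)

(** An accumulation point of [D]. There a derivative relative to [D] is unique, which [Derive_on],
    being defined by [iota], needs. *)
Definition perfect_at (D : R -> Prop) (x : R) : Prop := adhDa (D_x D x) x.

Lemma Derive_on_unique (D : R -> Prop) (f : R -> R) (x v : R) :
  perfect_at D x -> D_in f (fun _ => v) D x -> Derive_on D f x = v.
Proof.
move=> Hp Hv; apply: iota_unique => // y Hy.
exact: single_limit Hp Hy Hv.
Qed.

Lemma is_derive_D_in (D : R -> Prop) (f g : R -> R) (x v : R) :
  is_derive f x v -> (forall y, D y -> g y = f y) -> D x ->
  D_in g (fun _ => v) D x.
Proof.
move=> /is_derive_Reals Hf Hfg Dx eps eps0.
have [del Hdel] := Hf eps eps0.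
exists del; split; first exact: cond_pos.
move=> y [[Dy yx] ydel]; rewrite (Hfg _ Dy) (Hfg _ Dx).
have := Hdel (y - x).
by rewrite /= /Rdist (_ : x + (y - x) = y); [apply=> //; lra | ring].
Qed.

Lemma D_in_is_derive (D : R -> Prop) (f g : R -> R) (x : R) :
  D_in f g D x -> locally x D -> is_derive f x (g x).
Proof.
move=> Hf [del Hdel]; apply/is_derive_Reals => eps eps0.
have [a [a0 Ha]] := Hf eps eps0.
have m0 : 0 < Rmin a del by apply: Rmin_pos => //; exact: cond_pos.
exists (mkposreal _ m0) => h h0 /= hm.
have := Ha (x + h).
rewrite /= /Rdist (_ : x + h - x = h); last by ring.
apply; split; last exact: Rlt_le_trans hm (Rmin_l _ _).
split; last by lra.
apply: Hdel; rewrite /ball /= /AbsRing_ball /abs /minus /plus /opp /=.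
rewrite (_ : x + h + - x = h); last by ring.
exact: Rlt_le_trans hm (Rmin_r _ _).
Qed.

Lemma C2_on_restriction (D : R -> Prop) (f f1 f2 g : R -> R) :
  (forall x, D x -> perfect_at D x) ->
  (forall x, D x -> is_derive f x (f1 x)) ->
  (forall x, D x -> is_derive f1 x (f2 x)) ->
  (forall x, D x -> continuous f2 x) ->
  (forall x, D x -> g x = f x) ->
  [/\ C2_on D g, forall x, D x -> Derive_on D g x = f1 x &
      forall x, D x -> Derive2_on D g x = f2 x].
Proof.
move=> Hp H1 H2 Hc Hg.
have E1 x : D x -> Derive_on D g x = f1 x.
  move=> Dx; apply: Derive_on_unique; first exact: Hp.
  exact: is_derive_D_in (H1 x Dx) Hg Dx.
have E2 x : D x -> Derive2_on D g x = f2 x.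
  move=> Dx; apply: Derive_on_unique; first exact: Hp.
  exact: is_derive_D_in (H2 x Dx) E1 Dx.
split=> // x Dx; split.
- have := is_derive_D_in (H1 x Dx) Hg Dx.
  by rewrite /D_in E1.
- have := is_derive_D_in (H2 x Dx) E1 Dx.
  by rewrite /D_in E2.
- move=> eps eps0.
  have /continuity_pt_filterlim Hcx := Hc x Dx.
  have [a [a0 Ha]] := Hcx eps eps0.
  exists a; split=> // y [[Dy yx] ya].
  rewrite !E2 //; by apply: Ha; split.
Qed.

Lemma perfect_left_ray (l x : R) : left_ray l x -> perfect_at (left_ray l) x.
Proof.
rewrite /left_ray => xl a a0; exists (x - a / 2).
split; first by split; rewrite /left_ray; lra.
by rewrite /Rdist; apply: Rabs_def1; lra.
Qed.

Lemma perfect_segment (l x : R) : 0 < l -> segment l x -> perfect_at (segment l) x.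
Proof.
rewrite /segment => l0 xl a a0.
have m0 : 0 < Rmin (a / 2) (l / 2) by apply: Rmin_pos; lra.
have m1 := Rmin_l (a / 2) (l / 2); have m2 := Rmin_r (a / 2) (l / 2).
case: (Rle_lt_dec x (l / 2)) => h; [exists (x + Rmin (a / 2) (l / 2)) |
  exists (x - Rmin (a / 2) (l / 2))].
  split; first by split; rewrite /segment; lra.
  by rewrite /Rdist; apply: Rabs_def1; lra.
split; first by split; rewrite /segment; lra.
by rewrite /Rdist; apply: Rabs_def1; lra.
Qed.

(** * Sup-norms, and counting nodes edge by edge *)

Lemma sup_norm_attained (D : R -> Prop) (f : R -> R) (a x0 : R) :
  (forall x, D x -> Rabs (f x) <= a) -> D x0 -> Rabs (f x0) = a ->
  sup_norm D f = a.
Proof.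
move=> Hle D0 H0; rewrite /sup_norm (is_lub_Rbar_unique _ (Finite a)) //.
split; first by move=> y [x Dx ->]; apply: Hle.
by move=> b; apply; exists x0.
Qed.

(** A node on an open edge carries its edge index, so lists from different edges are disjoint and
    concatenate; the centre, common to all edges, is counted once by [None]. *)
Lemma nodal_count_edges (d : nat) (d_gt2 : (2 < d)%N) (l : 'I_d -> R)
    (phi : 'I_d -> R -> R) (K : 'I_d -> nat) (nodes : 'I_d -> seq R) :
  (forall j, [/\ List.NoDup (nodes j), size (nodes j) = K j &
     forall x, List.In x (nodes j) <-> 0 < x < l j /\ phi j x = 0]) ->
  exists Z : nat, nodal_count d_gt2 l phi Z /\
    INR Z = (if Req_EM_T (center d_gt2 phi) 0 then 1 else 0) +
            \sumR_(j < d) INR (K j).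
Proof.
move=> H.
have edges (s : seq 'I_d) : uniq s -> exists t : seq (option ('I_d * R)),
    [/\ List.NoDup t, INR (size t) = \big[Rplus/0]_(j <- s) INR (K j) &
      forall p, List.In p t <->
        exists j x, [/\ p = Some (j, x), j \in s & 0 < x < l j /\ phi j x = 0]].
  elim: s => [_|j s IH /= /andP[js us]].
    exists [::]; split; [exact: List.NoDup_nil | by rewrite big_nil |].
    by move=> p; split=> // -[j [x []]].
  have [t [Nt St It]] := IH us; have [Nj Sj Ij] := H j.
  exists (List.app (List.map (fun x => Some (j, x)) (nodes j)) t).
  have Imap p : List.In p (List.map (fun x => Some (j, x)) (nodes j)) <->
      exists x, p = Some (j, x) /\ 0 < x < l j /\ phi j x = 0.
    rewrite List.in_map_iff; split.
      by move=> [x [<- /Ij ?]]; exists x.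
    by move=> [x [-> /Ij ?]]; exists x.
  split.
  - apply: List.NoDup_app => //.
      by apply: List.NoDup_map_NoDup_ForallPairs => // x y _ _ [].
    move=> p /Imap [x [-> _]] /It [k [y [[e _] ks _]]].
    by move: js; rewrite e ks.
  - rewrite big_cons -St -Sj.
    have -> : forall (A : Type) (u v : seq A), size (List.app u v) = addn (size u) (size v).
      by move=> A; elim=> [|x u IHu] v //=; rewrite IHu.
    rewrite plus_INR; congr (_ + _); congr INR.
    by elim: (nodes j) => //= x u ->.
  - move=> p; rewrite List.in_app_iff Imap It; split.
      move=> [[x [-> Hx]]|[k [x [-> ks Hx]]]].
        by exists j, x; split=> //; rewrite inE eqxx.
      by exists k, x; split=> //; rewrite inE ks orbT.
    move=> [k [x [-> ]]]; rewrite inE => /orP[/eqP -> Hx|ks Hx].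
      by left; exists x.
    by right; exists k, x.
have [t [Nt St It]] := edges (index_enum 'I_d) (index_enum_uniq _).
case: Req_EM_T => c0.
  exists (size t).+1; split; last by rewrite S_INR St Rplus_comm.
  exists (None :: t); split=> //.
    by apply: List.NoDup_cons => // /It [j [x []]].
  move=> [[j x]|]; split=> //=.
  - by case=> // /It [k [y [[-> ->] _]]].
  - by move=> Hx; right; apply/It; exists j, x; split=> //; exact: mem_index_enum.
  - by left.
exists (size t); split; last by rewrite St Rplus_0_l.
exists t; split=> //.
move=> [[j x]|]; split=> //=.
- by move=> /It [k [y [[-> ->] _]]].
- by move=> Hx; apply/It; exists j, x; split=> //; exact: mem_index_enum.
- by move=> /It [k [y []]].
Qed.

(** * The phase equation *)

(** The quotient of [1 - s ^ (2 * n + 2)] by [1 - s ^ 2], as a sum so that it stays regular at the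
    peaks of the wave, where [1 - s ^ 2] vanishes. *)
Definition geo (n : nat) (s : R) : R := sum_f_R0 (fun i => (s ^ 2) ^ i) n.

Definition geo' (n : nat) (s : R) : R :=
  sum_f_R0 (fun i => 2 * INR i * s * (s ^ 2) ^ i.-1) n.

Lemma geo_S (n : nat) (s : R) : geo n.+1 s = geo n s + s ^ 2 * (s ^ 2) ^ n.
Proof. by []. Qed.

Lemma geo'_S (n : nat) (s : R) :
  geo' n.+1 s = geo' n s + 2 * (INR n + 1) * s * (s ^ 2) ^ n.
Proof. by rewrite -S_INR. Qed.

Lemma geo_bounds (n : nat) (s : R) : s ^ 2 <= 1 -> 1 <= geo n s <= INR n + 1.
Proof.
move=> s1; elim: n => [|n IH]; first by rewrite /geo /=; lra.
rewrite geo_S S_INR.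
have p0 : 0 <= (s ^ 2) ^ n.+1 by apply: pow_le; apply: pow2_ge_0.
have p1 : (s ^ 2) ^ n.+1 <= 1.
  by rewrite -(pow1 n.+1); apply: pow_incr; split=> //; apply: pow2_ge_0.
by rewrite -[_ * _ ^ n]/((s ^ 2) ^ n.+1); lra.
Qed.

Lemma geo_closed_form (n : nat) (s : R) :
  (1 - s ^ 2) * geo n s = 1 - s ^ 2 * (s ^ 2) ^ n.
Proof.
elim: n => [|n IH]; first by rewrite /geo /=; ring.
by rewrite geo_S Rmult_plus_distr_l IH -[(s ^ 2) ^ n.+1]/(s ^ 2 * (s ^ 2) ^ n); ring.
Qed.

(** Half the derivative in [s] of [geo_closed_form]. It turns the first order phase equation back
    into the second order equation for the wave. *)
Lemma geo_ode (n : nat) (s : R) :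
  - s * geo n s + / 2 * (1 - s ^ 2) * geo' n s = - (INR n + 1) * (s * (s ^ 2) ^ n).
Proof.
elim: n => [|n IH]; first by rewrite /geo /geo' /=; field.
rewrite geo_S geo'_S S_INR -[(s ^ 2) ^ n.+1]/(s ^ 2 * (s ^ 2) ^ n).
transitivity (- s * geo n s + / 2 * (1 - s ^ 2) * geo' n s
  - s * (s ^ 2 * (s ^ 2) ^ n) + (1 - s ^ 2) * (INR n + 1) * s * (s ^ 2) ^ n).
  by field.
by rewrite IH; ring.
Qed.

Lemma is_derive_geo (n : nat) (s : R) : is_derive (geo n) s (geo' n s).
Proof.
elim: n => [|n IH].
  rewrite /geo' /= (_ : _ * _ = 0); last by ring.
  by apply: (is_derive_ext (fun _ => 1)) => [t|] //; exact: is_derive_const.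
apply: (is_derive_ext (fun s => plus (geo n s) ((s ^ 2) ^ n.+1))) => [t|] //.
apply: (is_derive_plus (geo n)) => //.
by auto_derive => //; rewrite /=; ring.
Qed.

Lemma continuous_geo (n : nat) (s : R) : continuous (geo n) s.
Proof. by apply: ex_derive_continuous; exists (geo' n s); apply: is_derive_geo. Qed.

(* Along an edge [phi = alpha * sin theta], where the phase satisfies
   [theta' = sqrt h]; this is energy conservation divided by [cos theta ^ 2]. *)
Definition h (n : nat) (mu a t : R) : R := mu + a * geo n (sin t).

(** [h] is affine in [geo n (sin t)], which lies between [1] and [n + 1]; bounds at these two ends
    therefore hold throughout, whatever the sign of [a]. Keeping [m] and [M] explicit makes the
    later estimates uniform in [mu] and [a]. *)
Definition pinched (n : nat) (m M mu a : R) : Prop :=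
  [/\ 0 < m, m <= mu + a <= M & m <= mu + (INR n + 1) * a <= M].

Lemma sin2_le1 (t : R) : sin t ^ 2 <= 1.
Proof.
by have := sin2_cos2 t; rewrite /Rsqr; have := pow2_ge_0 (cos t); rewrite /=; nra.
Qed.

Lemma h_bounds (n : nat) (m M mu a t : R) :
  pinched n m M mu a -> m <= h n mu a t <= M.
Proof.
move=> [m0 h1 h2]; have := geo_bounds n (sin2_le1 t); rewrite /h => gb.
set g := geo n (sin t) in gb *.
case: (Rle_lt_dec 0 a) => a0; first by nra.
by nra.
Qed.

Lemma h_gt0 (n : nat) (m M mu a t : R) : pinched n m M mu a -> 0 < h n mu a t.
Proof. by move=> P; have := h_bounds t P; case: P; lra. Qed.

Lemma continuous_h (n : nat) (mu a t : R) : continuous (h n mu a) t.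
Proof.
apply: (continuous_plus (fun _ => mu) (fun t => a * geo n (sin t))).
  exact: continuous_const.
apply: (continuous_scal_r a (fun t => geo n (sin t))).
apply: continuous_comp; last exact: continuous_geo.
exact: continuous_sin.
Qed.

(** The length of edge over which the phase moves from [c] to [t], by separation of variables in
    [theta' = sqrt h]. *)
Definition travel (n : nat) (mu a c t : R) : R :=
  RInt (fun s => / sqrt (h n mu a s)) c t.

Section Phase.

Variables (n : nat) (m M mu a : R).
Hypothesis P : pinched n m M mu a.

Lemma slowness_bounds (t : R) : / sqrt M <= / sqrt (h n mu a t) <= / sqrt m.
Proof.
have hb := h_bounds t P; case: P => m0 _ _.
split; apply: Rinv_le_contravar.
- by apply: sqrt_lt_R0; lra.
- by apply: sqrt_le_1_alt; lra.
- exact: sqrt_lt_R0.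
- by apply: sqrt_le_1_alt; lra.
Qed.

Lemma continuous_slowness (t : R) : continuous (fun s => / sqrt (h n mu a s)) t.
Proof.
have h0 := h_gt0 t P.
apply: (continuous_comp (fun s => sqrt (h n mu a s)) Rinv).
  apply: (continuous_comp (h n mu a) sqrt); first exact: continuous_h.
  exact: continuous_sqrt.
by apply: continuous_Rinv; apply: Rgt_not_eq; apply: sqrt_lt_R0.
Qed.

Lemma ex_RInt_slowness (x y : R) : ex_RInt (fun s => / sqrt (h n mu a s)) x y.
Proof. by apply: ex_RInt_continuous => z _; apply: continuous_slowness. Qed.

Lemma is_derive_travel (c t : R) :
  is_derive (travel n mu a c) t (/ sqrt (h n mu a t)).
Proof.
apply: (@is_derive_RInt R_NormedModule (fun s => / sqrt (h n mu a s)) _ c); last exact: continuous_slowness.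
apply: locally_all => y.
exact: (RInt_correct _ _ _ (ex_RInt_slowness c y)).
Qed.

Lemma travel_Chasles (c x y : R) :
  travel n mu a c y - travel n mu a c x = travel n mu a x y.
Proof.
have := RInt_Chasles _ _ _ _ (ex_RInt_slowness c x) (ex_RInt_slowness x y).
by rewrite /plus /= /travel => <-; ring.
Qed.

Lemma travel_bounds (x y : R) : x <= y ->
  (y - x) * / sqrt M <= travel n mu a x y <= (y - x) * / sqrt m.
Proof.
move=> xy.
have const v : RInt (fun _ => v) x y = (y - x) * v by rewrite RInt_const.
rewrite -!const /travel; split; apply: RInt_le => //.
- exact: ex_RInt_const.
- exact: ex_RInt_slowness.
- by move=> t _; case: (slowness_bounds t).
- exact: ex_RInt_slowness.
- exact: ex_RInt_const.
- by move=> t _; case: (slowness_bounds t).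
Qed.

Lemma pinched_pos : 0 < m /\ 0 < M /\ 0 < sqrt m /\ 0 < sqrt M.
Proof. by case: P => m0 [? ?] _; do !split=> //; try apply: sqrt_lt_R0; lra. Qed.

Lemma travel_lt (c x y : R) : x < y -> travel n mu a c x < travel n mu a c y.
Proof.
move=> xy; have := travel_Chasles c x y.
have := travel_bounds (Rlt_le _ _ xy).
have [m0 [M0 [sm sM]]] := pinched_pos.
have := Rinv_0_lt_compat _ sM; nra.
Qed.

Lemma travel_le (c x y : R) : x <= y -> travel n mu a c x <= travel n mu a c y.
Proof. by case=> [xy|->]; [apply: Rlt_le; apply: travel_lt | lra]. Qed.

Lemma travel_inj (c x y : R) : travel n mu a c x = travel n mu a c y -> x = y.
Proof.
by case: (Rtotal_order x y) => [xy|[//|xy]]; have := travel_lt c xy; lra.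
Qed.

Lemma travel_lt_inv (c x y : R) : travel n mu a c x < travel n mu a c y -> x < y.
Proof.
by move=> H; case: (Rlt_le_dec x y) => // yx; have := travel_le c yx; lra.
Qed.

Lemma travel_refl (c : R) : travel n mu a c c = 0.
Proof. exact: RInt_point. Qed.

Lemma travel_onto (c y : R) : exists t, travel n mu a c t = y.
Proof.
have [m0 [M0 [sm sM]]] := pinched_pos.
(* The travel grows at rate at least [/ sqrt M], so a phase change of [B] on either side of [c]
   carries it past [y]. *)
pose B := (Rabs y + 1) * sqrt M.
have B0 : 0 < B by apply: Rmult_lt_0_compat => //; have := Rabs_pos y; lra.
have BM : B * / sqrt M = Rabs y + 1 by rewrite /B; field; lra.
have ya := Rle_abs y; have yb : - y <= Rabs y by rewrite -Rabs_Ropp; exact: Rle_abs.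
have lo : travel n mu a c (c - B) - y < 0.
  have le : c - B <= c by lra.
  have := travel_bounds le; have := travel_Chasles c (c - B) c.
  by rewrite travel_refl (_ : c - (c - B) = B); [rewrite BM; lra | ring].
have hi : 0 < travel n mu a c (c + B) - y.
  have le : c <= c + B by lra.
  have := travel_bounds le.
  by rewrite (_ : c + B - c = B); [rewrite BM; lra | ring].
have lohi : c - B < c + B by lra.
have cont x : c - B <= x <= c + B ->
    continuity_pt (fun t => travel n mu a c t - y) x.
  move=> _; apply/continuity_pt_filterlim.
  apply: (continuous_minus (travel n mu a c) (fun _ => y)).
    by apply: ex_derive_continuous; exists (/ sqrt (h n mu a x)); apply: is_derive_travel.
  exact: continuous_const.
have [z [_ fz]] := Ranalysis5.IVT_interv _ _ _ cont lohi lo hi.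
by exists z; lra.
Qed.

End Phase.

Definition phase (n : nat) (mu a c y : R) : R :=
  iota (fun t : R => travel n mu a c t = y).

(** Filling in [v] at [k = 0] turns differentiability at [x] into continuity at [0], so that limits
    of difference quotients can be composed and inverted as continuous functions. *)
Definition diff_quotient (f : R -> R) (x v k : R) : R :=
  if Req_EM_T k 0 then v else (f (x + k) - f x) / k.

Lemma diff_quotient_0 (f : R -> R) (x v : R) : diff_quotient f x v 0 = v.
Proof. by rewrite /diff_quotient; case: Req_EM_T. Qed.

Lemma continuous_diff_quotient (f : R -> R) (x v : R) :
  is_derive f x v -> continuous (diff_quotient f x v) 0.
Proof.
move=> /is_derive_Reals Hf.
apply: (proj2 (filterlim_locally _ (diff_quotient f x v 0))) => e.
have [del Hdel] := Hf e (cond_pos e); exists del => k.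
rewrite diff_quotient_0.
rewrite /ball /= /AbsRing_ball /abs /minus /plus /opp /= /diff_quotient.
case: Req_EM_T => k0.
  by rewrite (_ : v + - v = 0) ?Rabs_R0; [move=> _; exact: cond_pos | ring].
by rewrite Ropp_0 Rplus_0_r => kd; apply: Hdel.
Qed.

(** The difference quotient of [g] is the reciprocal of that of [f], taken at the increment of [g],
    which tends to 0. A right inverse suffices, since it makes [g] injective. *)
Lemma is_derive_inverse (f g : R -> R) (y v : R) :
  is_derive f (g y) v -> v <> 0 -> (forall z, f (g z) = z) -> continuous g y ->
  is_derive g y (/ v).
Proof.
move=> Hf v0 fg gc; apply/is_derive_Reals => eps eps0.
pose q := diff_quotient f (g y) v.
have qc : continuous q 0 := continuous_diff_quotient Hf.
have gc0 : continuous (fun k => g (y + k) - g y) 0.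
  apply: (continuous_minus (fun k => g (y + k)) (fun _ => g y)).
    apply: (continuous_comp (fun k => y + k) g); last by rewrite Rplus_0_r.
    apply: (continuous_plus (fun _ => y) (fun k : R => k)).
      exact: continuous_const.
    exact: continuous_id.
  exact: continuous_const.
have Qc : continuous (fun k => / q (g (y + k) - g y)) 0.
  apply: (continuous_comp (fun k => q (g (y + k) - g y)) Rinv).
    apply: (continuous_comp (fun k => g (y + k) - g y) q) => //.
    by rewrite Rplus_0_r Rminus_diag.
  by apply: continuous_Rinv; rewrite Rplus_0_r Rminus_diag /q diff_quotient_0.
have [del Hdel] := continuous_ball (mkposreal _ eps0) Qc.
exists del => k k0 kd.
have := Hdel k; rewrite /ball /= /AbsRing_ball /abs /minus /plus /opp /=.
rewrite Rplus_0_r Rminus_diag {2}/q diff_quotient_0 Ropp_0 Rplus_0_r => /(_ kd).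
rewrite /q /diff_quotient; case: Req_EM_T => e.
  case: k0; have e' : g (y + k) = g y by lra.
  by have := fg (y + k); rewrite e' fg; lra.
rewrite (_ : g y + (g (y + k) - g y) = g (y + k)); last by ring.
rewrite !fg (_ : y + k - y = k); last by ring.
by rewrite (_ : / (k / (g (y + k) - g y)) = (g (y + k) - g y) / k) //; field.
Qed.

Section PhaseSpec.

Variables (n : nat) (m M mu a : R).
Hypothesis P : pinched n m M mu a.

Lemma travel_phase (c y : R) : travel n mu a c (phase n mu a c y) = y.
Proof.
have [t Ht] := travel_onto P c y.
rewrite -[RHS]Ht; congr travel; apply: iota_unique => // z Hz.
by apply: (travel_inj P (c := c)); rewrite Hz Ht.
Qed.

Lemma phase_travel (c t : R) : phase n mu a c (travel n mu a c t) = t.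
Proof. by apply: (travel_inj P (c := c)); rewrite travel_phase. Qed.

Lemma phase_0 (c : R) : phase n mu a c 0 = c.
Proof. by rewrite -[RHS](phase_travel c) travel_refl. Qed.

Lemma phase_lt (c x y : R) : x < y -> phase n mu a c x < phase n mu a c y.
Proof. by move=> xy; apply: (travel_lt_inv P (c := c)); rewrite !travel_phase. Qed.

Lemma phase_bounds (c x y : R) : x <= y ->
  (y - x) * sqrt m <= phase n mu a c y - phase n mu a c x <= (y - x) * sqrt M.
Proof.
move=> xy; have [m0 [M0 [sm sM]]] := pinched_pos P.
have pxy : phase n mu a c x <= phase n mu a c y.
  by case: xy => [xy|->]; [apply: Rlt_le; apply: phase_lt | lra].
have := travel_Chasles P c (phase n mu a c x) (phase n mu a c y).
rewrite !travel_phase => ->.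
have := travel_bounds P pxy.
set u := travel _ _ _ _ _; set w := _ - _ => -[h1 h2]; split.
  have := Rmult_le_compat_r _ _ _ (Rlt_le _ _ sm) h2.
  by rewrite Rmult_assoc Rinv_l; lra.
have := Rmult_le_compat_r _ _ _ (Rlt_le _ _ sM) h1.
by rewrite Rmult_assoc Rinv_l; lra.
Qed.

Lemma is_derive_phase (c y : R) :
  is_derive (phase n mu a c) y (sqrt (h n mu a (phase n mu a c y))).
Proof.
have s0 : 0 < sqrt (h n mu a (phase n mu a c y)).
  by apply: sqrt_lt_R0; apply: h_gt0 P.
rewrite -[sqrt _]Rinv_inv.
apply: (is_derive_inverse (f := travel n mu a c)).
- exact: is_derive_travel P _ _.
- by apply: Rgt_not_eq; apply: Rinv_0_lt_compat.
- by move=> z; exact: travel_phase.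
apply: (continuous_bound_near (g := fun z => Rabs (z - y) * sqrt M)).
- apply: locally_all => z; case: (Rle_lt_dec y z) => yz.
    have := phase_bounds c yz.
    by move=> ?; rewrite !Rabs_pos_eq; try lra; have [_ [_ [? _]]] := pinched_pos P; nra.
  have zy := Rlt_le _ _ yz; have := phase_bounds c zy.
  move=> ?; rewrite Rabs_minus_sym (Rabs_minus_sym z) !Rabs_pos_eq; try lra.
  by have [_ [_ [? _]]] := pinched_pos P; nra.
- apply: (continuous_mult (fun z => Rabs (z - y)) (fun _ => sqrt M)).
    apply: (continuous_comp (fun z => z - y) Rabs); last exact: continuous_Rabs.
    apply: (continuous_minus (fun z : R => z) (fun _ => y)).
      exact: continuous_id.
    exact: continuous_const.
  exact: continuous_const.
- by rewrite Rminus_diag Rabs_R0; ring.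
Qed.

Lemma phase_periodic (c y : R) :
  phase n mu a c (y + travel n mu a c (c + 2 * PI)) = phase n mu a c y + 2 * PI.
Proof.
apply: (travel_inj P (c := c)); rewrite travel_phase.
rewrite -{1}(travel_phase c y).
set t := phase n mu a c y.
have := travel_Chasles P c (c + 2 * PI) (t + 2 * PI).
rewrite (_ : travel n mu a (c + 2 * PI) (t + 2 * PI) = travel n mu a c t); first by lra.
rewrite /travel.
have := RInt_comp_lin (fun s => / sqrt (h n mu a s)) 1 (2 * PI) c t.
rewrite !Rmult_1_l => <-; last exact: ex_RInt_slowness P _ _.
apply: RInt_ext => x _; rewrite /scal /= /mult /= Rmult_1_l Rmult_1_l.
by rewrite /h sin_plus cos_2PI sin_2PI; congr (/ sqrt (_ + _ * geo _ _)); ring.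
Qed.

End PhaseSpec.

(** * Dependence of the phase on the parameters *)

Lemma inv_sqrt_diff (x y : R) : 0 < x -> 0 < y ->
  / sqrt x - / sqrt y = (y - x) * / (sqrt x * sqrt y * (sqrt x + sqrt y)).
Proof.
move=> x0 y0.
have sx := sqrt_lt_R0 _ x0; have sy := sqrt_lt_R0 _ y0.
have -> : y - x = sqrt y * sqrt y - sqrt x * sqrt x by rewrite !sqrt_sqrt; lra.
by field; do !split; lra.
Qed.

Lemma inv_sqrt_diff_upper (m x y : R) : 0 < m -> m <= x -> m <= y ->
  Rabs (/ sqrt x - / sqrt y) <= Rabs (y - x) * / (m * sqrt m).
Proof.
move=> m0 mx my; rewrite inv_sqrt_diff; try lra.
have sm := sqrt_lt_R0 _ m0.
have mx' := sqrt_le_1_alt _ _ mx; have my' := sqrt_le_1_alt _ _ my.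
have mm := sqrt_sqrt m (Rlt_le _ _ m0).
have H : m * sqrt m <= sqrt x * sqrt y * (sqrt x + sqrt y).
  have : sqrt m * sqrt m <= sqrt x * sqrt y by apply: Rmult_le_compat; lra.
  by rewrite mm => H; apply: Rmult_le_compat; lra.
have H0 : 0 < m * sqrt m by nra.
rewrite Rabs_mult; apply: Rmult_le_compat_l; first exact: Rabs_pos.
rewrite Rabs_pos_eq; last by apply: Rlt_le; apply: Rinv_0_lt_compat; lra.
exact: Rinv_le_contravar.
Qed.

Lemma inv_sqrt_diff_lower (m M x y : R) : 0 < m -> m <= x -> x <= y -> y <= M ->
  (y - x) * / (2 * M * sqrt M) <= / sqrt x - / sqrt y.
Proof.
move=> m0 mx xy yM; rewrite inv_sqrt_diff; try lra.
have x0 : 0 < x by lra.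
have sx := sqrt_lt_R0 _ x0.
have xy' := sqrt_le_1_alt _ _ xy; have yM' := sqrt_le_1_alt _ _ yM.
have M0 : 0 <= M by lra.
have MM := sqrt_sqrt M M0.
apply: Rmult_le_compat_l; first lra.
apply: Rinv_le_contravar; first by apply: Rmult_lt_0_compat; nra.
have : sqrt x * sqrt y <= sqrt M * sqrt M by apply: Rmult_le_compat; lra.
rewrite MM => H.
have -> : 2 * M * sqrt M = M * (sqrt M + sqrt M) by ring.
by apply: Rmult_le_compat; try lra; nra.
Qed.

Section Compare.

Variables (n : nat) (m M mu1 a1 mu2 a2 c : R).
Hypothesis P1 : pinched n m M mu1 a1.
Hypothesis P2 : pinched n m M mu2 a2.

(** Bounds the difference of the two values of [h] at any phase; [n + 1] is the bound on [geo] over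
    all sines. *)
Let D := Rabs (mu1 - mu2) + (INR n + 1) * Rabs (a1 - a2).

Lemma travel_param_lipschitz (t : R) : c <= t ->
  Rabs (travel n mu1 a1 c t - travel n mu2 a2 c t) <=
  (t - c) * (D * / (m * sqrt m)).
Proof.
move=> ct.
have e1 := ex_RInt_slowness P1 c t; have e2 := ex_RInt_slowness P2 c t.
have := RInt_minus _ _ _ _ e1 e2.
rewrite /minus /plus /opp /= -/(Rminus _ _) /travel => <-.
apply: abs_RInt_le_const => //.
  exact: (@ex_RInt_minus R_NormedModule).
move=> s _.
have [m0 _] := pinched_pos P1.
have [h1 _] := h_bounds s P1; have [h2 _] := h_bounds s P2.
apply: Rle_trans (inv_sqrt_diff_upper m0 h1 h2) _.
apply: Rmult_le_compat_r.
  apply: Rlt_le; apply: Rinv_0_lt_compat; apply: Rmult_lt_0_compat => //.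
  exact: sqrt_lt_R0.
rewrite /h /D.
have gb := geo_bounds n (sin2_le1 s); set g := geo _ _ in gb *.
have -> : mu2 + a2 * g - (mu1 + a1 * g) = - ((mu1 - mu2) + g * (a1 - a2)) by ring.
rewrite Rabs_Ropp; apply: Rle_trans (Rabs_triang _ _) _.
apply: Rplus_le_compat_l; rewrite Rabs_mult (Rabs_pos_eq g); last lra.
by apply: Rmult_le_compat_r; [exact: Rabs_pos | lra].
Qed.

(** At the phase [t2] reached by the second motion, the travel of the first differs from [y] by at
    most the bound of [travel_param_lipschitz]. As it grows at rate at least [/ sqrt M], this error
    in travel becomes an error in phase. *)
Lemma phase_param_lipschitz (y : R) : 0 <= y ->
  Rabs (phase n mu1 a1 c y - phase n mu2 a2 c y) <=
  D * (M * / (m * sqrt m) * y).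
Proof.
move=> y0.
have [m0 [M0 [sm sM]]] := pinched_pos P1.
set t1 := phase n mu1 a1 c y; set t2 := phase n mu2 a2 c y.
have [b1 b2] := phase_bounds P2 c y0; rewrite (phase_0 P2) Rminus_0_r -/t2 in b1 b2.
have ct2 : c <= t2 by nra.
have L := travel_param_lipschitz ct2.
rewrite (travel_phase P2) in L.
have e1 : travel n mu1 a1 c t1 = y := travel_phase P1 c y.
have E : Rabs (t1 - t2) * / sqrt M <= Rabs (travel n mu1 a1 c t2 - y).
  have := travel_Chasles P1 c t1 t2; rewrite e1 => ->.
  case: (Rle_lt_dec t1 t2) => tt.
    have := travel_bounds P1 tt; have := Rinv_0_lt_compat _ sM.
    by rewrite Rabs_minus_sym => ? ?; rewrite !Rabs_pos_eq; nra.
  have tt' := Rlt_le _ _ tt.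
  have := travel_bounds P1 tt'; have := Rinv_0_lt_compat _ sM.
  have := travel_Chasles P1 t1 t2 t1; rewrite (travel_refl n mu1 a1 t1).
  move=> ch ? ?; rewrite -(Rabs_Ropp (travel _ _ _ _ _)) !Rabs_pos_eq; nra.
have EL := Rle_trans _ _ _ E L.
have D0 : 0 <= D.
  by rewrite /D; have := Rabs_pos (mu1 - mu2); have := Rabs_pos (a1 - a2);
     have := pos_INR n; nra.
have K0 : 0 < / (m * sqrt m) by apply: Rinv_0_lt_compat; nra.
have := Rmult_le_compat_r _ _ _ (Rlt_le _ _ sM) EL.
rewrite (Rmult_assoc _ (/ sqrt M)) Rinv_l ?Rmult_1_r; last lra.
move=> X; apply: Rle_trans X _.
have DK : 0 <= D * / (m * sqrt m) by nra.
have MM := sqrt_sqrt M (Rlt_le _ _ M0).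
have -> : D * (M * / (m * sqrt m) * y) =
  (y * sqrt M) * (D * / (m * sqrt m)) * sqrt M by rewrite -{1}MM; ring.
apply: Rmult_le_compat_r; first lra.
exact: Rmult_le_compat_r.
Qed.

(** Larger [a] means larger [h], by at least [a2 - a1] because [geo >= 1]. The travel saved up to
    [t1] is at least proportional to [t1 - c >= y * sqrt m], and it is spent at speed at least
    [sqrt m]. *)
Lemma phase_param_lower (y : R) : 0 <= y -> mu1 = mu2 -> a1 <= a2 ->
  (a2 - a1) * (m * / (2 * M * sqrt M) * y) <=
  phase n mu2 a2 c y - phase n mu1 a1 c y.
Proof.
move=> y0 mu12 a12.
have [m0 [M0 [sm sM]]] := pinched_pos P1.
set t1 := phase n mu1 a1 c y; set t2 := phase n mu2 a2 c y.
have [b1 b2] := phase_bounds P1 c y0; rewrite (phase_0 P1) Rminus_0_r -/t1 in b1 b2.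
have ct1 : c <= t1 by nra.
have e1 : travel n mu1 a1 c t1 = y := travel_phase P1 c y.
have e2 : travel n mu2 a2 c t2 = y := travel_phase P2 c y.
set K := / (2 * M * sqrt M).
have K0 : 0 < K by apply: Rinv_0_lt_compat; nra.
have L : (t1 - c) * ((a2 - a1) * K) <=
         travel n mu1 a1 c t1 - travel n mu2 a2 c t1.
  have x1 := ex_RInt_slowness P1 c t1; have x2 := ex_RInt_slowness P2 c t1.
  have := RInt_minus _ _ _ _ x1 x2.
  rewrite /minus /plus /opp /= -/(Rminus _ _) /travel => <-.
  have := RInt_const c t1 ((a2 - a1) * K); rewrite /scal /= /mult /= => <-.
  apply: RInt_le => //.
  - exact: ex_RInt_const.
  - exact: (@ex_RInt_minus R_NormedModule).
  move=> s _; rewrite -/(Rminus _ _).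
  have [h1 _] := h_bounds s P1; have [_ h2] := h_bounds s P2.
  have gb := geo_bounds n (sin2_le1 s).
  have dh : h n mu2 a2 s - h n mu1 a1 s = (a2 - a1) * geo n (sin s).
    by rewrite /h mu12; ring.
  have hh : h n mu1 a1 s <= h n mu2 a2 s by nra.
  apply: Rle_trans (inv_sqrt_diff_lower m0 h1 hh h2).
  by rewrite dh; apply: Rmult_le_compat_r; [lra | nra].
have tt : t1 <= t2.
  case: (Rle_lt_dec t1 t2) => // tt; have := travel_lt P2 c tt.
  have : 0 <= (t1 - c) * ((a2 - a1) * K) by apply: Rmult_le_pos; nra.
  by lra.
have := travel_bounds P2 tt; have := travel_Chasles P2 c t1 t2; rewrite e2 => ch [_ tb].
have H : (t1 - c) * ((a2 - a1) * K) <= (t2 - t1) * / sqrt m by lra.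
have := Rmult_le_compat_r _ _ _ (Rlt_le _ _ sm) H.
rewrite (Rmult_assoc _ (/ sqrt m)) Rinv_l ?Rmult_1_r; last lra.
move=> X; apply: Rle_trans X.
have mm := sqrt_sqrt m (Rlt_le _ _ m0).
have aK : 0 <= (a2 - a1) * K by nra.
have -> : (a2 - a1) * (m * K * y) = (y * sqrt m) * ((a2 - a1) * K) * sqrt m.
  by rewrite -{1}mm; ring.
apply: Rmult_le_compat_r; first lra.
exact: Rmult_le_compat_r.
Qed.

End Compare.

(* [a = nu * alpha ^ (2 * sigma)]; the parameter set P is the set where the
   speed of the phase stays positive. *)
Definition stiffness (nu : R) (n : nat) (alpha : R) : R := nu * (alpha ^ 2) ^ n.

Lemma nonneg_power_ge0 (x y : R) : 0 <= nonneg_power x y.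
Proof.
rewrite /nonneg_power; case: Req_EM_T => [x0|x0]; first exact: Rle_refl.
by apply: Rlt_le; apply: exp_pos.
Qed.

Lemma nonneg_power_lt (n : nat) (x al : R) : (0 < n)%N -> 0 <= x -> 0 < al ->
  nonneg_power x (1 / (2 * INR n)) < al <-> x < (al ^ 2) ^ n.
Proof.
move=> n0 x0 al0.
have n0' : 0 < INR n by apply: lt_0_INR; apply/ssrnat.ltP.
have pw : (al ^ 2) ^ n = Rpower al (2 * INR n).
  by rewrite -pow_mult -Rpower_pow // mult_INR.
rewrite /nonneg_power pw; case: Req_EM_T => [xe|xn0].
  by split=> // _; rewrite xe; apply: exp_pos.
have x0' : 0 < x by lra.
have e : x = Rpower (Rpower x (1 / (2 * INR n))) (2 * INR n).
  rewrite Rpower_mult (_ : 1 / (2 * INR n) * (2 * INR n) = 1) ?Rpower_1 //.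
  by field; lra.
have y0 : 0 < Rpower x (1 / (2 * INR n)) by apply: exp_pos.
move: (Rpower x (1 / (2 * INR n))) e y0 => y e y0.
split=> H.
  by rewrite e; apply: Rlt_Rpower_l; [lra | split].
case: (Rlt_le_dec y al) => // H'.
have := Rle_Rpower_l al y (2 * INR n).
by rewrite -e; lra.
Qed.

Lemma nonneg_power_gt (n : nat) (x al : R) : (0 < n)%N -> 0 <= x -> 0 < al ->
  al < nonneg_power x (1 / (2 * INR n)) <-> (al ^ 2) ^ n < x.
Proof.
move=> n0 x0 al0.
have n0' : 0 < INR n by apply: lt_0_INR; apply/ssrnat.ltP.
have pw : (al ^ 2) ^ n = Rpower al (2 * INR n).
  by rewrite -pow_mult -Rpower_pow // mult_INR.
have al0' : 0 < (al ^ 2) ^ n by rewrite pw; apply: exp_pos.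
rewrite /nonneg_power; case: Req_EM_T => [xe|xn0].
  by rewrite /is_left; split=> ?; lra.
rewrite pw.
have x0' : 0 < x by lra.
have e : x = Rpower (Rpower x (1 / (2 * INR n))) (2 * INR n).
  rewrite Rpower_mult (_ : 1 / (2 * INR n) * (2 * INR n) = 1) ?Rpower_1 //.
  by field; lra.
have y0 : 0 < Rpower x (1 / (2 * INR n)) by apply: exp_pos.
move: (Rpower x (1 / (2 * INR n))) e y0 => y e y0.
split=> H.
  by rewrite e; apply: Rlt_Rpower_l; [lra | split].
case: (Rlt_le_dec al y) => // H'.
have := Rle_Rpower_l y al (2 * INR n).
by rewrite -e; lra.
Qed.

(** The last two inequalities are positivity of [h] at a zero of the wave, where [geo] is [1], and
    at a peak, where it is [n + 1]. For [nu > 0] the first is binding and gives [alpha_0]; for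
    [nu < 0] the second is, gives [alpha_c] and forces [mu > 0]. *)
Lemma in_P_iff (nu : R) (n : nat) (mu al : R) : nu <> 0 -> (0 < n)%N ->
  in_P nu n mu al <->
  [/\ 0 < al, 0 < mu + stiffness nu n al &
      0 < mu + (INR n + 1) * stiffness nu n al].
Proof.
move=> nu0 n0.
have n0' : 0 < INR n by apply: lt_0_INR; apply/ssrnat.ltP.
rewrite /stiffness.
have pw a : 0 < a -> 0 < (a ^ 2) ^ n by move=> a0; apply: pow_lt; nra.
split.
- case=> [[nup H]|[num [mu0 [al0 alc]]]].
    have al0 : 0 < al.
      case: H => [[//]|[_ H]]; apply: Rle_lt_trans H.
      exact: nonneg_power_ge0.
    have A0 := pw _ al0.
    have K : 0 < mu + nu * (al ^ 2) ^ n.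
      case: H => [[mu0 _]|[mu0 H]]; first by nra.
      move: H; rewrite /alpha_0 nonneg_power_lt //; last exact: Rabs_pos.
      rewrite Rabs_div // (Rabs_pos_eq nu); last lra.
      rewrite Rabs_left1 // => H.
      have := Rmult_lt_compat_l _ _ _ nup H.
      by rewrite (_ : nu * (- mu / nu) = - mu); [lra | field].
    split=> //; have : 0 < nu * (al ^ 2) ^ n by nra.
    by nra.
  move: alc; rewrite /alpha_c nonneg_power_gt //; last exact: Rabs_pos.
  have d0 : (INR n + 1) * nu < 0 by nra.
  rewrite Rabs_div; last lra.
  rewrite (Rabs_left _ d0) Rabs_pos_eq; last lra.
  move=> H; have d1 : 0 < - ((INR n + 1) * nu) by lra.
  have := Rmult_lt_compat_l _ _ _ d1 H.
  rewrite (_ : _ * (mu / _) = mu); last by field; lra.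
  have := pw _ al0 => A0 H'.
  have : nu * (al ^ 2) ^ n < 0 by nra.
  by split; nra.
- move=> [al0 h1 h2]; have A0 := pw _ al0.
  case: (Rlt_le_dec 0 nu) => nu1.
    left; split=> //; case: (Rlt_le_dec 0 mu) => mu0; [by left|right].
    split=> //; rewrite /alpha_0 nonneg_power_lt //; last exact: Rabs_pos.
    rewrite Rabs_div // (Rabs_pos_eq nu); last lra.
    rewrite Rabs_left1 //.
    apply: (Rmult_lt_reg_l nu) => //.
    by rewrite (_ : nu * (- mu / nu) = - mu); [lra | field].
  have nu2 : nu < 0 by lra.
  have : nu * (al ^ 2) ^ n < 0 by nra.
  right; split=> //; split; first by nra.
  split=> //; rewrite /alpha_c nonneg_power_gt //; last exact: Rabs_pos.
  have d0 : (INR n + 1) * nu < 0 by nra.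
  rewrite Rabs_div; last lra.
  rewrite (Rabs_left _ d0) Rabs_pos_eq; last by nra.
  have d1 : 0 < - ((INR n + 1) * nu) by lra.
  apply: (Rmult_lt_reg_l _ _ _ d1).
  rewrite (_ : _ * (mu / _) = mu); last by field; lra.
  by lra.
Qed.

Lemma in_P_pinched (nu : R) (n : nat) (mu al : R) : nu <> 0 -> (0 < n)%N ->
  in_P nu n mu al ->
  exists m M, pinched n m M mu (stiffness nu n al).
Proof.
move=> nu0 n0 /in_P_iff [] // al0 h1 h2.
exists (Rmin (mu + stiffness nu n al) (mu + (INR n + 1) * stiffness nu n al)).
exists (Rmax (mu + stiffness nu n al) (mu + (INR n + 1) * stiffness nu n al)).
by split; [apply: Rmin_pos | split; [apply: Rmin_l | apply: Rmax_l]
  | split; [apply: Rmin_r | apply: Rmax_r]].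
Qed.

(** * Explicit zero-attaining solutions *)

Lemma pow_odd (x : R) (n : nat) : x ^ (2 * n + 1) = x * (x ^ 2) ^ n.
Proof. by rewrite addn1 -pow_mult. Qed.

Definition bc_phase (b : boundary_condition) : R :=
  match b with Dirichlet => 0 | Neumann => PI / 2 end.

Lemma bc_phase_bounds (b : boundary_condition) : 0 <= bc_phase b <= PI / 2.
Proof. by have := PI_RGT_0; case: b => /=; lra. Qed.

(** [y] is the distance from the boundary vertex, so the phase starts at [0] or [PI / 2] there and
    increases towards the centre. Hence the minus sign in [wave_slope], a derivative in [x]. *)
Definition wave_phase (nu : R) (n : nat) (b : boundary_condition)
    (mu al y : R) : R :=
  phase n mu (stiffness nu n al) (bc_phase b) y.

Definition wave (nu : R) (n : nat) (b : boundary_condition)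
    (l mu al x : R) : R :=
  al * sin (wave_phase nu n b mu al (l - x)).

Definition wave_slope (nu : R) (n : nat) (b : boundary_condition)
    (l mu al x : R) : R :=
  let t := wave_phase nu n b mu al (l - x) in
  - (al * cos t * sqrt (h n mu (stiffness nu n al) t)).

Definition force (nu : R) (n : nat) (mu r : R) : R :=
  - (mu * r) - (INR n + 1) * nu * (r * (r ^ 2) ^ n).

Lemma force_opp (nu : R) (n : nat) (mu r : R) :
  force nu n mu (- r) = - force nu n mu r.
Proof.
rewrite /force (_ : (- r) ^ 2 = r ^ 2); last by ring.
by ring.
Qed.

Lemma is_derive_h (n : nat) (mu a t : R) :
  is_derive (h n mu a) t (a * (geo' n (sin t) * cos t)).
Proof.
have D : is_derive (fun t => geo n (sin t)) t (scal (cos t) (geo' n (sin t))).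
  apply: (is_derive_comp (geo n) sin); first exact: is_derive_geo.
  exact: is_derive_sin.
have := is_derive_plus (fun _ => mu) (fun t => scal a (geo n (sin t))) t _ _
  (is_derive_const mu t) (is_derive_scal _ t a _ D).
rewrite /plus /scal /zero /= /mult /= Rplus_0_l => K.
by rewrite Rmult_comm (Rmult_comm (geo' _ _)) -Rmult_comm.
Qed.

Section Wave.

Variables (nu : R) (n : nat) (b : boundary_condition) (l mu al m M : R).
Hypothesis P : pinched n m M mu (stiffness nu n al).

Let th := wave_phase nu n b mu al.
Let u := wave nu n b l mu al.
Let u' := wave_slope nu n b l mu al.

Lemma is_derive_wave_phase (x : R) :
  is_derive (fun x => th (l - x)) x
    (- sqrt (h n mu (stiffness nu n al) (th (l - x)))).
Proof.
have D : is_derive (fun x => l - x) x (-1).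
  by auto_derive => //; ring.
have := is_derive_comp th _ x _ _ (is_derive_phase P (bc_phase b) (l - x)) D.
by rewrite /scal /= /mult /= -/(wave_phase _ _ _ _ _ _) -/th Rmult_comm
  -Ropp_mult_distr_r Rmult_1_r.
Qed.

Lemma is_derive_wave (x : R) : is_derive u x (u' x).
Proof.
have D : is_derive (fun t => al * sin t) (th (l - x)) (al * cos (th (l - x))).
  by auto_derive => //; ring.
have := is_derive_comp _ _ x _ _ D (is_derive_wave_phase x).
rewrite /scal /= /mult /= => K.
rewrite /u' /wave_slope -/(th (l - x)).
by rewrite (_ : - _ = - sqrt (h n mu (stiffness nu n al) (th (l - x))) *
  (al * cos (th (l - x)))) //; ring.
Qed.

(** The chain rule gives [- al * (sin t * h - cos t * h' / 2)], where the derivative [h'] of [h] in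
    the phase carries another factor [cos t]. After [cos ^ 2 = 1 - sin ^ 2] the combination of [geo]
    and [geo'] is the left side of [geo_ode]. *)
Lemma is_derive_wave_slope (x : R) : is_derive u' x (force nu n mu (u x)).
Proof.
set t := th (l - x).
have h0 := h_gt0 t P.
have s0 := sqrt_lt_R0 _ h0.
have Dh := is_derive_sqrt _ _ _ (is_derive_h n mu (stiffness nu n al) t) h0.
have Dc : is_derive (fun t => - (al * cos t)) t (al * sin t).
  by auto_derive => //; ring.
have := is_derive_mult _ _ t _ _ Dc Dh Rmult_comm.
rewrite /plus /mult /= => Dm.
have := is_derive_comp
  (fun s => - (al * cos s) * sqrt (h n mu (stiffness nu n al) s))
  (fun x => th (l - x)) x _ _ Dm (is_derive_wave_phase x).
rewrite /scal /= /mult /= -/t => K.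
have -> : force nu n mu (u x) =
  - sqrt (h n mu (stiffness nu n al) t) *
  (al * sin t * sqrt (h n mu (stiffness nu n al) t) +
   - (al * cos t) * (stiffness nu n al * (geo' n (sin t) * cos t) /
     (2 * sqrt (h n mu (stiffness nu n al) t)))).
  have e := geo_ode n (sin t).
  have c2 : cos t ^ 2 = 1 - sin t ^ 2.
    by have := sin2_cos2 t; rewrite /Rsqr /=; lra.
  transitivity (- (al * sin t * (mu + stiffness nu n al * geo n (sin t))) +
     al * stiffness nu n al * (/ 2 * cos t ^ 2 * geo' n (sin t))).
    transitivity (- mu * (al * sin t) + al * stiffness nu n al *
      (- sin t * geo n (sin t) + / 2 * (1 - sin t ^ 2) * geo' n (sin t))).
      rewrite e /force /u /wave -/(th (l - x)) -/t /stiffness.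
      by rewrite Rpow_mult_distr Rpow_mult_distr; ring.
    by rewrite c2; ring.
  transitivity (- (al * sin t * (sqrt (h n mu (stiffness nu n al) t) *
       sqrt (h n mu (stiffness nu n al) t))) +
     al * stiffness nu n al * (/ 2 * cos t ^ 2 * geo' n (sin t))).
    by rewrite sqrt_sqrt; [rewrite /h | lra].
  by field; lra.
apply: is_derive_ext K => s; rewrite /u' /wave_slope.
exact: esym (Ropp_mult_distr_l _ _).
Qed.

Lemma continuous_wave (x : R) : continuous u x.
Proof. by apply: ex_derive_continuous; exists (u' x); apply: is_derive_wave. Qed.

Lemma continuous_force (r : R) : continuous (force nu n mu) r.
Proof. by apply: ex_derive_continuous; rewrite /force; auto_derive. Qed.

Lemma signed_wave_solves (D : R -> Prop) (e : R) (g : R -> R) :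
  e = 1 \/ e = -1 ->
  (forall x, D x -> perfect_at D x) -> (forall x, D x -> g x = e * u x) ->
  solves_on nu n D mu g /\ (forall x, D x -> Derive_on D g x = e * u' x).
Proof.
move=> He Hp Hg.
have fe r : force nu n mu (e * r) = e * force nu n mu r.
  case: He => ->; first by rewrite !Rmult_1_l.
  by rewrite -!Ropp_mult_distr_l !Rmult_1_l force_opp.
have [C2 E1 E2] := @C2_on_restriction D (fun x => e * u x) (fun x => e * u' x)
  (fun x => force nu n mu (e * u x)) g Hp
  (fun x _ => is_derive_scal _ _ _ _ (is_derive_wave x))
  (fun x _ => eq_ind_r (is_derive _ x)
     (is_derive_scal _ _ _ _ (is_derive_wave_slope x)) (fe (u x)))
  (fun x _ => continuous_comp (fun x => e * u x) (force nu n mu) x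
     (continuous_scal_r e u x (@continuous_wave x)) (@continuous_force _)) Hg.
split=> //; split=> // x Dx.
by rewrite E2 // pow_odd Hg // /force; ring.
Qed.

End Wave.

(** * Solutions on the ray *)

Lemma is_sign_abs (e r : R) : e = 1 \/ e = -1 -> Rabs (e * r) = Rabs r.
Proof.
by case=> ->; [rewrite Rmult_1_l | rewrite -Ropp_mult_distr_l Rmult_1_l Rabs_Ropp].
Qed.

Section Ray.

Variables (nu : R) (n : nat) (b : boundary_condition) (l mu al m M : R).
Hypothesis P : pinched n m M mu (stiffness nu n al).
Hypothesis al0 : 0 < al.

Let a := stiffness nu n al.
Let c := bc_phase b.
Let u := wave nu n b l mu al.
Let u' := wave_slope nu n b l mu al.

Lemma wave_le (x : R) : Rabs (u x) <= al.
Proof.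
rewrite /u /wave Rabs_mult Rabs_pos_eq; last lra.
set t := wave_phase _ _ _ _ _ _; have := SIN_bound t => ?.
have : Rabs (sin t) <= 1 by apply: Rabs_le.
by nra.
Qed.

Lemma wave_at_travel (t : R) : u (l - travel n mu a c t) = al * sin t.
Proof.
rewrite /u /wave /wave_phase; congr (_ * sin _).
rewrite (_ : l - (l - travel n mu a c t) = travel n mu a c t); last by ring.
exact: phase_travel P _ _.
Qed.

Lemma travel_ge0 (t : R) : c <= t -> 0 <= travel n mu a c t.
Proof. by move=> ct; rewrite -(travel_refl n mu a c); apply: (travel_le P). Qed.

Lemma wave_end : u l = al * sin c /\ u' l = - (al * cos c * sqrt (h n mu a c)).
Proof.
by rewrite /u /u' /wave /wave_slope /wave_phase Rminus_diag (phase_0 P).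
Qed.

Lemma signed_wave_ray (e : R) (g : R -> R) : e = 1 \/ e = -1 ->
  (forall x, left_ray l x -> g x = e * u x) ->
  ray_solution nu n l b mu al g.
Proof.
move=> He Hg.
have [S D] := signed_wave_solves P He (@perfect_left_ray l) Hg.
have ll : left_ray l l by rewrite /left_ray; lra.
have Dl : Derive_on (left_ray l) g l = e * u' l := D l ll.
have [w1 w2] := wave_end.
have cb := bc_phase_bounds b; have pi0 := PI_RGT_0.
have ray t : c <= t -> left_ray l (l - travel n mu a c t).
  by move=> ct; have := travel_ge0 ct; rewrite /left_ray; lra.
split=> //.
- rewrite /satisfies_bc; move: w1 w2; rewrite /c; case: b => /= w1 w2.
    by rewrite Hg // w1 sin_0; ring.
  by rewrite Dl w2 cos_PI2; ring.
- exists (travel n mu a c (c + 2 * PI)).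
    by rewrite -(travel_refl n mu a c); apply: (travel_lt P); lra.
  move=> x xl; rewrite !Hg //; last first.
    by have := @travel_ge0 (c + 2 * PI); move: xl; rewrite /left_ray; lra.
  rewrite /u /wave /wave_phase; congr (_ * (_ * _)).
  rewrite (_ : l - (x - _) = l - x + travel n mu a c (c + 2 * PI)); last by ring.
  by rewrite (phase_periodic P) sin_plus cos_2PI sin_2PI; ring.
- exists (l - travel n mu a c PI); first by apply: ray; rewrite /c; lra.
  by rewrite Hg ?wave_at_travel ?sin_PI; [ring | apply: ray; rewrite /c; lra].
- apply: (@sup_norm_attained _ _ _ (l - travel n mu a c (PI / 2))).
  + by move=> x xl; rewrite Hg // is_sign_abs //; apply: wave_le.
  + by apply: ray; rewrite /c; lra.
  + rewrite Hg; last by apply: ray; rewrite /c; lra.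
    by rewrite is_sign_abs // wave_at_travel sin_PI2 Rmult_1_r Rabs_pos_eq; lra.
Qed.

Lemma signed_wave_sup_segment (e : R) (g : R -> R) : e = 1 \/ e = -1 ->
  PI / 2 <= wave_phase nu n b mu al l ->
  (forall x, segment l x -> g x = e * u x) -> sup_norm (segment l) g = al.
Proof.
move=> He Hl Hg.
have cb := bc_phase_bounds b.
have seg : segment l (l - travel n mu a c (PI / 2)).
  have := @travel_ge0 (PI / 2).
  have := travel_le P c Hl; rewrite /wave_phase (travel_phase P).
  by rewrite /segment /a /c; lra.
apply: (@sup_norm_attained _ _ _ (l - travel n mu a c (PI / 2))) => //.
  by move=> x xl; rewrite Hg // is_sign_abs //; apply: wave_le.
by rewrite Hg // is_sign_abs // wave_at_travel sin_PI2 Rmult_1_r Rabs_pos_eq; lra.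
Qed.

(** Along solutions [U1 ^ 2 + potential U] is conserved. *)
Definition potential (nu : R) (n : nat) (mu r : R) : R :=
  mu * r ^ 2 + nu * (r ^ 2 * (r ^ 2) ^ n).

(** [geo_closed_form] extracts the factor [cos t ^ 2] from the difference of the powers; this
    factorisation is what makes the ansatz [al * sin t] work. *)
Lemma potential_drop (t : R) :
  potential nu n mu al - potential nu n mu (al * sin t) =
  (al * cos t) ^ 2 * h n mu a t.
Proof.
have c2 : cos t ^ 2 = 1 - sin t ^ 2.
  by have := sin2_cos2 t; rewrite /Rsqr /=; lra.
have e := geo_closed_form n (sin t).
rewrite /potential /h /a /stiffness (_ : (al * sin t) ^ 2 = al ^ 2 * sin t ^ 2);
  last by ring.
rewrite (_ : (al * cos t) ^ 2 = al ^ 2 * cos t ^ 2); last by ring.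
rewrite (Rpow_mult_distr (al ^ 2)) c2.
move: ((al ^ 2) ^ n) ((sin t ^ 2) ^ n) (geo n (sin t)) e => A B g e.
transitivity (al ^ 2 * mu * (1 - sin t ^ 2) + al ^ 2 * (nu * A) *
   ((1 - sin t ^ 2) * g)); last by ring.
by rewrite e; ring.
Qed.

(* Shifting by one period extends a ray solution past its endpoint, so that
   all derivatives on the ray become two-sided. *)
Lemma ray_extension (v : R -> R) : ray_solution nu n l b mu al v ->
  exists U U1 : R -> R,
  [/\ forall x, x <= l -> v x = U x,
      forall x, x <= l ->
        is_derive U x (U1 x) /\ is_derive U1 x (force nu n mu (U x)),
      match b with Dirichlet => U l = 0 | Neumann => U1 l = 0 end,
      (forall x, x <= l -> Rabs (U x) <= al) &
      exists2 x, x <= l & Rabs (U x) = al /\ U1 x = 0].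
Proof.
move=> [[C2 eq] bc [T T0 per] _ sup].
pose U x := v (x - T).
pose U1 x := Derive_on (left_ray l) v (x - T).
have near x : x < l + T -> locally (x - T) (left_ray l).
  move=> xl; have e0 : 0 < l - (x - T) by lra.
  exists (mkposreal _ e0) => y.
  rewrite /ball /= /AbsRing_ball /abs /minus /plus /opp /left_ray /=.
  by move/Rabs_def2; lra.
have Dshift x : is_derive (fun x => x - T) x 1 by auto_derive => //; ring.
have D1 x : x < l + T -> is_derive U x (U1 x).
  move=> xl; have rx : left_ray l (x - T) by rewrite /left_ray; lra.
  have [d1 _ _] := C2 _ rx.
  have := is_derive_comp v (fun x => x - T) x _ _ (D_in_is_derive d1 (near _ xl))
    (Dshift x).
  by rewrite /scal /= /mult /= Rmult_1_l.
have D2 x : x < l + T -> is_derive U1 x (force nu n mu (U x)).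
  move=> xl; have rx : left_ray l (x - T) by rewrite /left_ray; lra.
  have [_ d2 _] := C2 _ rx.
  have := is_derive_comp (Derive_on (left_ray l) v) (fun x => x - T) x _ _
    (D_in_is_derive d2 (near _ xl)) (Dshift x).
  rewrite /scal /= /mult /= Rmult_1_l.
  have := eq _ rx; rewrite pow_odd => e.
  by rewrite (_ : Derive2_on _ _ _ = force nu n mu (U x)) // /force /U; lra.
have vU x : x <= l -> v x = U x by move=> xl; rewrite /U per.
have perU x : x < l + T -> U (x - T) = U x.
  by move=> xl; rewrite {2}/U vU //; lra.
(* [U ^ 2] has a maximum on one compact period, and periodicity makes it a maximum over all of
   [x < l + T]. There [X <= l] is an interior point, so [U1 X = 0] even when [X = l]. *)
have [X [XM XI]] : exists X, (forall x, l - T <= x <= l -> U x ^ 2 <= U X ^ 2) /\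
    l - T <= X <= l.
  apply: continuity_ab_maj; first lra.
  move=> x xI; apply/continuity_pt_filterlim.
  apply: (continuous_comp U (fun y => y ^ 2)).
    by apply: ex_derive_continuous; exists (U1 x); apply: D1; lra.
  by apply: ex_derive_continuous; auto_derive.
have XM' k x : l - INR k.+1 * T <= x <= l -> U x ^ 2 <= U X ^ 2.
  elim: k x => [|k IH] x xI; first by apply: XM; move: xI; rewrite /=; lra.
  case: (Rle_lt_dec (l - T) x) => xT; first by apply: XM; lra.
  rewrite -(_ : U (x + T - T) = U x); last by congr U; ring.
  rewrite perU; last lra.
  by apply: IH; move: xI; rewrite !S_INR; lra.
have XMall x : x < l + T -> U x ^ 2 <= U X ^ 2.
  move=> xl; rewrite -perU //.
  have [k Hk] := INR_unbounded ((l - (x - T)) / T).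
  apply: (XM' k); split; last lra.
  have := Rmult_lt_compat_r _ _ _ T0 Hk.
  rewrite (_ : (l - (x - T)) / T * T = l - (x - T)); last by field; lra.
  by rewrite S_INR; lra.
have UX : Rabs (U X) = al.
  rewrite -sup; symmetry; apply: (@sup_norm_attained _ _ _ X).
  - move=> x xl; rewrite vU //; apply: Rsqr_le_abs_0.
    by have := XMall x; rewrite /Rsqr /=; rewrite /left_ray in xl; lra.
  - by rewrite /left_ray; lra.
  - by rewrite vU //; lra.
exists U, U1; split=> //.
- by move=> x xl; split; [apply: D1 | apply: D2]; lra.
- move: bc; rewrite /satisfies_bc; case: b => bc; first by rewrite -vU //; lra.
  rewrite -bc; symmetry; apply: Derive_on_unique.
    by apply: perfect_left_ray; rewrite /left_ray; lra.
  apply: (is_derive_D_in (D1 l _)); try by rewrite /left_ray; lra.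
  exact: vU.
- move=> x xl; rewrite -UX; apply: Rsqr_le_abs_0.
  by have := XMall x; rewrite /Rsqr /=; lra.
- exists X; first lra; split=> //.
  have lX : l - T - 1 < X by lra.
  have Xl : X < l + T by lra.
  have Dsq : is_derive (fun x => U x ^ 2) X (2 * U1 X * U X).
    by have := is_derive_pow U 2 X _ (D1 X Xl); rewrite /= Rmult_1_r.
  have/is_derive_Reals dsq := Dsq.
  pose pr : derivable_pt (fun x => U x ^ 2) X := exist _ _ dsq.
  have := deriv_maximum (fun x => U x ^ 2) _ _ _ pr lX Xl
     (fun x _ xl => XMall x xl).
  rewrite /pr /derive_pt /= => z.
  case: (Rmult_integral _ _ z) => [z1|z1]; first lra.
  by move: UX; rewrite z1 Rabs_R0; lra.
Qed.

(** Gronwall backwards from [l]: a weighted squared distance of the two states is nondecreasing and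
    vanishes at [l]. *)
Lemma ode_unique (U U1 W W1 : R -> R) :
  (forall x, x <= l -> is_derive U x (U1 x) /\ is_derive U1 x (force nu n mu (U x))) ->
  (forall x, x <= l -> is_derive W x (W1 x) /\ is_derive W1 x (force nu n mu (W x))) ->
  (forall x, x <= l -> Rabs (U x) <= al) -> (forall x, x <= l -> Rabs (W x) <= al) ->
  U l = W l -> U1 l = W1 l -> forall x, x <= l -> U x = W x.
Proof.
move=> HU HW bU bW e0 e1.
(* [force] is polynomial, hence only locally Lipschitz, so the amplitude bounds on both functions
   enter; the constant for its odd power is built by induction on the exponent. *)
have [K [K0 HK]] : exists K, 0 <= K /\ forall r s, Rabs r <= al -> Rabs s <= al ->
    Rabs (force nu n mu r - force nu n mu s) <= K * Rabs (r - s).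
  have [K [K0 HK]] : exists K, 0 <= K /\ forall r s, Rabs r <= al -> Rabs s <= al ->
      Rabs (r * (r ^ 2) ^ n - s * (s ^ 2) ^ n) <= K * Rabs (r - s).
    elim: (n) => [|k [K [K0 HK]]].
      exists 1; split; first lra.
      by move=> r s _ _; rewrite /= !Rmult_1_r Rmult_1_l; lra.
    exists (al ^ 2 * K + 2 * al * (al * (al ^ 2) ^ k)).
    have B0 : 0 <= (al ^ 2) ^ k by apply: pow_le; apply: pow2_ge_0.
    split.
      have := pow2_ge_0 al => A2.
      apply: Rplus_le_le_0_compat; first exact: Rmult_le_pos.
      by apply: Rmult_le_pos; [lra | apply: Rmult_le_pos; lra].
    move=> r s hr hs.
    set p := s * (s ^ 2) ^ k.
    have pb : Rabs p <= al * (al ^ 2) ^ k.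
      rewrite /p Rabs_mult; apply: Rmult_le_compat => //; try exact: Rabs_pos.
      rewrite -RPow_abs -[Rabs (s ^ 2)]RPow_abs; apply: pow_incr; split.
        by apply: pow2_ge_0.
      by apply: pow_incr; split=> //; exact: Rabs_pos.
    have -> : r * (r ^ 2) ^ k.+1 - s * (s ^ 2) ^ k.+1 =
      r ^ 2 * (r * (r ^ 2) ^ k - p) + (r - s) * ((r + s) * p).
      by rewrite /p /=; ring.
    apply: Rle_trans (Rabs_triang _ _) _.
    rewrite [X in _ <= X]Rmult_plus_distr_r; apply: Rplus_le_compat.
      rewrite Rabs_mult Rmult_assoc; apply: Rmult_le_compat; try exact: Rabs_pos.
        rewrite -RPow_abs; apply: pow_incr; split=> //; exact: Rabs_pos.
      exact: HK.
    rewrite Rabs_mult Rmult_comm; apply: Rmult_le_compat_r; first exact: Rabs_pos.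
    rewrite Rabs_mult; apply: Rmult_le_compat => //; try exact: Rabs_pos.
    by apply: Rle_trans (Rabs_triang _ _) _; lra.
  exists (Rabs mu + Rabs ((INR n + 1) * nu) * K); split.
    by have := Rabs_pos mu; have := Rabs_pos ((INR n + 1) * nu); nra.
  move=> r s hr hs; rewrite /force.
  have -> : - (mu * r) - (INR n + 1) * nu * (r * (r ^ 2) ^ n) -
     (- (mu * s) - (INR n + 1) * nu * (s * (s ^ 2) ^ n)) =
     - (mu * (r - s) + (INR n + 1) * nu * (r * (r ^ 2) ^ n - s * (s ^ 2) ^ n)) by ring.
  rewrite Rabs_Ropp; apply: Rle_trans (Rabs_triang _ _) _.
  rewrite [X in _ <= X]Rmult_plus_distr_r Rabs_mult; apply: Rplus_le_compat_l.
  rewrite Rabs_mult Rmult_assoc; apply: Rmult_le_compat_l; first exact: Rabs_pos.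
  exact: HK.
move=> x xl.
pose w t := U t - W t; pose w1 t := U1 t - W1 t.
(* The weight absorbs the growth: [2 * w * w1 + 2 * w1 * f] is at least
   [- (1 + K) * (w ^ 2 + w1 ^ 2)], since [|f| <= K * |w|]. *)
pose E t := (w t ^ 2 + w1 t ^ 2) * exp ((1 + K) * t).
pose f t := force nu n mu (U t) - force nu n mu (W t).
pose E' t := ((2 * w t * w1 t + 2 * w1 t * f t) +
  (1 + K) * (w t ^ 2 + w1 t ^ 2)) * exp ((1 + K) * t).
have DE t : t <= l -> is_derive E t (E' t).
  move=> tl; have [u0 u1] := HU t tl; have [w0 w11] := HW t tl.
  have d0 : is_derive w t (w1 t) := is_derive_minus _ _ _ _ _ u0 w0.
  have d1 : is_derive w1 t (f t) := is_derive_minus _ _ _ _ _ u1 w11.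
  rewrite /E /E'; auto_derive.
    by do !split=> //; [exists (w1 t) | exists (f t)].
  by rewrite (is_derive_unique _ _ _ d0) (is_derive_unique _ _ _ d1); ring.
have E'0 t : t <= l -> 0 <= E' t.
  move=> tl; apply: Rmult_le_pos; last by apply: Rlt_le; apply: exp_pos.
  have := HK _ _ (bU t tl) (bW t tl); rewrite -/(f t) -/(w t) => fb.
  have [fb1 fb2] := Rabs_le_between' (f t) 0 (K * Rabs (w t)).
  rewrite Rminus_0_r in fb1; have {fb1 fb2} fb3 := fb1 fb.
  case: (Rle_lt_dec 0 (w t)) => w0.
    rewrite (Rabs_pos_eq _ w0) in fb3.
    case: (Rle_lt_dec 0 (w1 t)) => w10.
      have : - (K * w t) * w1 t <= f t * w1 t by nra.
      have := pow2_ge_0 (w t + w1 t); have := pow2_ge_0 (w t - w1 t); nra.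
    have : (K * w t) * w1 t <= f t * w1 t by nra.
    have := pow2_ge_0 (w t + w1 t); have := pow2_ge_0 (w t - w1 t); nra.
  rewrite (Rabs_left _ w0) in fb3.
  case: (Rle_lt_dec 0 (w1 t)) => w10.
    have : (K * w t) * w1 t <= f t * w1 t by nra.
    have := pow2_ge_0 (w t + w1 t); have := pow2_ge_0 (w t - w1 t); nra.
  have : - (K * w t) * w1 t <= f t * w1 t by nra.
  have := pow2_ge_0 (w t + w1 t); have := pow2_ge_0 (w t - w1 t); nra.
have [|t|cc [ccI mvt]] := MVT_gen E x l E'.
- move=> t; rewrite Rmax_right // => tI; apply: DE; lra.
- rewrite Rmax_right // => tI; apply/continuity_pt_filterlim.
  by apply: ex_derive_continuous; exists (E' t); apply: DE; lra.
rewrite Rmax_right // in ccI.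
have El : E l = 0 by rewrite /E /w /w1 e0 e1; ring.
have Ex : E x <= 0.
  have : 0 <= E' cc * (l - x) by apply: Rmult_le_pos; [apply: E'0 |]; lra.
  by lra.
have ex0 := exp_pos ((1 + K) * x).
have s0 : w x ^ 2 + w1 x ^ 2 <= 0.
  case: (Rle_lt_dec (w x ^ 2 + w1 x ^ 2) 0) => // s0.
  by have := Rmult_lt_0_compat _ _ s0 ex0; rewrite -/(E x); lra.
have : w x ^ 2 = 0 by have := pow2_ge_0 (w x); have := pow2_ge_0 (w1 x); lra.
rewrite /w => z; have : U x - W x = 0 by nra.
by lra.
Qed.

(** At a peak the slope vanishes, so the conserved energy is [potential al]. At [l] the boundary
    condition leaves a single unknown, whose absolute value the energy determines; only a sign [e]
    remains, and [ode_unique] propagates it along the ray. *)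
Lemma ray_unique (v : R -> R) : ray_solution nu n l b mu al v ->
  exists e, (e = 1 \/ e = -1) /\ forall x, left_ray l x -> v x = e * u x.
Proof.
move=> Hv; have [U [U1 [vU DU bcU leU [X XI [UX U1X]]]]] := ray_extension Hv.
pose E x := U1 x ^ 2 + potential nu n mu (U x).
have DE x : x <= l -> is_derive E x 0.
  move=> xl; have [d0 d1] := DU x xl.
  rewrite /E /potential; auto_derive.
    by do !split=> //; [exists (force nu n mu (U x)) | exists (U1 x)..].
  rewrite (is_derive_unique _ _ _ d0) (is_derive_unique _ _ _ d1) /force.
  case: (n) => [|k]; first by rewrite /=; ring.
  by rewrite [Nat.pred _]/= S_INR [_ ^ k.+1]/=; ring.
have El : E l = E X.
  have [|t|cc [ccI mvt]] := MVT_gen E X l (fun _ => 0).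
  - by move=> t; rewrite Rmax_right // => tI; apply: DE; lra.
  - rewrite Rmax_right // => tI; apply/continuity_pt_filterlim.
    by apply: ex_derive_continuous; exists 0; apply: DE; lra.
  by lra.
have pev r s : Rabs r = s -> potential nu n mu r = potential nu n mu s.
  move=> <-; rewrite /potential RPow_abs (Rabs_pos_eq (r ^ 2)) //.
  exact: pow2_ge_0.
have EX : E X = potential nu n mu al.
  by rewrite /E U1X (pev _ _ UX); ring.
have {El EX} El : U1 l ^ 2 + potential nu n mu (U l) = potential nu n mu al.
  by rewrite -EX -El.
have [w1 w2] := wave_end.
have ll : l <= l by lra.
have [e [He [e0 e1]]] : exists e, (e = 1 \/ e = -1) /\
    (U l = e * u l /\ U1 l = e * u' l).
  have sq r s : r ^ 2 = s ^ 2 -> exists e, (e = 1 \/ e = -1) /\ r = e * s.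
    move=> rs; have : (r - s) * (r + s) = 0 by nra.
    case/Rmult_integral => z; [exists 1 | exists (-1)]; split; lra.
  rewrite w1 w2; move: bcU; rewrite /c; case: b => /= bcU.
    have p0 : potential nu n mu 0 = 0 by rewrite /potential /=; ring.
    have := potential_drop 0; rewrite sin_0 cos_0 Rmult_0_r p0 Rmult_1_r => pd.
    rewrite bcU p0 in El.
    have [|e [He e1]] := sq (U1 l) (- (al * sqrt (h n mu a 0))).
      rewrite (_ : (- (al * sqrt (h n mu a 0))) ^ 2 =
        al ^ 2 * (sqrt (h n mu a 0) * sqrt (h n mu a 0))); last by ring.
      rewrite sqrt_sqrt; last by apply: Rlt_le; exact: (h_gt0 0 P).
      by lra.
    by exists e; do !split=> //; rewrite bcU; ring.
  rewrite bcU in El.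
  (* Neumann end: with [U l = al * sin t] and zero slope, the drop in [potential_drop] is zero, and
     [h > 0] forces [cos t = 0], that is [|U l| = al]. *)
  have rb : -1 <= U l / al <= 1.
    have [lo hi] := Rabs_le_between (U l) al; have {lo hi} := lo (leU l ll).
    by move=> [? ?]; split; apply: (Rmult_le_reg_r al) => //; field_simplify; lra.
  have Us : U l = al * sin (asin (U l / al)) by rewrite sin_asin //; field; lra.
  have := potential_drop (asin (U l / al)); rewrite -Us.
  set t := asin _ => pd.
  have z : (al * cos t) ^ 2 * h n mu a t = 0 by lra.
  have cz : al * cos t = 0.
    case: (Rmult_integral _ _ z); first by nra.
    by have := h_gt0 t P; rewrite -/a; lra.
  have cz' : cos t = 0 by case: (Rmult_integral _ _ cz) => //; lra.
  have [|e [He e1]] := sq (U l) al.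
    rewrite Us -/t; have := sin2_cos2 t; rewrite cz' /Rsqr => s1.
    transitivity (al ^ 2 * (sin t * sin t + 0 * 0)); first by ring.
    by rewrite s1; ring.
  exists e; do !split=> //; first by rewrite sin_PI2; lra.
  by rewrite bcU cos_PI2; ring.
exists e; split=> // x xl; rewrite vU //.
apply: (ode_unique (W := fun x => e * u x) (W1 := fun x => e * u' x) DU) => //.
- move=> y yl; split; first exact: (is_derive_scal u y e (u' y) (is_derive_wave b l P y)).
  have := is_derive_scal u' y e _ (is_derive_wave_slope b l P y).
  rewrite -/u; case: He => ->; first by rewrite !Rmult_1_l.
  by rewrite -!Ropp_mult_distr_l !Rmult_1_l force_opp.
- by move=> y yl; rewrite is_sign_abs //; apply: wave_le.
Qed.

End Ray.

(** * Solving the vertex conditions *)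

Definition near (r x0 x : R) : Prop := Rabs (x - x0) < r.

Lemma nearP (r x0 x : R) : near r x0 x <-> x0 - r < x < x0 + r.
Proof.
rewrite /near; split; first by move/Rabs_def2; lra.
by move=> ?; apply: Rabs_def1; lra.
Qed.

Lemma locally_pair (T U : UniformSpace) (x : T) (y : U) (Q : T * U -> Prop) :
  locally (x, y) Q -> exists e : posreal,
    forall x' y', ball x e x' -> ball y e y' -> Q (x', y').
Proof. by move=> [e He]; exists e => x' y' ? ?; apply: He. Qed.

Lemma ball_near (x y e : R) : ball x e y <-> near e x y.
Proof. by []. Qed.

Section StarCurve.

Variables (d : nat) (mu0 r : R) (al0 s : 'I_d -> R) (p W : 'I_d -> R -> R -> R).
Hypothesis d_gt0 : (0 < d)%N.
Hypothesis r_gt0 : 0 < r.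
Hypothesis s_sign : forall j, s j = 1 \/ s j = -1.

Let box j mu al := near r mu0 mu /\ near r (al0 j) al.

Hypothesis p_cont : forall j mu al, box j mu al ->
  continuous (fun q : R * R => p j q.1 q.2) (mu, al).
Hypothesis W_cont : forall j mu al, box j mu al ->
  continuous (fun q : R * R => W j q.1 q.2) (mu, al).
Hypothesis p_mono : forall j mu al al', box j mu al -> box j mu al' ->
  al < al' -> p j mu al < p j mu al'.
Hypothesis W_mono : forall j mu al al', box j mu al -> box j mu al' ->
  al < al' -> W j mu al < W j mu al'.
Hypothesis p_zero : forall j, p j mu0 (al0 j) = 0.
Hypothesis W_zero : \sumR_(j < d) (s j * W j mu0 (al0 j)) = 0.

(* [p j = - s j * v] means that all edges take the value [v] at the centre;
   raising [v] lowers every signed central slope [s j * W j]. *)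
Lemma slope_sum_mono (mu v v' : R) (A A' : 'I_d -> R) :
  (forall j, box j mu (A j)) -> (forall j, box j mu (A' j)) ->
  (forall j, p j mu (A j) = - s j * v) -> (forall j, p j mu (A' j) = - s j * v') ->
  v < v' ->
  \sumR_(j < d) (s j * W j mu (A' j)) < \sumR_(j < d) (s j * W j mu (A j)).
Proof.
move=> bA bA' pA pA' vv; apply: sumR_lt => // j.
have p_inv x y : box j mu x -> box j mu y -> p j mu x < p j mu y -> x < y.
  move=> bx byy; case: (Rtotal_order x y) => [//|[->|yx]]; first lra.
  by have := p_mono byy bx yx; lra.
have := pA j; have := pA' j; case: (s_sign j) => -> e' e.
  have : A' j < A j by apply: p_inv => //; lra.
  by move=> /(W_mono (bA' j) (bA j)); lra.
have : A j < A' j by apply: p_inv => //; lra.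
by move=> /(W_mono (bA j) (bA' j)); lra.
Qed.

Lemma continuous_slice1 (T U V : UniformSpace) (f : T * U -> V) (x : T) (y : U) :
  continuous f (x, y) -> continuous (fun x => f (x, y)) x.
Proof.
move=> H; apply: (continuous_comp (fun x => (x, y)) f) => //.
by apply: continuous_pair; [exact: continuous_id | exact: continuous_const].
Qed.

Lemma continuous_slice2 (T U V : UniformSpace) (f : T * U -> V) (x : T) (y : U) :
  continuous f (x, y) -> continuous (fun y => f (x, y)) y.
Proof.
move=> H; apply: (continuous_comp (fun y => (x, y)) f) => //.
by apply: continuous_pair; [exact: continuous_const | exact: continuous_id].
Qed.

(** [monotone_implicit] is applied twice: on each edge [p j mu al = y] gives the amplitude as a
    function of [(mu, y)], and then the vanishing of the slope sum at common central value [v] gives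
    [v] as a function of [mu]. *)
Lemma star_curve : exists (v : R -> R) (A : 'I_d -> R -> R),
  [/\ v mu0 = 0, forall j, A j mu0 = al0 j &
   locally mu0 (fun mu =>
     (forall j, [/\ box j mu (A j mu), continuous (A j) mu &
        p j mu (A j mu) = - s j * v mu]) /\
     \sumR_(j < d) (s j * W j mu (A j mu)) = 0)].
Proof.
have near0 x : near r x x by rewrite /near Rminus_diag Rabs_R0.
have stage1 j : exists g : R * R -> R, g (mu0, 0) = al0 j /\
    locally (mu0, 0) (fun q => [/\ al0 j - r < g q < al0 j + r,
      p j q.1 (g q) - q.2 = 0 & continuous g q]).
  apply: (@monotone_implicit _ (fun q al => p j q.1 al - q.2)) => //.
    by rewrite /= p_zero; ring.
  exists (mkposreal _ r_gt0) => -[mu y] [/= /ball_near nmu _].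
  split=> [al al' h1 h2 h3|al h1].
    have := @p_mono j mu al al'; rewrite /box !nearP; move: nmu; rewrite nearP.
    by lra.
  have b : box j mu al by split=> //; apply/nearP.
  split.
    apply: (continuous_minus (fun al => p j mu al) (fun _ => y)).
      exact: (@continuous_slice2 _ _ _ (fun q => p j q.1 q.2) mu al (p_cont b)).
    exact: continuous_const.
  apply: (continuous_minus (fun q : R * R => p j q.1 al) (fun q => q.2)).
    apply: (continuous_comp (fun q : R * R => q.1) (fun mu => p j mu al)).
      exact: continuous_fst.
    exact: (@continuous_slice1 _ _ _ (fun q => p j q.1 q.2) mu al (p_cont b)).
  exact: continuous_snd.
have [g Hg] : exists g : 'I_d -> R * R -> R, forall j, g j (mu0, 0) = al0 j /\
    locally (mu0, 0) (fun q => [/\ al0 j - r < g j q < al0 j + r,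
      p j q.1 (g j q) - q.2 = 0 & continuous (g j) q]).
  by apply: (fin_all_exists (P := fun j g => g (mu0, 0) = al0 j /\
    locally (mu0, 0) (fun q => [/\ al0 j - r < g q < al0 j + r,
      p j q.1 (g q) - q.2 = 0 & continuous g q]))).
have Hloc : locally (mu0, 0) (fun q : R * R => forall j,
    [/\ box j q.1 (g j q), p j q.1 (g j q) = q.2 & continuous (g j) q]).
  apply: filter_forall_ord => j; have [_ L] := Hg j.
  have L2 : locally (mu0, 0) (fun q : R * R => near r mu0 q.1).
    by exists (mkposreal _ r_gt0) => q [/ball_near].
  apply: (locally_weaken (locally_and L L2)) => q [[h1 h2 h3] h4].
  by split=> //; [split=> //; apply/nearP | apply: Rminus_diag_uniq].
have [e He] := locally_pair Hloc.
have s_abs j v : near e 0 v -> ball 0 e (- s j * v).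
  rewrite /near => nv; apply/ball_near; rewrite /near !Rminus_0_r in nv *.
  by case: (s_sign j) => ->; rewrite ?Ropp_involutive ?Rmult_1_l //
    -Ropp_mult_distr_l Rabs_Ropp Rmult_1_l.
(* Negated, since the slope sum falls as [v] rises while [monotone_implicit] asks for an increasing
   function. *)
pose f mu v := - \sumR_(j < d) (s j * W j mu (g j (mu, - s j * v))).
have in_box mu v j : near e mu0 mu -> near e 0 v ->
    [/\ box j mu (g j (mu, - s j * v)), p j mu (g j (mu, - s j * v)) = - s j * v &
      continuous (g j) (mu, - s j * v)].
  by move=> nmu nv; apply: (He mu (- s j * v)) => //; apply: s_abs.
have f_cont mu v : near e mu0 mu -> near e 0 v ->
    continuous (fun q : R * R => f q.1 q.2) (mu, v).
  move=> nmu nv; apply: (@continuous_opp _ _ R_NormedModule).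
  apply: continuous_sumR => j.
  have [b _ gc] := in_box mu v j nmu nv.
  apply: (continuous_scal_r (s j) (fun q : R * R => W j q.1 (g j (q.1, - s j * q.2)))).
  apply: (continuous_comp (fun q : R * R => (q.1, g j (q.1, - s j * q.2)))
    (fun q : R * R => W j q.1 q.2)); last exact: W_cont b.
  apply: continuous_pair; first exact: continuous_fst.
  apply: (continuous_comp (fun q : R * R => (q.1, - s j * q.2)) (g j)) => //.
  apply: continuous_pair; first exact: continuous_fst.
  apply: (continuous_scal_r (- s j) (fun q : R * R => q.2)).
  exact: continuous_snd.
have near_e x : 0 - e < x < 0 + e -> near e 0 x by move=> ?; apply/nearP.
have f0 : f mu0 0 = 0.
  rewrite /f (eq_bigr (fun j => s j * W j mu0 (al0 j))) ?W_zero ?Ropp_0 //.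
  by move=> j _; rewrite Rmult_0_r (Hg j).1.
have loc_f : locally mu0 (fun mu =>
    (forall x y, 0 - e < x -> x < y -> y < 0 + e -> f mu x < f mu y) /\
    (forall x, 0 - e < x < 0 + e ->
       continuous (f mu) x /\ continuous (fun mu => f mu x) mu)).
  exists e => mu /ball_near nmu; split=> [x y h1 h2 h3|x /near_e nx].
    have nx : near e 0 x by apply: near_e; lra.
    have ny : near e 0 y by apply: near_e; lra.
    apply: Ropp_lt_contravar; apply: (slope_sum_mono _ _ _ _ h2) => j.
    - by case: (in_box mu x j nmu nx).
    - by case: (in_box mu y j nmu ny).
    - by case: (in_box mu x j nmu nx).
    - by case: (in_box mu y j nmu ny).
  have c := f_cont mu x nmu nx; split.
    exact: (@continuous_slice2 _ _ _ (fun q => f q.1 q.2) mu x c).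
  exact: (@continuous_slice1 _ _ _ (fun q => f q.1 q.2) mu x c).
have [v [v0 Hv]] := monotone_implicit (cond_pos e) f0 loc_f.
have Le : locally mu0 (fun mu => near e mu0 mu) by exists e.
exists v, (fun j mu => g j (mu, - s j * v mu)); split=> //.
  by move=> j; rewrite v0 Rmult_0_r (Hg j).1.
apply: (locally_weaken (locally_and Hv Le)) => mu [[/near_e nv fv vc] nmu].
split; last by rewrite -[LHS]Ropp_involutive -/(f mu (v mu)) fv Ropp_0.
move=> j; have [b e1 gc] := in_box mu (v mu) j nmu nv; split=> //.
apply: (continuous_comp (fun mu => (mu, - s j * v mu)) (g j)) => //.
apply: continuous_pair; first exact: continuous_id.
exact: (continuous_scal_r (- s j) v).
Qed.

End StarCurve.

(** * Monotonicity in the amplitude *)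

Lemma continuous_stiffness (nu : R) (n : nat) (q : R * R) :
  continuous (fun q : R * R => stiffness nu n q.2) q.
Proof.
apply: (continuous_comp (fun q : R * R => q.2) (stiffness nu n)).
  exact: continuous_snd.
by apply: ex_derive_continuous; rewrite /stiffness; auto_derive.
Qed.

Lemma continuous_affine_stiffness (nu : R) (n : nat) (k : R) (q : R * R) :
  continuous (fun q : R * R => q.1 + k * stiffness nu n q.2) q.
Proof.
apply: (continuous_plus (fun q : R * R => q.1) (fun q => k * stiffness nu n q.2)).
  exact: continuous_fst.
apply: (continuous_scal_r k (fun q : R * R => stiffness nu n q.2)).
exact: continuous_stiffness.
Qed.

Lemma locally_between (T : UniformSpace) (f : T -> R) (x : T) (lo hi : R) :
  continuous f x -> lo < f x < hi -> locally x (fun t => lo < f t < hi).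
Proof.
move=> fc [h1 h2].
apply: (locally_weaken (locally_and
  (continuous_lt (@continuous_const _ _ lo x) fc h1)
  (continuous_lt fc (@continuous_const _ _ hi x) h2))).
by [].
Qed.

(** Bounds uniform in a neighbourhood, so that Lipschitz and monotonicity constants can be fixed
    before the radius: half the smaller and twice the larger of the two end values of [h]. *)
Lemma pinched_near (nu : R) (n : nat) (mu0 al0 : R) : nu <> 0 -> (0 < n)%N ->
  in_P nu n mu0 al0 ->
  exists m M, locally (mu0, al0) (fun q : R * R =>
    [/\ pinched n m M q.1 (stiffness nu n q.2), al0 / 2 < q.2 < 2 * al0 &
        in_P nu n q.1 q.2]).
Proof.
move=> nu0 n0 /in_P_iff [] // al00 h1 h2.
set x := mu0 + stiffness nu n al0 in h1; set y := mu0 + _ in h2.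
pose m := Rmin (x / 2) (y / 2); pose M := Rmax (2 * x) (2 * y).
exists m, M.
have m0 : 0 < m by apply: Rmin_pos; lra.
have mx : m <= x / 2 := Rmin_l _ _; have my : m <= y / 2 := Rmin_r _ _.
have Mx : 2 * x <= M := Rmax_l _ _; have My : 2 * y <= M := Rmax_r _ _.
have L1 : locally (mu0, al0) (fun q : R * R => m < q.1 + 1 * stiffness nu n q.2 < M).
  apply: locally_between; first exact: continuous_affine_stiffness.
  by rewrite /= Rmult_1_l -/x; lra.
have L2 : locally (mu0, al0)
    (fun q : R * R => m < q.1 + (INR n + 1) * stiffness nu n q.2 < M).
  apply: locally_between; first exact: continuous_affine_stiffness.
  by rewrite /= -/y; lra.
have L3 : locally (mu0, al0) (fun q : R * R => al0 / 2 < q.2 < 2 * al0).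
  by apply: (locally_between (f := fun q : R * R => q.2));
    [exact: continuous_snd | rewrite /=; lra].
apply: (locally_weaken (locally_and L1 (locally_and L2 L3))).
move=> q; rewrite Rmult_1_l => -[k1 [k2 k3]].
split=> //; first by split=> //; lra.
by apply/in_P_iff => //; split; lra.
Qed.

Section Edge.

Variables (nu : R) (n : nat) (b : boundary_condition) (l mu0 al0 : R).
Hypothesis nu0 : nu <> 0.
Hypothesis n0 : (0 < n)%N.
Hypothesis l0 : 0 < l.
Hypothesis P0 : in_P nu n mu0 al0.

Let th (q : R * R) := wave_phase nu n b q.1 q.2 l.

Lemma wave_center (mu al : R) :
  wave nu n b l mu al 0 = al * sin (th (mu, al)).
Proof. by rewrite /wave Rminus_0_r. Qed.

Lemma wave_slope_center (mu al : R) :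
  wave_slope nu n b l mu al 0 =
  - (al * cos (th (mu, al)) * sqrt (h n mu (stiffness nu n al) (th (mu, al)))).
Proof. by rewrite /wave_slope Rminus_0_r. Qed.

Lemma continuous_wave_phase : continuous th (mu0, al0).
Proof.
have [m [M L]] := pinched_near nu0 n0 P0.
have [P _ _] := locally_singleton _ _ L.
pose K := M * / (m * sqrt m) * l.
apply: (continuous_bound_near (g := fun q => (Rabs (q.1 - mu0) +
  (INR n + 1) * Rabs (stiffness nu n q.2 - stiffness nu n al0)) * K)).
- apply: (locally_weaken L) => q [Pq _ _].
  exact: (phase_param_lipschitz (bc_phase b) Pq P (Rlt_le _ _ l0)).
- have cabs (f : R * R -> R) (v : R) : continuous f (mu0, al0) ->
      continuous (fun q => Rabs (f q - v)) (mu0, al0).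
    move=> fc; apply: (continuous_comp (fun q => f q - v) Rabs).
      apply: (continuous_minus f (fun _ => v)) => //.
      exact: continuous_const.
    exact: continuous_Rabs.
  apply: (continuous_mult (fun q : R * R => Rabs (q.1 - mu0) +
    (INR n + 1) * Rabs (stiffness nu n q.2 - stiffness nu n al0)) (fun _ => K));
    last exact: continuous_const.
  apply: (continuous_plus (fun q : R * R => Rabs (q.1 - mu0))
    (fun q : R * R => (INR n + 1) * Rabs (stiffness nu n q.2 - stiffness nu n al0))).
    by apply: (cabs (fun q => q.1)); exact: continuous_fst.
  apply: (continuous_scal_r (INR n + 1)
    (fun q : R * R => Rabs (stiffness nu n q.2 - stiffness nu n al0))).
  by apply: (cabs (fun q => stiffness nu n q.2)); exact: continuous_stiffness.
- by rewrite /= !Rminus_diag Rabs_R0; ring.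
Qed.

Lemma continuous_wave_center :
  continuous (fun q : R * R => wave nu n b l q.1 q.2 0) (mu0, al0).
Proof.
apply: (continuous_ext (fun q : R * R => q.2 * sin (th q))) => [[mu al]|].
  by rewrite wave_center.
apply: (continuous_mult (fun q : R * R => q.2) (fun q => sin (th q))).
  exact: continuous_snd.
by apply: (continuous_comp th sin);
  [exact: continuous_wave_phase | exact: continuous_sin].
Qed.

Lemma continuous_wave_slope_center :
  continuous (fun q : R * R => wave_slope nu n b l q.1 q.2 0) (mu0, al0).
Proof.
have thc := continuous_wave_phase.
apply: (continuous_ext (fun q : R * R => - (q.2 * cos (th q) *
    sqrt (h n q.1 (stiffness nu n q.2) (th q))))) => [[mu al]|].
  by rewrite wave_slope_center.
apply: (@continuous_opp _ _ R_NormedModule).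
apply: (continuous_mult (fun q : R * R => q.2 * cos (th q))
  (fun q => sqrt (h n q.1 (stiffness nu n q.2) (th q)))).
  apply: (continuous_mult (fun q : R * R => q.2) (fun q => cos (th q))).
    exact: continuous_snd.
  by apply: (continuous_comp th cos); [exact: thc | exact: continuous_cos].
apply: (continuous_comp (fun q : R * R => h n q.1 (stiffness nu n q.2) (th q)) sqrt);
  last exact: continuous_sqrt.
apply: (continuous_plus (fun q : R * R => q.1)
  (fun q => stiffness nu n q.2 * geo n (sin (th q)))).
  exact: continuous_fst.
apply: (continuous_mult (fun q : R * R => stiffness nu n q.2)
  (fun q => geo n (sin (th q)))); first exact: continuous_stiffness.
apply: (continuous_comp (fun q => sin (th q)) (geo n)); last exact: continuous_geo.
by apply: (continuous_comp th sin); [exact: thc | exact: continuous_sin].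
Qed.

Lemma pow_diff_bounds (lo hi x y : R) (k : nat) : 0 < lo -> lo <= x -> x <= y -> y <= hi ->
  lo ^ k * (y - x) <= y ^ k.+1 - x ^ k.+1 <= INR k.+1 * hi ^ k * (y - x).
Proof.
move=> lo0 lox xy yhi; elim: k => [|k [IH1 IH2]].
  by rewrite /= ; lra.
have -> : y ^ k.+2 - x ^ k.+2 = y * (y ^ k.+1 - x ^ k.+1) + x ^ k.+1 * (y - x).
  by rewrite -!tech_pow_Rmult; ring.
have lox' : lo ^ k.+1 <= x ^ k.+1 by apply: pow_incr; lra.
have xhi' : x ^ k.+1 <= hi ^ k.+1 by apply: pow_incr; lra.
have lk : 0 < lo ^ k by apply: pow_lt.
have hk : 0 < hi ^ k by apply: pow_lt; lra.
split.
  have : 0 <= y * (y ^ k.+1 - x ^ k.+1).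
    by apply: Rmult_le_pos; [lra | apply: Rle_trans IH1; apply: Rmult_le_pos; lra].
  have : lo ^ k.+1 * (y - x) <= x ^ k.+1 * (y - x) by apply: Rmult_le_compat_r; lra.
  by lra.
rewrite (S_INR k.+1) Rmult_plus_distr_r Rmult_1_l Rmult_plus_distr_r.
apply: Rplus_le_compat; last by apply: Rmult_le_compat_r; lra.
apply: Rle_trans (Rmult_le_compat_l y _ _ _ IH2) _; first lra.
have -> : INR k.+1 * hi ^ k.+1 * (y - x) = hi * (INR k.+1 * hi ^ k * (y - x)).
  by rewrite -tech_pow_Rmult; ring.
apply: Rmult_le_compat_r; last lra.
by apply: Rmult_le_pos; [apply: Rmult_le_pos; [exact: pos_INR | lra] | lra].
Qed.

Lemma stiffness_diff_bounds (lo hi : R) : 0 < lo -> lo <= hi ->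
  exists c C, 0 < c /\ 0 < C /\ forall x y, lo <= x -> x < y -> y <= hi ->
    c * (y - x) <= sign nu * (stiffness nu n y - stiffness nu n x) <= C * (y - x).
Proof.
move=> lo0 lohi.
have nn : exists k, (2 * n)%N = k.+1.
  by case: n n0 => // k _; exists (2 * k).+1; rewrite mulnS.
have [k nk] := nn.
have sn : sign nu * nu = Rabs nu.
  case: (Rlt_le_dec 0 nu) => s.
    by rewrite sign_eq_1 // Rabs_pos_eq; lra.
  by rewrite sign_eq_m1 ?Rabs_left; lra.
have an : 0 < Rabs nu by apply: Rabs_pos_lt.
exists (Rabs nu * lo ^ k), (Rabs nu * (INR k.+1 * hi ^ k)).
have pk : 0 < INR k.+1 by apply: lt_0_INR; lia.
split; first by apply: Rmult_lt_0_compat => //; apply: pow_lt.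
split.
  by do 2 (apply: Rmult_lt_0_compat => //); apply: pow_lt; lra.
move=> x y lox xy yhi.
have st z : stiffness nu n z = nu * z ^ k.+1 by rewrite /stiffness -pow_mult -nk.
have [b1 b2] := pow_diff_bounds k lo0 lox (Rlt_le _ _ xy) yhi.
have -> : sign nu * (stiffness nu n y - stiffness nu n x) =
          Rabs nu * (y ^ k.+1 - x ^ k.+1) by rewrite !st -sn; ring.
by rewrite !Rmult_assoc in b2 *; split; apply: Rmult_le_compat_l; lra.
Qed.

(** At fixed [mu] the amplitude enters only through the stiffness, which increases or decreases with
    the sign of [nu]. The factor [sign nu] covers both cases; for [nu < 0] the lower comparison is
    applied with the two amplitudes exchanged. *)
Lemma phase_amplitude_bounds (m M lo hi : R) : 0 < m -> 0 < M -> 0 < lo -> lo <= hi ->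
  exists c C, 0 < c /\ 0 < C /\ forall mu x y,
    pinched n m M mu (stiffness nu n x) -> pinched n m M mu (stiffness nu n y) ->
    lo <= x -> x < y -> y <= hi ->
    c * (y - x) <= sign nu * (th (mu, y) - th (mu, x)) <= C * (y - x).
Proof.
move=> m0 M0 lo0 lohi.
have [c [C [c0 [C0 H]]]] := stiffness_diff_bounds lo0 lohi.
have sm := sqrt_lt_R0 _ m0; have sM := sqrt_lt_R0 _ M0.
pose k := m * / (2 * M * sqrt M) * l.
pose K := (INR n + 1) * (M * / (m * sqrt m) * l).
have k0 : 0 < k.
  have : 0 < / (2 * M * sqrt M) by apply: Rinv_0_lt_compat; nra.
  by move=> ?; do 2 (apply: Rmult_lt_0_compat => //).
have K0 : 0 < K.
  have : 0 < / (m * sqrt m) by apply: Rinv_0_lt_compat; nra.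
  move=> ?; apply: Rmult_lt_0_compat; first by have := pos_INR n; lra.
  by do 2 (apply: Rmult_lt_0_compat => //).
exists (k * c), (K * C); split; first exact: Rmult_lt_0_compat.
split; first exact: Rmult_lt_0_compat.
move=> mu x y Px Py lox xy yhi.
have [h1 h2] := H x y lox xy yhi.
have ll := Rlt_le _ _ l0.
have up := phase_param_lipschitz (bc_phase b) Py Px ll.
rewrite Rminus_diag Rabs_R0 Rplus_0_l -!/(wave_phase _ _ _ _ _ _) in up.
have low := @phase_param_lower n m M _ _ _ _ (bc_phase b) Px Py l ll erefl.
have low' := @phase_param_lower n m M _ _ _ _ (bc_phase b) Py Px l ll erefl.
rewrite -!/(wave_phase _ _ _ _ _ _) -/k in low low'.
have up' : Rabs (th (mu, y) - th (mu, x)) <=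
    Rabs (stiffness nu n y - stiffness nu n x) * K.
  by apply: Rle_trans up _; rewrite /K; apply: Req_le; ring.
rewrite /th /= in up' *.
set D := stiffness nu n y - stiffness nu n x in h1 h2 low up'.
have yx : 0 < y - x by lra.
case: (Rlt_le_dec 0 nu) => s.
  rewrite sign_eq_1 // Rmult_1_l in h1 h2 *.
  have D0 : 0 <= D by nra.
  rewrite (Rabs_pos_eq D) // in up'.
  have xy' : stiffness nu n x <= stiffness nu n y by rewrite /D in D0; lra.
  have lw := low xy'; rewrite -/D in lw.
  have [_ u2] := proj1 (Rabs_le_between _ _) up'.
  split; first by nra.
  by have := Rmult_le_compat_r _ _ _ (Rlt_le _ _ K0) h2; lra.
rewrite sign_eq_m1 in h1 h2 *; try lra.
have D0 : D <= 0 by nra.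
rewrite (Rabs_left1 D) // in up'.
have yx' : stiffness nu n y <= stiffness nu n x by rewrite /D in D0; lra.
have lw := low' yx'.
rewrite (_ : stiffness nu n x - stiffness nu n y = - D) in lw; last by rewrite /D; ring.
have [u1 _] := proj1 (Rabs_le_between _ _) up'.
split; first by nra.
by have := Rmult_le_compat_r _ _ _ (Rlt_le _ _ K0) h2; lra.
Qed.

(** Mean value theorem: [cos] is at least [1 / 2] on [[-1, 1]] because [1 <= PI / 3]. *)
Lemma sin_increment (x y e : R) : e <= 1 -> Rabs x <= e -> Rabs y <= e ->
  exists k, 1 / 2 <= k <= 1 /\ sin y - sin x = k * (y - x).
Proof.
move=> e1 /Rabs_le_between hx /Rabs_le_between hy.
have [||z [zI ->]] := MVT_gen sin x y cos.
- by move=> t _; exact: is_derive_sin.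
- by move=> t _; apply/continuity_pt_filterlim; exact: continuous_sin.
exists (cos z); split=> //.
have z1 : -1 <= z <= 1.
  by move: zI; rewrite /Rmin /Rmax; case: Rle_dec => _; lra.
split; last by have := COS_bound z; lra.
have pi3 : 1 <= PI / 3 by have := PI2_3_2; lra.
have p0 := PI_RGT_0.
have -> : 1 / 2 = cos (PI / 3) by rewrite cos_PI3.
case: (Rle_lt_dec 0 z) => z0; first by apply: cos_decr_1; lra.
by rewrite -(cos_neg z); apply: cos_decr_1; lra.
Qed.

Lemma is_derive_potential (mu r : R) :
  is_derive (potential nu n mu) r (2 * r * (mu + (INR n + 1) * nu * (r ^ 2) ^ n)).
Proof.
rewrite /potential; auto_derive => //.
case: (n) => [|k]; first by rewrite /=; ring.
by rewrite [Nat.pred _]/= S_INR -[(r * _) ^ k.+1]/((r * (r * 1)) * (r * (r * 1)) ^ k); ring.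
Qed.

Lemma potential_increment (mu x y : R) : exists z, Rmin x y <= z <= Rmax x y /\
  potential nu n mu y - potential nu n mu x =
  2 * z * (mu + (INR n + 1) * nu * (z ^ 2) ^ n) * (y - x).
Proof.
have [||z [zI ->]] := MVT_gen (potential nu n mu) x y
  (fun r => 2 * r * (mu + (INR n + 1) * nu * (r ^ 2) ^ n)).
- by move=> t _; exact: is_derive_potential.
- move=> t _; apply/continuity_pt_filterlim; apply: ex_derive_continuous.
  by exists (2 * t * (mu + (INR n + 1) * nu * (t ^ 2) ^ n)); apply: is_derive_potential.
by exists z.
Qed.

(** Central value: the change of the factor [al] contributes only order [e], while the phase
    contributes a fixed positive multiple of [al' - al]. Central slope: its square is
    [potential al - potential p], with [p] the central value up to sign. The first term grows at
    rate at least [al0 * m], the second changes at most half as fast, since the derivative of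
    [potential] vanishes at [0]. *)
Lemma edge_monotone : sin (th (mu0, al0)) = 0 -> exists r, 0 < r /\
  forall mu al, near r mu0 mu -> near r al0 al ->
  [/\ in_P nu n mu al, near (PI / 2) (th (mu0, al0)) (th (mu, al)) &
   forall al', near r al0 al' -> al < al' ->
   sign nu * (cos (th (mu0, al0)) * wave nu n b l mu al 0) <
   sign nu * (cos (th (mu0, al0)) * wave nu n b l mu al' 0) /\
   - (cos (th (mu0, al0)) * wave_slope nu n b l mu al 0) <
   - (cos (th (mu0, al0)) * wave_slope nu n b l mu al' 0)].
Proof.
set t0 := th (mu0, al0) => s0.
have [al00 _ _] := proj1 (in_P_iff mu0 al0 nu0 n0) P0.
have [m [M L]] := pinched_near nu0 n0 P0.
have [Ppin _ _] := locally_singleton _ _ L.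
have [m0 [M0 _]] := pinched_pos Ppin.
have [c [C [c0 [C0 HC]]]] : exists c C, 0 < c /\ 0 < C /\ forall mu x y,
    pinched n m M mu (stiffness nu n x) -> pinched n m M mu (stiffness nu n y) ->
    al0 / 2 <= x -> x < y -> y <= 2 * al0 ->
    c * (y - x) <= sign nu * (th (mu, y) - th (mu, x)) <= C * (y - x).
  by apply: phase_amplitude_bounds => //; lra.
(* [K] bounds [mu + (n + 1) * nu * y ^ (2 * n)] for [mu] within [1] of [mu0] and [|y| <= 1]; [C2]
   will be a Lipschitz constant of the central value in the amplitude. *)
pose K := Rabs mu0 + 1 + (INR n + 1) * Rabs nu.
pose C2 := 1 + 2 * al0 * C.
have K0 : 0 < K.
  have := Rabs_pos mu0; have := Rabs_pos nu; have := pos_INR n.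
  rewrite /K => N V U; have : 0 <= (INR n + 1) * Rabs nu by nra.
  by lra.
have C20 : 0 < C2 by rewrite /C2; have := Rmult_lt_0_compat _ _ al00 C0; lra.
have KC0 : 0 < 8 * K * C2 by apply: Rmult_lt_0_compat => //; lra.
(* Four demands on the phase deviation: [1] for [sin_increment]; [al0 * c / 8] so that the phase
   term, with rate [al0 * c / 4], beats the amplitude term; [/ (2 * al0)] to keep central values at
   most [1]; [m / (8 * K * C2)] so that the central potential moves by at most half the guaranteed
   gain at the peak. *)
pose e := Rmin (Rmin 1 (al0 * c / 8)) (Rmin (/ (2 * al0)) (m / (8 * K * C2))).
have e0 : 0 < e.
  repeat apply: Rmin_pos; try lra.
  - have := Rmult_lt_0_compat _ _ al00 c0; lra.
  - apply: Rinv_0_lt_compat; lra.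
  - exact: Rdiv_lt_0_compat.
have e1 : e <= 1 by apply: Rle_trans (Rmin_l _ _) _; exact: Rmin_l.
have e2 : e <= al0 * c / 8 by apply: Rle_trans (Rmin_l _ _) _; exact: Rmin_r.
have e3 : 2 * al0 * e <= 1.
  have : e <= / (2 * al0) by apply: Rle_trans (Rmin_r _ _) _; exact: Rmin_l.
  move/(Rmult_le_compat_l (2 * al0)); rewrite Rinv_r; lra.
have e4 : 8 * K * C2 * e <= m.
  have : e <= m / (8 * K * C2) by apply: Rle_trans (Rmin_r _ _) _; exact: Rmin_r.
  move/(Rmult_le_compat_l (8 * K * C2)).
  by rewrite (_ : 8 * K * C2 * (m / (8 * K * C2)) = m); [lra | field; lra].
have Lth := continuous_near continuous_wave_phase e0.
have Lmu : locally (mu0, al0) (fun q : R * R => near 1 mu0 q.1).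
  by exists (mkposreal _ Rlt_0_1) => q [/ball_near].
have [r Hr] := locally_pair (locally_and L (locally_and Lth Lmu)).
exists r; split; first exact: cond_pos.
move=> mu al nmu nal.
have [[Pq alI inP] [dth nmu1]] := Hr mu al nmu nal.
rewrite /= in Pq alI inP dth nmu1.
split=> //.
  rewrite /near; apply: Rlt_trans dth _; have := PI2_3_2; lra.
move=> al' nal' lt.
have [[Pq' alI' _] [dth' _]] := Hr mu al' nmu nal'.
rewrite /= in Pq' alI' dth'.
have [H1 H2] := HC mu al al' Pq Pq' (Rlt_le _ _ alI.1) lt (Rlt_le _ _ alI'.2).
set t := th (mu, al) in dth H1 H2; set t' := th (mu, al') in dth' H1 H2.
set k0 := cos t0.
have kk : k0 * k0 = 1 by have := sin2_cos2 t0; rewrite s0 /Rsqr -/k0; lra.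
(* Since [sin t0 = 0], multiplying by [cos t0], which is [1] or [-1], moves the phases to a
   neighbourhood of [0]. *)
pose del := t - t0; pose del' := t' - t0.
have sd : sin del = k0 * sin t by rewrite /del sin_minus s0 /k0; ring.
have cd : cos del = k0 * cos t by rewrite /del cos_minus s0 /k0; ring.
have sd' : sin del' = k0 * sin t' by rewrite /del' sin_minus s0 /k0; ring.
have cd' : cos del' = k0 * cos t' by rewrite /del' cos_minus s0 /k0; ring.
have bd : Rabs del <= e by apply: Rlt_le.
have bd' : Rabs del' <= e by apply: Rlt_le.
have b0 : Rabs 0 <= e by rewrite Rabs_R0; lra.
have small x : Rabs x <= e -> Rabs (sin x) <= e.
  move=> bx; have [k [kI kE]] := sin_increment e1 b0 bx.
  rewrite sin_0 !Rminus_0_r in kE; rewrite kE Rabs_mult Rabs_pos_eq; last lra.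
  by have := Rabs_pos x; nra.
have cpos x : Rabs x <= e -> 0 < cos x.
  move=> /Rabs_le_between bx; apply: cos_gt_0; have := PI2_3_2; lra.
have [k [kI kE]] := sin_increment e1 bd bd'.
have dd : del' - del = t' - t by rewrite /del' /del; ring.
rewrite dd in kE.
have sg : sign nu * sign nu = 1.
  case: (Rlt_le_dec 0 nu) => s; first by rewrite sign_eq_1 //; ring.
  by rewrite sign_eq_m1; [ring | lra].
have yx : 0 < al' - al by lra.
have c1 : 0 < c * (al' - al) by apply: Rmult_lt_0_compat.
have S1 : c / 2 * (al' - al) <= sign nu * (sin del' - sin del) <= C * (al' - al).
  rewrite kE (_ : sign nu * (k * (t' - t)) = k * (sign nu * (t' - t))); last by ring.
  set D := sign nu * (t' - t) in H1 H2 *.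
  have D0 : 0 <= D by lra.
  have : 0 <= (k - 1 / 2) * D by apply: Rmult_le_pos; lra.
  have : 0 <= (1 - k) * D by apply: Rmult_le_pos; lra.
  by lra.
have sgabs x : Rabs (sign nu * x) = Rabs x.
  case: (Rlt_le_dec 0 nu) => s; first by rewrite sign_eq_1 // Rmult_1_l.
  by rewrite sign_eq_m1 -?Ropp_mult_distr_l ?Rabs_Ropp ?Rmult_1_l //; lra.
have sm' := small _ bd'; have sm := small _ bd.
pose p := al * sin del; pose p' := al' * sin del'.
have pE : k0 * wave nu n b l mu al 0 = p by rewrite wave_center -/t /p sd; ring.
have pE' : k0 * wave nu n b l mu al' 0 = p' by rewrite wave_center -/t' /p' sd'; ring.
have pp : sign nu * (p' - p) =
    (al' - al) * (sign nu * sin del') + al * (sign nu * (sin del' - sin del)).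
  by rewrite /p /p'; ring.
have sb : - e <= sign nu * sin del' <= e.
  by apply/Rabs_le_between; rewrite sgabs.
set X := sign nu * sin del' in pp sb; set Y := sign nu * (sin del' - sin del) in pp S1.
have aX1 : (al' - al) * - e <= (al' - al) * X by apply: Rmult_le_compat_l; lra.
have aX2 : (al' - al) * X <= (al' - al) * e by apply: Rmult_le_compat_l; lra.
have aY1 : al0 / 2 * (c / 2 * (al' - al)) <= al * Y by apply: Rmult_le_compat; lra.
have aY2 : al * Y <= 2 * al0 * (C * (al' - al)) by apply: Rmult_le_compat; lra.
have ae1 : (al' - al) * e <= (al' - al) * (al0 * c / 8) by apply: Rmult_le_compat_l; lra.
have ae2 : (al' - al) * e <= (al' - al) * 1 by apply: Rmult_le_compat_l; lra.
have ac0 := Rmult_lt_0_compat _ _ al00 c1.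
have dp0 : 0 < sign nu * (p' - p) by lra.
have dpC : Rabs (p' - p) <= C2 * (al' - al).
  by rewrite -sgabs Rabs_pos_eq; [rewrite /C2; lra | lra].
rewrite pE pE'; split; first by lra.
pose W := al * cos del * sqrt (h n mu (stiffness nu n al) t).
pose W' := al' * cos del' * sqrt (h n mu (stiffness nu n al') t').
have -> : - (k0 * wave_slope nu n b l mu al 0) = W.
  by rewrite wave_slope_center -/t /W cd; ring.
have -> : - (k0 * wave_slope nu n b l mu al' 0) = W'.
  by rewrite wave_slope_center -/t' /W' cd'; ring.
have W0 : 0 < W.
  apply: Rmult_lt_0_compat; last by apply: sqrt_lt_R0; exact: (h_gt0 t Pq).
  by apply: Rmult_lt_0_compat; [lra | exact: cpos].
have W0' : 0 < W'.
  apply: Rmult_lt_0_compat; last by apply: sqrt_lt_R0; exact: (h_gt0 t' Pq').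
  by apply: Rmult_lt_0_compat; [lra | exact: cpos].
have sq x s : pinched n m M mu (stiffness nu n x) ->
    (x * (k0 * cos s) * sqrt (h n mu (stiffness nu n x) s)) ^ 2 =
    potential nu n mu x - potential nu n mu (x * (k0 * sin s)).
  move=> Px.
  have -> : potential nu n mu (x * (k0 * sin s)) = potential nu n mu (x * sin s).
    rewrite /potential (_ : (x * (k0 * sin s)) ^ 2 = (x * sin s) ^ 2) //.
    by rewrite (_ : (x * (k0 * sin s)) ^ 2 = k0 * k0 * (x * sin s) ^ 2); [rewrite kk|]; ring.
  rewrite potential_drop.
  transitivity (k0 * k0 * (x * cos s) ^ 2 * (sqrt (h n mu (stiffness nu n x) s) *
    sqrt (h n mu (stiffness nu n x) s))); first by ring.
  by rewrite kk sqrt_sqrt; [ring | apply: Rlt_le; exact: (h_gt0 s Px)].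
have Wsq : W ^ 2 = potential nu n mu al - potential nu n mu p.
  by rewrite /W /p cd sd sq.
have Wsq' : W' ^ 2 = potential nu n mu al' - potential nu n mu p'.
  by rewrite /W' /p' cd' sd' sq.
have [z [zI zE]] := potential_increment mu al al'.
rewrite Rmin_left ?Rmax_right in zI; try lra.
(* The stiffness is monotone, so at the intermediate amplitude [z] it lies between its values at the
   ends, where the lower bound [m] is known. *)
have nz : m <= mu + (INR n + 1) * nu * (z ^ 2) ^ n.
  have zst : stiffness nu n al <= stiffness nu n z <= stiffness nu n al' \/
             stiffness nu n al' <= stiffness nu n z <= stiffness nu n al.
    rewrite /stiffness.
    have q1 : (al ^ 2) ^ n <= (z ^ 2) ^ n.
      by apply: pow_incr; split; [exact: pow2_ge_0 | apply: pow_incr; lra].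
    have q2 : (z ^ 2) ^ n <= (al' ^ 2) ^ n.
      by apply: pow_incr; split; [exact: pow2_ge_0 | apply: pow_incr; lra].
    case: (Rle_lt_dec 0 nu) => s; [left|right].
      by split; apply: Rmult_le_compat_l.
    by split; apply: Rmult_le_compat_neg_l => //; apply: Rlt_le.
  have N0 : 0 <= INR n + 1 by have := pos_INR n; lra.
  rewrite Rmult_assoc -/(stiffness nu n z).
  case: Pq Pq' => _ _ [q1 _] [_ _ [q2 _]]; case: zst => -[z1 _].
    by have := Rmult_le_compat_l _ _ _ N0 z1; lra.
  by have := Rmult_le_compat_l _ _ _ N0 z1; lra.
have G1 : al0 * m * (al' - al) <= potential nu n mu al' - potential nu n mu al.
  rewrite zE; apply: Rmult_le_compat_r; first lra.
  by apply: Rmult_le_compat; lra.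
have [y [yI yE]] := potential_increment mu p p'.
have pb : Rabs p <= 2 * al0 * e.
  rewrite /p Rabs_mult (Rabs_pos_eq al); last lra.
  by apply: Rmult_le_compat; try lra; exact: Rabs_pos.
have pb' : Rabs p' <= 2 * al0 * e.
  rewrite /p' Rabs_mult (Rabs_pos_eq al'); last lra.
  by apply: Rmult_le_compat; try lra; exact: Rabs_pos.
have yb : Rabs y <= 2 * al0 * e.
  apply/Rabs_le_between; move/Rabs_le_between: pb; move/Rabs_le_between: pb'.
  by move: yI; rewrite /Rmin /Rmax; case: Rle_dec => _; lra.
have y2 : 0 <= (y ^ 2) ^ n <= 1.
  have y21 : 0 <= y ^ 2 <= 1.
    split; first exact: pow2_ge_0.
    rewrite -[y ^ 2]Rabs_pos_eq; last exact: pow2_ge_0.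
    rewrite -RPow_abs -(pow1 2); apply: pow_incr; split; first exact: Rabs_pos.
    exact: Rle_trans yb e3.
  split; first by apply: pow_le; case: y21.
  by rewrite -(pow1 n); apply: pow_incr.
have Kb : Rabs (mu + (INR n + 1) * nu * (y ^ 2) ^ n) <= K.
  apply: Rle_trans (Rabs_triang _ _) _; apply: Rplus_le_compat.
    have -> : mu = mu0 + (mu - mu0) by ring.
    by apply: Rle_trans (Rabs_triang _ _) _; apply: Rplus_le_compat_l; apply: Rlt_le.
  rewrite !Rabs_mult (Rabs_pos_eq ((y ^ 2) ^ n)); last lra.
  rewrite (Rabs_pos_eq (INR n + 1)); last by have := pos_INR n; lra.
  rewrite -[X in _ <= X]Rmult_1_r; apply: Rmult_le_compat_l; last by case: y2.
  by apply: Rmult_le_pos; [have := pos_INR n; lra | exact: Rabs_pos].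
have G2 : Rabs (potential nu n mu p' - potential nu n mu p) <=
    2 * (2 * al0 * e) * K * (C2 * (al' - al)).
  rewrite yE !Rabs_mult (Rabs_pos_eq 2); last lra.
  apply: Rmult_le_compat => //; try exact: Rabs_pos.
    by apply: Rmult_le_pos; [have := Rabs_pos y; lra | exact: Rabs_pos].
  by apply: Rmult_le_compat => //; try exact: Rabs_pos; have := Rabs_pos y; lra.
have G3 : 2 * (2 * al0 * e) * K * (C2 * (al' - al)) <= al0 * m * (al' - al) / 2.
  have : 8 * K * C2 * e * (al0 * (al' - al)) <= m * (al0 * (al' - al)).
    by apply: Rmult_le_compat_r => //; apply: Rmult_le_pos; lra.
  by lra.
have G4 : 0 < al0 * m * (al' - al).
  by apply: Rmult_lt_0_compat => //; apply: Rmult_lt_0_compat.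
have [_ G5] := proj1 (Rabs_le_between _ _) G2.
have sqlt : W ^ 2 < W' ^ 2 by rewrite Wsq Wsq'; lra.
case: (Rlt_le_dec W W') => // WW.
have : W' ^ 2 <= W ^ 2 by apply: pow_incr; lra.
by lra.
Qed.

End Edge.

(** * Solutions on the star and their nodes *)

Lemma sumR_const (d : nat) (c : R) : \sumR_(j < d) c = INR d * c.
Proof.
elim: d => [|d IH]; first by rewrite big_ord0 /=; ring.
by rewrite big_ord_recl IH S_INR; ring.
Qed.

Lemma sin_zero_nat (t : R) : 0 < t -> sin t = 0 -> exists k : nat, t = INR k.+1 * PI.
Proof.
move=> t0 /sin_eq_0_0 [z tz]; have p0 := PI_RGT_0.
have z0 : 0 < IZR z by case: (Rlt_le_dec 0 (IZR z)) => // ?; nra.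
have {z0} z0 : (0 < z)%Z by apply: lt_IZR.
exists (Z.to_nat z).-1; rewrite tz; congr (_ * _).
rewrite prednK; last by apply/ssrnat.ltP; lia.
by rewrite INR_IZR_INZ Znat.Z2Nat.id //; lia.
Qed.

Section EdgeNodes.

Variables (nu : R) (n : nat) (b : boundary_condition) (l mu al m M : R).
Hypothesis P : pinched n m M mu (stiffness nu n al).
Hypothesis al0 : 0 < al.

(** Zeros are the points with phase [k * PI]. Phase [0] occurs only at a Dirichlet end, which is not
    interior. Equality is allowed in the upper bound because phase [(K + 1) * PI] is then reached at
    the centre, outside the open edge. *)
Lemma edge_nodes (e : R) (g : R -> R) (K : nat) : e = 1 \/ e = -1 ->
  (forall x, segment l x -> g x = e * wave nu n b l mu al x) ->
  INR K * PI < wave_phase nu n b mu al l <= INR K.+1 * PI ->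
  exists nodes : seq R, [/\ List.NoDup nodes, size nodes = K &
    forall x, List.In x nodes <-> 0 < x < l /\ g x = 0].
Proof.
move=> He Hg [K1 K2]; have p0 := PI_RGT_0; have cb := bc_phase_bounds b.
set c := bc_phase b.
pose f (k : nat) := l - travel n mu (stiffness nu n al) c (INR k * PI).
exists (List.map f (List.seq 1 K)).
have f_inj k k' : f k = f k' -> k = k'.
  move=> ff; apply: INR_eq; apply: (Rmult_eq_reg_r PI); last lra.
  by apply: (travel_inj P (c := c)); rewrite /f in ff; lra.
split.
- apply: List.NoDup_map_NoDup_ForallPairs => [k k' _ _|]; first exact: f_inj.
  exact: List.seq_NoDup.
- by have := List.length_map f (List.seq 1 K); rewrite List.length_seq.
move=> x; rewrite List.in_map_iff; split.
  move=> [k [<- /List.in_seq [k1 kK]]].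
  have INRk1 : 1 <= INR k by apply: (le_INR 1).
  have INRkK : INR k <= INR K by apply: le_INR; lia.
  have ck : c < INR k * PI by rewrite /c; nra.
  have kl : INR k * PI < wave_phase nu n b mu al l by nra.
  have t1 := travel_lt P c ck; have t2 := travel_lt P c kl.
  rewrite travel_refl in t1.
  rewrite /wave_phase (travel_phase P) in t2.
  have fI : 0 < f k < l by rewrite /f; lra.
  split=> //; rewrite Hg; last by rewrite /segment; lra.
  rewrite (wave_at_travel b l P); have := sin_eq_0_1 (INR k * PI).
  by move=> ->; [ring | exists (Z.of_nat k); rewrite INR_IZR_INZ].
move=> [xI gx].
have xs : segment l x by rewrite /segment; lra.
rewrite Hg // in gx.
have w0 : wave nu n b l mu al x = 0 by case: He => E; rewrite E in gx; lra.
have s0 : sin (wave_phase nu n b mu al (l - x)) = 0.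
  by case: (Rmult_integral _ _ w0) => //; lra.
have lx : 0 < l - x by lra.
have lx' : l - x < l by lra.
have p1 := phase_lt P c lx; have p2 := phase_lt P c lx'.
rewrite (phase_0 P) -!/(wave_phase nu n b mu al _) in p1 p2.
have t0 : 0 < wave_phase nu n b mu al (l - x) by rewrite /c in p1; lra.
have [k Hk] := sin_zero_nat t0 s0.
exists k.+1; split.
  rewrite /f -Hk /wave_phase (travel_phase P); ring.
apply/List.in_seq; split; first by apply/ssrnat.leP.
have : INR k.+1 < INR K.+1.
  by apply: (Rmult_lt_reg_r PI) => //; rewrite -Hk; lra.
by move/INR_lt => /=; lia.
Qed.

End EdgeNodes.

(** * Functions on the star as sign patterns times explicit waves *)

Section Waves.

Variables (d : nat) (l : 'I_d -> R).
Hypothesis l_gt0 : forall j, 0 < l j.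
Variables (nu : R) (n : nat) (bc : 'I_d -> boundary_condition).
Hypothesis nu0 : nu <> 0.
Hypothesis n0 : (0 < n)%N.

Definition center_phase (q : R * ('I_d -> R)) (j : 'I_d) : R :=
  wave_phase nu n (bc j) q.1 (q.2 j) (l j).

Definition waves (e : 'I_d -> R) (q : R * ('I_d -> R)) : 'I_d -> R -> R :=
  fun j x => e j * wave nu n (bc j) (l j) q.1 (q.2 j) x.

Definition signs (e : 'I_d -> R) : Prop := forall j, e j = 1 \/ e j = -1.

Definition agrees (e : 'I_d -> R) (q : R * ('I_d -> R)) (phi : 'I_d -> R -> R) : Prop :=
  forall j x, segment (l j) x -> phi j x = waves e q j x.

Lemma segment_0 (j : 'I_d) : segment (l j) 0.
Proof. by have := l_gt0 j; rewrite /segment; lra. Qed.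

Lemma segment_l (j : 'I_d) : segment (l j) (l j).
Proof. by have := l_gt0 j; rewrite /segment; lra. Qed.

Lemma in_Q_gt0 (q : R * ('I_d -> R)) (j : 'I_d) : in_Q nu n q -> 0 < q.2 j.
Proof. by move=> /(_ j) /in_P_iff []. Qed.

Lemma in_Q_pinched (q : R * ('I_d -> R)) (j : 'I_d) : in_Q nu n q ->
  exists m M, pinched n m M q.1 (stiffness nu n (q.2 j)).
Proof. by move=> /(_ j) /in_P_pinched; apply. Qed.

(** Reduces a function given through abstract ray solutions to an explicit sign pattern; from here
    on functions on the star are handled through [e] and [q]. *)
Lemma upto_signs_agrees (q : R * ('I_d -> R)) (phi : 'I_d -> R -> R) :
  in_Q nu n q -> is_phi_upto_signs nu n l bc q phi ->
  exists2 e, signs e & agrees e q phi.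
Proof.
move=> Hq [H _].
have [e He] : exists e : 'I_d -> R, forall j, (e j = 1 \/ e j = -1) /\
    forall x, segment (l j) x -> phi j x = e j * wave nu n (bc j) (l j) q.1 (q.2 j) x.
  apply: (fin_all_exists (P := fun j e => (e = 1 \/ e = -1) /\
    forall x, segment (l j) x -> phi j x = e * wave nu n (bc j) (l j) q.1 (q.2 j) x)).
  move=> j; have [u Hu Hphi] := H j.
  have [m [M P]] := in_Q_pinched j Hq.
  have [e [He Eu]] := ray_unique P (in_Q_gt0 j Hq) Hu.
  exists e; split=> // x xs; rewrite Hphi // Eu //.
  by case: xs.
exists e => j; first by case: (He j).
by move=> x xs; case: (He j) => _; apply.
Qed.

Section Agrees.

Variables (e : 'I_d -> R) (q : R * ('I_d -> R)) (phi : 'I_d -> R -> R).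
Hypothesis He : signs e.
Hypothesis Hq : in_Q nu n q.
Hypothesis Hphi : agrees e q phi.

Lemma agrees_solves (j : 'I_d) :
  solves_on nu n (segment (l j)) q.1 (phi j) /\
  forall x, segment (l j) x -> Derive_on (segment (l j)) (phi j) x =
    e j * wave_slope nu n (bc j) (l j) q.1 (q.2 j) x.
Proof.
have [m [M P]] := in_Q_pinched j Hq.
apply: (signed_wave_solves P (He j)) => [x xs|x xs]; last exact: Hphi.
exact: perfect_segment.
Qed.

Lemma agrees_center_slope (j : 'I_d) : center_slope l phi j =
  e j * wave_slope nu n (bc j) (l j) q.1 (q.2 j) 0.
Proof. by have [_ D] := agrees_solves j; apply: D; apply: segment_0. Qed.

(** This is how [same_signs] determines [e]. The minus sign at a Dirichlet end is due to the phase
    decreasing towards the boundary. *)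
Lemma agrees_end (j : 'I_d) :
  match bc j with
  | Neumann => sign (phi j (l j)) = e j /\
      Derive_on (segment (l j)) (phi j) (l j) = 0
  | Dirichlet => sign (Derive_on (segment (l j)) (phi j) (l j)) = - e j /\
      phi j (l j) = 0
  end.
Proof.
have [m [M P]] := in_Q_pinched j Hq; have al0 := in_Q_gt0 j Hq.
have [_ D] := agrees_solves j; have Dl := D _ (segment_l j).
have pl := Hphi (segment_l j); rewrite /waves in pl.
have [w1 w2] := wave_end (bc j) (l j) P; rewrite w1 in pl; rewrite w2 in Dl.
have sg x : 0 < x -> sign (e j * x) = e j.
  move=> x0; case: (He j) => ->; first by rewrite Rmult_1_l sign_eq_1.
  by rewrite sign_eq_m1; lra.
case: (bc j) P pl Dl => P /= pl Dl.
- rewrite pl Dl sin_0 cos_0; split; last by ring.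
  have -> : e j * - (q.2 j * 1 * sqrt (h n q.1 (stiffness nu n (q.2 j)) 0)) =
      - (e j * (q.2 j * sqrt (h n q.1 (stiffness nu n (q.2 j)) 0))) by ring.
  rewrite sign_opp sg //; apply: Rmult_lt_0_compat => //.
  by apply: sqrt_lt_R0; exact: (h_gt0 0 P).
- rewrite pl Dl sin_PI2 cos_PI2; split; last by ring.
  by rewrite Rmult_1_r sg.
Qed.

Lemma agrees_bc (j : 'I_d) : satisfies_bc (segment (l j)) (l j) (bc j) (phi j).
Proof. by have := agrees_end j; rewrite /satisfies_bc; case: (bc j) => -[]. Qed.

End Agrees.

Lemma agrees_same_signs (e e' : 'I_d -> R) (q q' : R * ('I_d -> R))
    (phi phi' : 'I_d -> R -> R) :
  signs e -> signs e' -> in_Q nu n q -> in_Q nu n q' ->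
  agrees e q phi -> agrees e' q' phi' ->
  same_signs l bc phi phi' <-> forall j, e j = e' j.
Proof.
move=> He He' Hq Hq' A A'.
have K j := agrees_end He Hq A j; have K' j := agrees_end He' Hq' A' j.
split=> H j; have := H j; have := K j; have := K' j; case: (bc j).
- by move=> [-> _] [-> _]; lra.
- by move=> [-> _] [-> _].
- by move=> [-> _] [-> _]; lra.
- by move=> [-> _] [-> _].
Qed.

Lemma is_phi_agrees (e : 'I_d -> R) (q_s q : R * ('I_d -> R))
    (phi_s phi : 'I_d -> R -> R) :
  signs e -> in_Q nu n q_s -> in_Q nu n q -> agrees e q_s phi_s ->
  is_phi nu n l bc phi_s q phi -> agrees e q phi.
Proof.
move=> He Hqs Hq As [H S].
have [e' He' A'] := upto_signs_agrees Hq H.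
have E := proj1 (agrees_same_signs He He' Hqs Hq As A') S.
by move=> j x xs; rewrite A' // /waves E.
Qed.

Lemma center_phase_gt0 (q : R * ('I_d -> R)) (j : 'I_d) :
  in_Q nu n q -> bc_phase (bc j) < center_phase q j.
Proof.
move=> Hq; have [m [M P]] := in_Q_pinched j Hq.
by have := phase_lt P (bc_phase (bc j)) (l_gt0 j); rewrite (phase_0 P).
Qed.

Lemma waves_is_phi (e : 'I_d -> R) (q_s q : R * ('I_d -> R)) (phi_s : 'I_d -> R -> R) :
  signs e -> in_Q nu n q_s -> in_Q nu n q -> agrees e q_s phi_s ->
  (forall j, PI / 2 <= center_phase q j) ->
  is_phi nu n l bc phi_s q (waves e q).
Proof.
move=> He Hqs Hq As th.
have Aw : agrees e q (waves e q) by [].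
split; last by apply/(agrees_same_signs He He Hqs Hq As Aw).
split=> [j|].
  have [m [M P]] := in_Q_pinched j Hq; have al0 := in_Q_gt0 j Hq.
  exists (waves e q j) => //.
  by apply: (signed_wave_ray P al0 (He j)).
rewrite /Lambda_star [RHS]surjective_pairing; congr pair.
apply: functional_extensionality => j.
have [m [M P]] := in_Q_pinched j Hq; have al0 := in_Q_gt0 j Hq.
by apply: (signed_wave_sup_segment P al0 (He j) (th j)).
Qed.

Lemma wave_value_on_segment (q : R * ('I_d -> R)) (j : 'I_d) (t : R) :
  in_Q nu n q -> bc_phase (bc j) <= t <= center_phase q j ->
  exists2 x, segment (l j) x &
    wave nu n (bc j) (l j) q.1 (q.2 j) x = q.2 j * sin t.
Proof.
move=> Hq [t1 t2]; have [m [M P]] := in_Q_pinched j Hq.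
exists (l j - travel n q.1 (stiffness nu n (q.2 j)) (bc_phase (bc j)) t);
  last exact: (wave_at_travel (bc j) (l j) P).
have := travel_ge0 P t1.
have := travel_le P (bc_phase (bc j)) t2.
rewrite /center_phase /wave_phase (travel_phase P) /segment; lra.
Qed.

(** Phase [PI / 2] gives a point where the function is not zero, phase [PI] a zero. The zero has to
    be asked for: with Neumann ends only, central phases that all stay below [PI] give none. *)
Lemma waves_in_Phi_star (e : 'I_d -> R) (q : R * ('I_d -> R)) :
  signs e -> in_Q nu n q -> (forall j, PI / 2 <= center_phase q j) ->
  (exists j, PI <= center_phase q j) ->
  (forall i j, waves e q i 0 = waves e q j 0) ->
  \sumR_(j < d) (e j * wave_slope nu n (bc j) (l j) q.1 (q.2 j) 0) = 0 ->
  in_Phi_star nu n l bc (waves e q).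
Proof.
move=> He Hq th [j0 th0] cont sum0.
have Aw : agrees e q (waves e q) by [].
have cb := bc_phase_bounds (bc j0); have p0 := PI_RGT_0.
have e0 : e j0 <> 0 by case: (He j0) => ->; lra.
split.
- exists q.1; split=> //.
  + by move=> j; have [] := agrees_solves He Hq Aw j.
  + rewrite -[RHS]sum0; apply: eq_bigr => j _.
    exact: (agrees_center_slope He Hq Aw).
  + by move=> j; apply: (agrees_bc He Hq Aw).
- have tI : bc_phase (bc j0) <= PI / 2 <= center_phase q j0 by split; [lra | exact: th].
  have [x xs w] := wave_value_on_segment Hq tI.
  exists j0, x; split=> //; rewrite /waves w sin_PI2 Rmult_1_r.
  by apply: Rmult_integral_contrapositive; split=> //; have := in_Q_gt0 j0 Hq; lra.
- have tI : bc_phase (bc j0) <= PI <= center_phase q j0 by lra.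
  have [x xs w] := wave_value_on_segment Hq tI.
  by exists j0, x; split=> //; rewrite /waves w sin_PI; ring.
Qed.

End Waves.

Lemma cos_at_sin_zero (t : R) : sin t = 0 -> cos t = 1 \/ cos t = -1.
Proof.
move=> s0; have := sin2_cos2 t; rewrite s0 /Rsqr => c2.
have : (cos t - 1) * (cos t + 1) = 0 by lra.
by case/Rmult_integral => ?; [left | right]; lra.
Qed.

Lemma is_sign_mul (x y : R) : x = 1 \/ x = -1 -> y = 1 \/ y = -1 ->
  x * y = 1 \/ x * y = -1.
Proof. by case=> ->; case=> ->; [left|right|right|left]; ring. Qed.

Lemma sign_mul_pos (e x : R) : e = 1 \/ e = -1 -> 0 < x -> sign (e * x) = e.
Proof.
by move=> He x0; case: He => ->; [rewrite Rmult_1_l sign_eq_1 | rewrite sign_eq_m1; lra].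
Qed.

(** * The change of the nodal count near a central zero *)

Section Star.

Variables (d : nat) (l : 'I_d -> R).
Hypothesis l_gt0 : forall j, 0 < l j.
Variables (nu : R) (n : nat) (bc : 'I_d -> boundary_condition).
Hypothesis nu0 : nu <> 0.
Hypothesis n0 : (0 < n)%N.
Hypothesis d_gt2 : (2 < d)%N.

Let phase0 := @center_phase d l nu n bc.
Let agr := @agrees d l nu n bc.

Lemma center_edge (phi : 'I_d -> R -> R) (j : 'I_d) :
  (forall i k, phi i 0 = phi k 0) -> center d_gt2 phi = phi j 0.
Proof. by move=> H; apply: H. Qed.

Lemma agrees_center (e : 'I_d -> R) (q : R * ('I_d -> R)) (phi : 'I_d -> R -> R) (j : 'I_d) :
  agr e q phi -> phi j 0 = e j * (q.2 j * sin (phase0 q j)).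
Proof. by move=> A; rewrite (A j 0 (segment_0 l_gt0 j)) /waves wave_center. Qed.

Lemma center_zero_phase (e : 'I_d -> R) (q : R * ('I_d -> R)) (phi : 'I_d -> R -> R) :
  signs e -> in_Q nu n q -> agr e q phi -> (forall i j, phi i 0 = phi j 0) ->
  center d_gt2 phi = 0 <-> forall j, sin (phase0 q j) = 0.
Proof.
move=> He Hq A cont; split=> [z j|z].
  have al0 := in_Q_gt0 nu0 n0 j Hq.
  have := z; rewrite (center_edge j cont) (agrees_center j A) => zj.
  case: (Rmult_integral _ _ zj); first by case: (He j) => ->; lra.
  by case/Rmult_integral; lra.
by rewrite /center (agrees_center _ A) z; ring.
Qed.

Lemma center_slope_sign (e : 'I_d -> R) (q : R * ('I_d -> R)) (phi : 'I_d -> R -> R)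
    (j : 'I_d) :
  signs e -> in_Q nu n q -> agr e q phi -> sin (phase0 q j) = 0 ->
  sign (center_slope l phi j) = - (e j * cos (phase0 q j)).
Proof.
move=> He Hq A s0.
rewrite (agrees_center_slope l_gt0 nu0 n0 He Hq A) wave_slope_center.
have [m [M P]] := in_Q_pinched nu0 n0 j Hq; have al0 := in_Q_gt0 nu0 n0 j Hq.
have ec := is_sign_mul (He j) (cos_at_sin_zero s0).
rewrite -/(center_phase l nu n bc q j) -/phase0.
set X := sqrt _.
have X0 : 0 < X by apply: sqrt_lt_R0; exact: (h_gt0 (phase0 q j) P).
rewrite (_ : e j * - _ = - (e j * cos (phase0 q j) * (q.2 j * X))); last first.
  rewrite /phase0 /center_phase /=; ring.
by rewrite sign_opp sign_mul_pos //; apply: Rmult_lt_0_compat.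
Qed.

(** At the reference the centre has phase [(k j + 1) * PI] on edge [j], leaving [k j] nodes on the
    open edge. If the phase there advances, the central node enters the edge, otherwise it does not.
    For [v <> 0] the direction [sign (del j)] is [- sign v] times the sign of the reference slope,
    and the loss of the node at the centre gives the [- 1]. *)
Lemma nodal_change (e : 'I_d -> R) (q_s q : R * ('I_d -> R))
    (phi_s phi : 'I_d -> R -> R) :
  signs e -> in_Q nu n q_s -> in_Q nu n q -> agr e q_s phi_s -> agr e q phi ->
  (forall j, sin (phase0 q_s j) = 0) ->
  (forall j, near (PI / 2) (phase0 q_s j) (phase0 q j)) ->
  (forall i j, phi i 0 = phi j 0) ->
  exists Z Z_s : nat,
    [/\ nodal_count d_gt2 l phi Z, nodal_count d_gt2 l phi_s Z_s &
        INR Z - INR Z_s =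
        sign (center d_gt2 phi) ^ 2 *
        (- 1 + INR d / 2 -
         1 / 2 * sign (center d_gt2 phi) *
         \sumR_(j < d) sign (center_slope l phi_s j))].
Proof.
move=> He Hqs Hq As A s0 nth cont.
have p0 := PI_RGT_0.
have [k Hk] : exists k : 'I_d -> nat, forall j, phase0 q_s j = INR (k j).+1 * PI.
  apply: (fin_all_exists (P := fun j k => phase0 q_s j = INR k.+1 * PI)) => j.
  apply: sin_zero_nat => //.
  have := center_phase_gt0 l_gt0 bc nu0 n0 j Hqs; have := bc_phase_bounds (bc j).
  by rewrite /phase0; lra.
pose del j := phase0 q j - phase0 q_s j.
have delb j : - (PI / 2) < del j < PI / 2.
  by have := nth j; rewrite nearP /del; lra.
pose K j := if Rlt_dec 0 (del j) then (k j).+1 else k j.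
have node_s j : exists nodes : seq R, [/\ List.NoDup nodes, size nodes = k j &
    forall x, List.In x nodes <-> 0 < x < l j /\ phi_s j x = 0].
  have [m [M P]] := in_Q_pinched nu0 n0 j Hqs; have al0 := in_Q_gt0 nu0 n0 j Hqs.
  apply: (@edge_nodes _ _ (bc j) _ _ _ _ _ P al0 (e j)) => [|x xs|] //;
    first exact: As.
  by rewrite -/(center_phase l nu n bc q_s j) -/phase0 Hk S_INR; lra.
have node j : exists nodes : seq R, [/\ List.NoDup nodes, size nodes = K j &
    forall x, List.In x nodes <-> 0 < x < l j /\ phi j x = 0].
  have [m [M P]] := in_Q_pinched nu0 n0 j Hq; have al0 := in_Q_gt0 nu0 n0 j Hq.
  apply: (@edge_nodes _ _ (bc j) _ _ _ _ _ P al0 (e j)) => [|x xs|] //;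
    first exact: A.
  rewrite -/(center_phase l nu n bc q j) -/phase0 /K.
  have := delb j; rewrite /del Hk !S_INR => db.
  by case: Rlt_dec => dj; rewrite /is_left ?S_INR; lra.
have [ns Hns] := fin_all_exists node_s; have [nq Hnq] := fin_all_exists node.
have [Z [HZ EZ]] := nodal_count_edges d_gt2 Hnq.
have [Zs [HZs EZs]] := nodal_count_edges d_gt2 Hns.
exists Z, Zs; split=> //.
have cs j : phi_s j 0 = 0 by rewrite (agrees_center j As) s0; ring.
rewrite EZ EZs {EZ EZs HZ HZs}.
case: (Req_EM_T (center d_gt2 phi_s) 0) => [zs|[]]; last exact: cs.
set v := center d_gt2 phi.
have slope j : sign (center_slope l phi_s j) = - (e j * cos (phase0 q_s j)).
  exact: center_slope_sign.
have ec j := is_sign_mul (He j) (cos_at_sin_zero (s0 j)).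
have val j : v = e j * cos (phase0 q_s j) * (q.2 j * sin (del j)).
  rewrite /v (center_edge j cont) (agrees_center j A) /del sin_minus s0.
  case: (cos_at_sin_zero (s0 j)) => ->; ring.
case: Req_EM_T => [v0|v0]; rewrite /is_left.
  have d0 j : ~ 0 < del j.
    move=> dj; have al0 := in_Q_gt0 nu0 n0 j Hq.
    have sd : 0 < sin (del j) by apply: sin_gt_0; have := delb j; lra.
    have := Rmult_lt_0_compat _ _ al0 sd; have := val j; rewrite v0.
    by case: (ec j) => ->; lra.
  rewrite v0 sign_0 (eq_bigr (fun j => INR (k j))).
    by rewrite Rminus_diag; ring.
  by move=> j _; rewrite /K; case: Rlt_dec => [dj|//]; case: (d0 _ dj).
have v2 : sign v ^ 2 = 1.
  case: (Rtotal_order v 0) => [vn|[//|vp]]; [rewrite sign_eq_m1 //|rewrite sign_eq_1 //]; ring.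
(* The indicator of [del j > 0] is [(1 + sign (del j)) / 2], with [sign (del j)] expressed by [v]
   and the reference slope. *)
have KE j : INR (K j) = INR (k j) +
    (1 / 2 + (- (1 / 2) * sign v) * sign (center_slope l phi_s j)).
  have al0 := in_Q_gt0 nu0 n0 j Hq.
  rewrite slope /K.
  have E : sign v = e j * cos (phase0 q_s j) * sign (del j).
    rewrite (val j) !sign_mult (sign_eq_1 _ al0) Rmult_1_l.
    have -> : sign (e j) * sign (cos (phase0 q_s j)) = e j * cos (phase0 q_s j).
      rewrite -sign_mult -{1}(Rmult_1_r (_ * _)) sign_mul_pos //; lra.
    congr (_ * _); case: (Rtotal_order (del j) 0) => [dn|[->|dp]].
    - rewrite !sign_eq_m1 //; apply: sin_lt_0_var; have := delb j; lra.
    - by rewrite sin_0.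
    - rewrite !sign_eq_1 //; apply: sin_gt_0; have := delb j; lra.
  have ee : e j * cos (phase0 q_s j) * (e j * cos (phase0 q_s j)) = 1.
    by case: (ec j) => ->; ring.
  have -> : 1 / 2 + - (1 / 2) * sign v * - (e j * cos (phase0 q_s j)) =
     1 / 2 + 1 / 2 * sign (del j) *
       (e j * cos (phase0 q_s j) * (e j * cos (phase0 q_s j))) by rewrite E; ring.
  rewrite ee; case: Rlt_dec => dj; rewrite /is_left; first by rewrite sign_eq_1 // S_INR; lra.
  have dn : del j < 0.
    case: (Rle_lt_or_eq_dec _ _ (Rnot_lt_le _ _ dj)) => // d0.
    by case: v0; rewrite (val j) d0 sin_0; ring.
  by rewrite sign_eq_m1 //; lra.
rewrite v2 (eq_bigr _ (fun j _ => KE j)) !big_split /= sumR_const sumR_scal.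
move: (\big[Rplus/0]_(j < d) sign _) (\big[Rplus/0]_(j < d) INR (k j)) => X Y.
by field.
Qed.

Lemma locally_edge (q_s : R * ('I_d -> R)) (j : 'I_d) (Q : R * R -> Prop) :
  locally (q_s.1, q_s.2 j) Q -> locally q_s (fun q => Q (q.1, q.2 j)).
Proof.
by move=> [r Hr]; exists r => q [b1 b2]; apply: Hr; split; [exact: b1 | exact: b2].
Qed.

Lemma center_phase_near (q_s : R * ('I_d -> R)) (r : R) : in_Q nu n q_s -> 0 < r ->
  locally q_s (fun q => forall j, near r (phase0 q_s j) (phase0 q j)).
Proof.
move=> Hqs r0; apply: filter_forall_ord => j.
have c := @continuous_wave_phase nu n (bc j) _ _ _ nu0 n0 (l_gt0 j) (Hqs j).
exact: (locally_edge (continuous_near c r0)).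
Qed.

Lemma curve_nodal_change (q_s : R * ('I_d -> R)) (phi_s : 'I_d -> R -> R) :
  in_Q nu n q_s -> is_phi_upto_signs nu n l bc q_s phi_s ->
  in_Phi_star nu n l bc phi_s -> center d_gt2 phi_s = 0 ->
  forall gamma : R -> R * ('I_d -> R),
  local_spectral_curve nu n l bc phi_s gamma ->
  locally q_s (fun q : R * ('I_d -> R) =>
    on_curve gamma q ->
    forall phi : 'I_d -> R -> R, is_phi nu n l bc phi_s q phi ->
    exists Z Z_s : nat,
      [/\ nodal_count d_gt2 l phi Z,
          nodal_count d_gt2 l phi_s Z_s &
          INR Z - INR Z_s =
          sign (center d_gt2 phi) ^ 2 *
          (- 1 + INR d / 2 -
           1 / 2 * sign (center d_gt2 phi) *
           \sumR_(j < d) sign (center_slope l phi_s j))]).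
Proof.
move=> Hqs Hphis [[mu [_ conts _ _]] _ _] z gamma [_ Hg].
have [e He As] := upto_signs_agrees nu0 n0 Hqs Hphis.
have s0 := proj1 (center_zero_phase He Hqs As conts) z.
have p0 := PI_RGT_0; have p20 : 0 < PI / 2 by lra.
apply: (locally_weaken (center_phase_near Hqs p20)) => q nq [tau tq] phi Hphi.
rewrite -{q}tq in nq Hphi *.
have [Hq [phi' Hphi' [[mu' [_ cont' _ _]] _ _]]] := Hg tau.
have A := is_phi_agrees l_gt0 nu0 n0 He Hqs Hq As Hphi.
have A' := is_phi_agrees l_gt0 nu0 n0 He Hqs Hq As Hphi'.
(* [is_phi] does not include continuity at the centre. It is inherited from [phi'], the solution
   that the curve supplies at the same [q], which agrees with [phi] on the star. *)
apply: (nodal_change He Hqs Hq As A s0) => // i j.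
by rewrite !(agrees_center _ A) -!(agrees_center _ A').
Qed.

End Star.

(** * The spectral curve *)

Lemma uniform_radius (d : nat) (r : 'I_d -> R) : (forall j, 0 < r j) ->
  exists r0, 0 < r0 /\ forall j, r0 <= r j.
Proof.
elim: d r => [|d IH] r H; first by exists 1; split; [lra | case].
have [r0 [r00 Hr0]] := IH (fun j => r (lift ord0 j)) (fun j => H _).
exists (Rmin (r ord0) r0); split; first exact: Rmin_pos.
move=> j; case: (unliftP ord0 j) => [k ->|->]; last exact: Rmin_l.
by apply: Rle_trans (Rmin_r _ _) _; apply: Hr0.
Qed.

Lemma near_le (r r' x y : R) : r <= r' -> near r x y -> near r' x y.
Proof. by rewrite /near; lra. Qed.

Lemma sign_sq (x : R) : x <> 0 -> sign x * sign x = 1.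
Proof.
move=> x0; case: (Rtotal_order x 0) => [s|[//|s]]; first by rewrite sign_eq_m1 //; ring.
by rewrite sign_eq_1 //; ring.
Qed.

Section Curve.

Variables (d : nat) (l : 'I_d -> R).
Hypothesis l_gt0 : forall j, 0 < l j.
Variables (nu : R) (n : nat) (bc : 'I_d -> boundary_condition).
Hypothesis nu0 : nu <> 0.
Hypothesis n0 : (0 < n)%N.
Hypothesis d_gt2 : (2 < d)%N.

Let phase0 := @center_phase d l nu n bc.
Let slope0 (q : R * ('I_d -> R)) (j : 'I_d) :=
  wave_slope nu n (bc j) (l j) q.1 (q.2 j) 0.

Variables (e : 'I_d -> R) (q_s : R * ('I_d -> R)).
Hypothesis He : signs e.
Hypothesis Hqs : in_Q nu n q_s.
Hypothesis s0 : forall j, sin (phase0 q_s j) = 0.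
Hypothesis sum0 : \sumR_(j < d) (e j * slope0 q_s j) = 0.

(** Otherwise all central phases lie strictly between [PI / 2] and [PI], where sine is positive and
    cosine negative. Equal central values then force equal signs [e], and slopes of one sign cannot
    add up to zero. So a zero on the star exists even when all ends are Neumann. *)
Lemma some_phase_ge_pi (q : R * ('I_d -> R)) : in_Q nu n q ->
  (forall j, near (PI / 2) (phase0 q_s j) (phase0 q j)) ->
  (forall i j, waves l nu n bc e q i 0 = waves l nu n bc e q j 0) ->
  \sumR_(j < d) (e j * slope0 q j) = 0 ->
  exists j, PI <= phase0 q j.
Proof.
move=> Hq nth cont sumq; apply: NNPP => H.
have p0 := PI_RGT_0.
have lt j : phase0 q j < PI.
  by case: (Rlt_le_dec (phase0 q j) PI) => // le; case: H; exists j.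
have gt j : PI / 2 < phase0 q j.
  have t0 : 0 < phase0 q_s j.
    have := center_phase_gt0 l_gt0 bc nu0 n0 j Hqs; have := bc_phase_bounds (bc j).
    by rewrite /phase0; lra.
  have [k Hk] := sin_zero_nat t0 (s0 j).
  have := nth j; rewrite nearP Hk S_INR; have := pos_INR k; nra.
have pos j : 0 < q.2 j * sin (phase0 q j) /\ 0 < slope0 q j.
  have al0 := in_Q_gt0 nu0 n0 j Hq; have [m [M P]] := in_Q_pinched nu0 n0 j Hq.
  have sp : 0 < sin (phase0 q j) by apply: sin_gt_0; have := gt j; have := lt j; lra.
  split; first exact: Rmult_lt_0_compat.
  rewrite /slope0 wave_slope_center -/(center_phase l nu n bc q j) -/phase0.
  have cn : cos (phase0 q j) < 0.
    by apply: cos_lt_0; have := gt j; have := lt j; lra.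
  have hp := sqrt_lt_R0 _ (h_gt0 (phase0 q j) P).
  set X := sqrt _ in hp *; have := Rmult_lt_0_compat _ _ al0 hp; rewrite /phase0 /center_phase /= in cn *; nra.
have d0 : (0 < d)%N by apply: ltnW; apply: ltnW.
pose o := Ordinal d0.
have eo j : e j = e o.
  have := cont j o; rewrite /waves !wave_center /=.
  have [p1 _] := pos j; have [p2 _] := pos o.
  rewrite /phase0 /center_phase in p1 p2.
  by case: (He j) => ->; case: (He o) => ->; lra.
have S0 : 0 < \sumR_(j < d) slope0 q j.
  rewrite -[X in X < _](Rmult_0_r (INR d)) -(sumR_const d 0).
  by apply: sumR_lt => // j; case: (pos j).
have := sumq; rewrite (eq_bigr (fun j => e o * slope0 q j)); last by move=> j _; rewrite eo.
by rewrite sumR_scal; case: (He o) => ->; lra.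
Qed.

(** In the last clause [A0] is a competitor at the same [mu] with central value zero; strict
    monotonicity of the slope sum in the central value then reads the sign of the latter off the
    slope sum of [A0]. *)
Lemma spectral_curve (phi_s : 'I_d -> R -> R) :
  agrees l nu n bc e q_s phi_s ->
  exists r rho gamma, [/\ 0 < r /\ 0 < rho,
    local_spectral_curve nu n l bc phi_s gamma, gamma 0 = q_s,
    forall tau, (gamma tau).1 = q_s.1 + r / 2 * sin tau &
    forall tau phi, is_phi nu n l bc phi_s (gamma tau) phi ->
    forall A0 : 'I_d -> R, (forall j, near rho (q_s.2 j) (A0 j)) ->
    (forall j, sin (phase0 ((gamma tau).1, A0) j) = 0) ->
    (0 < \sumR_(j < d) (e j * slope0 ((gamma tau).1, A0) j) ->
      0 < sign nu * center d_gt2 phi) /\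
    (\sumR_(j < d) (e j * slope0 ((gamma tau).1, A0) j) < 0 ->
      sign nu * center d_gt2 phi < 0)].
Proof.
move=> As.
have d0 : (0 < d)%N by apply: ltnW; apply: ltnW.
have p0 := PI_RGT_0.
have Hr j := edge_monotone nu0 n0 (l_gt0 j) (Hqs j) (s0 j).
have [rj Hrj] := fin_all_exists Hr.
have [rho [rho0 Hrho]] := uniform_radius (fun j => (Hrj j).1).
(* [ka] is the parity of the reference phase at the centre, and [s j] the sign of the reference
   slope there; [p] and [W] below are the central value and slope normalised so as to increase with
   the amplitude. *)
pose ka j := cos (phase0 q_s j).
pose s j := - (e j * ka j).
have ec j : e j * ka j = 1 \/ e j * ka j = -1.
  exact: is_sign_mul (He j) (cos_at_sin_zero (s0 j)).
have ka2 j : ka j * ka j = 1.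
  by rewrite /ka; case: (cos_at_sin_zero (s0 j)) => ->; ring.
have e2 j : e j * e j = 1 by case: (He j) => ->; ring.
have s_sign j : s j = 1 \/ s j = -1.
  by rewrite /s; case: (ec j) => ->; [right | left]; ring.
pose p j mu al := sign nu * (ka j * wave nu n (bc j) (l j) mu al 0).
pose W j mu al := - (ka j * wave_slope nu n (bc j) (l j) mu al 0).
pose box j mu al := near rho q_s.1 mu /\ near rho (q_s.2 j) al.
have box_edge j mu al : box j mu al ->
    near (rj j) q_s.1 mu /\ near (rj j) (q_s.2 j) al.
  by move=> [b1 b2]; split; apply: near_le (Hrho j) _.
have inP j mu al : box j mu al -> in_P nu n mu al.
  by move=> /box_edge [b1 b2]; case: ((Hrj j).2 mu al b1 b2).
have p_cont j mu al : box j mu al ->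
    continuous (fun q : R * R => p j q.1 q.2) (mu, al).
  move=> b; apply: (continuous_scal_r (sign nu)
    (fun q : R * R => ka j * wave nu n (bc j) (l j) q.1 q.2 0)).
  apply: (continuous_scal_r (ka j) (fun q : R * R => wave nu n (bc j) (l j) q.1 q.2 0)).
  exact: (continuous_wave_center nu0 n0 (l_gt0 j) (inP _ _ _ b)).
have W_cont j mu al : box j mu al ->
    continuous (fun q : R * R => W j q.1 q.2) (mu, al).
  move=> b; apply: (@continuous_opp _ _ R_NormedModule).
  apply: (continuous_scal_r (ka j)
    (fun q : R * R => wave_slope nu n (bc j) (l j) q.1 q.2 0)).
  exact: (continuous_wave_slope_center nu0 n0 (l_gt0 j) (inP _ _ _ b)).
have mono j mu al al' : box j mu al -> box j mu al' -> al < al' ->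
    p j mu al < p j mu al' /\ W j mu al < W j mu al'.
  move=> /box_edge [b1 b2] /box_edge [_ b3] lt.
  by case: ((Hrj j).2 mu al b1 b2) => _ _; apply.
have p_mono j mu al al' : box j mu al -> box j mu al' -> al < al' ->
    p j mu al < p j mu al'.
  by move=> b b' lt; case: (mono j mu al al' b b' lt).
have W_mono j mu al al' : box j mu al -> box j mu al' -> al < al' ->
    W j mu al < W j mu al'.
  by move=> b b' lt; case: (mono j mu al al' b b' lt).
have p_sin j mu A : p j mu (A j) = sign nu * (ka j * (A j * sin (phase0 (mu, A) j))).
  by rewrite /p wave_center.
have p_zero j : p j q_s.1 (q_s.2 j) = 0.
  by rewrite p_sin -surjective_pairing s0; ring.
have sW j mu al : s j * W j mu al = e j * wave_slope nu n (bc j) (l j) mu al 0.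
  rewrite /s /W.
  transitivity (e j * (ka j * ka j) * wave_slope nu n (bc j) (l j) mu al 0); first by ring.
  by rewrite ka2; ring.
have W_zero : \sumR_(j < d) (s j * W j q_s.1 (q_s.2 j)) = 0.
  by rewrite -[RHS]sum0; apply: eq_bigr => j _; apply: sW.
have [v [A [v0 A0 loc]]] :=
  star_curve d0 rho0 s_sign p_cont W_cont p_mono W_mono p_zero W_zero.
have [r Hfam] := loc; have r0 := cond_pos r.
pose fam mu : R * ('I_d -> R) := (mu, fun j => A j mu).
have Hfam' mu : near r q_s.1 mu -> in_Q nu n (fam mu) /\
    [/\ forall j, near (PI / 2) (phase0 q_s j) (phase0 (fam mu) j),
        forall j, waves l nu n bc e (fam mu) j 0 = sign nu * v mu,
        \sumR_(j < d) (e j * slope0 (fam mu) j) = 0,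
        forall j, box j mu (A j mu) & forall j, continuous (A j) mu].
  move=> nmu; have [H S] := Hfam mu nmu.
  split; first by move=> j; have [b _ _] := H j; apply: inP b.
  split.
  - move=> j; have [/box_edge [b1 b2] _ _] := H j.
    by case: ((Hrj j).2 mu _ b1 b2).
  - move=> j; have [_ _ pE] := H j.
    rewrite /waves /=; set w := wave _ _ _ _ _ _ _ in pE *.
    have : p j mu (A j mu) = sign nu * (ka j * w) by [].
    rewrite pE /s => E.
    transitivity (e j * (ka j * ka j) * (sign nu * sign nu) * w).
      by rewrite ka2 sign_sq //; ring.
    transitivity (e j * ka j * sign nu * (sign nu * (ka j * w))); first by ring.
    rewrite -E; transitivity ((e j * e j) * (ka j * ka j) * (sign nu * v mu)); first by ring.
    by rewrite e2 ka2; ring.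
  - by rewrite -[RHS]S; apply: eq_bigr => j _; rewrite sW.
  - by move=> j; case: (H j).
  - by move=> j; case: (H j).
(* The sine compresses the whole line into the interval of [mu] where the family is defined, with
   [tau = 0] at the reference point. *)
pose mut tau := q_s.1 + r / 2 * sin tau.
have nmut tau : near r q_s.1 (mut tau).
  by apply/nearP; rewrite /mut; have := SIN_bound tau; nra.
pose gamma tau := fam (mut tau).
have A0' : fam q_s.1 = q_s.
  by rewrite [RHS]surjective_pairing /fam; congr pair; apply: functional_extensionality.
have mut_cont tau : continuous mut tau.
  by apply: ex_derive_continuous; rewrite /mut; auto_derive.
exists r, rho, gamma; split=> //.
- split.
    move=> tau; have [_ [_ _ _ _ Ac]] := Hfam' _ (nmut tau).
    apply: (continuous_pair (f := mut) (g := fun tau j => A j (mut tau))) => //.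
    by apply: continuous_fct => j; apply: (continuous_comp mut (A j)).
  move=> tau; have [Hq [nth V S _ _]] := Hfam' _ (nmut tau); split=> //.
  have th j : PI / 2 <= phase0 (gamma tau) j.
    have t0 : 0 < phase0 q_s j.
      have := center_phase_gt0 l_gt0 bc nu0 n0 j Hqs; have := bc_phase_bounds (bc j).
      by rewrite /phase0; lra.
    have [k Hk] := sin_zero_nat t0 (s0 j).
    by have := nth j; rewrite nearP -/(gamma tau) Hk S_INR; have := pos_INR k; nra.
  have cont i j : waves l nu n bc e (gamma tau) i 0 = waves l nu n bc e (gamma tau) j 0.
    by rewrite !V.
  exists (waves l nu n bc e (gamma tau)).
    exact: (waves_is_phi l_gt0 nu0 n0 He Hqs Hq As).
  apply: (waves_in_Phi_star l_gt0 nu0 n0 He Hq th) => //.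
  exact: (some_phase_ge_pi Hq).
- by rewrite /gamma /mut sin_0 Rmult_0_r Rplus_0_r.
move=> tau phi Hphi B nB zB.
have [Hq [_ V S bA _]] := Hfam' _ (nmut tau).
have Aphi := is_phi_agrees l_gt0 nu0 n0 He Hqs Hq As Hphi.
have cE : sign nu * center d_gt2 phi = v (mut tau).
  rewrite /center (Aphi _ 0 (segment_0 l_gt0 _)) V -Rmult_assoc sign_sq //; ring.
rewrite cE [(gamma tau).1]/=.
have bB j : box j (mut tau) (B j).
  by split=> //; case: (bA j).
have pA j : p j (mut tau) (A j (mut tau)) = - s j * v (mut tau).
  by have [H _] := Hfam _ (nmut tau); case: (H j).
have pB j : p j (mut tau) (B j) = - s j * 0 by rewrite p_sin zB; ring.
have EA : \sumR_(j < d) (s j * W j (mut tau) (A j (mut tau))) = 0.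
  by rewrite -[RHS]S; apply: eq_bigr => j _; rewrite sW.
have EB : \sumR_(j < d) (e j * slope0 (mut tau, B) j) =
    \sumR_(j < d) (s j * W j (mut tau) (B j)).
  by apply: eq_bigr => j _; rewrite sW.
rewrite EB.
have up := slope_sum_mono d0 s_sign p_mono W_mono bA bB pA pB.
have down := slope_sum_mono d0 s_sign p_mono W_mono bB bA pB pA.
rewrite EA in up down.
case: (Rtotal_order (v (mut tau)) 0) => [vn|[vz|vp]].
- by have := up vn; split; lra.
- have AB j : A j (mut tau) = B j.
    have := pA j; have := pB j; rewrite vz => <- E.
    case: (Rtotal_order (A j (mut tau)) (B j)) => [lt|[//|lt]].
      by have := p_mono j _ _ _ (bA j) (bB j) lt; lra.
    by have := p_mono j _ _ _ (bB j) (bA j) lt; lra.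
  rewrite (eq_bigr (fun j => s j * W j (mut tau) (A j (mut tau)))).
    by rewrite EA; split; lra.
  by move=> j _; rewrite AB.
- by have := down vp; split; lra.
Qed.

End Curve.

(** * Solutions vanishing at the centre for small [mu] *)

Lemma geo_sin_bounds (n : nat) (t : R) : 1 <= geo n (sin t) <= INR n + 1.
Proof. exact: geo_bounds (sin2_le1 t). Qed.

Lemma pinched_exists (n : nat) (mu a : R) : 0 < mu + a -> 0 < mu + (INR n + 1) * a ->
  exists m M, pinched n m M mu a.
Proof.
move=> h1 h2.
exists (Rmin (mu + a) (mu + (INR n + 1) * a)), (Rmax (mu + a) (mu + (INR n + 1) * a)).
by split; [apply: Rmin_pos | split; [apply: Rmin_l | apply: Rmax_l]
  | split; [apply: Rmin_r | apply: Rmax_r]].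
Qed.

(* The half period at stiffness 1; other stiffnesses reduce to it by
   [travel_scaling]. *)
Definition half_period (n : nat) (m : R) : R := travel n m 1 0 PI.

Section HalfPeriod.

Variable n : nat.

Lemma pinched_unit (m : R) : -1 < m -> exists m' M', pinched n m' M' m 1.
Proof. by move=> m1; apply: pinched_exists; have := pos_INR n; lra. Qed.

Lemma half_period_gt0 (m : R) : -1 < m -> 0 < half_period n m.
Proof.
move=> /pinched_unit [m' [M' P]]; rewrite -(travel_refl n m 1 0).
exact: (travel_lt P 0 PI_RGT_0).
Qed.

Lemma travel_half_periods (mu a m M : R) (k : nat) : pinched n m M mu a ->
  travel n mu a 0 (INR k * PI) = INR k * travel n mu a 0 PI.
Proof.
move=> P; elim: k => [|k IH].
  by rewrite /= !Rmult_0_l; apply: travel_refl.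
rewrite S_INR Rmult_plus_distr_r Rmult_1_l Rmult_plus_distr_r Rmult_1_l -IH.
have := travel_Chasles P 0 (INR k * PI) (INR k * PI + PI).
rewrite (_ : travel n mu a (INR k * PI) (INR k * PI + PI) = travel n mu a 0 PI); first by lra.
rewrite /travel.
have := RInt_comp_lin (fun s => / sqrt (h n mu a s)) 1 (INR k * PI) 0 PI.
rewrite !Rmult_1_l Rplus_0_l (Rplus_comm PI) => <-; last exact: ex_RInt_slowness P _ _.
apply: RInt_ext => x _; rewrite /scal /= /mult /= Rmult_1_l Rmult_1_l.
have sk : sin (INR k * PI) = 0.
  by apply: sin_eq_0_1; exists (Z.of_nat k); rewrite INR_IZR_INZ.
have ck : cos (INR k * PI) ^ 2 = 1.
  by have := sin2_cos2 (INR k * PI); rewrite sk /Rsqr /=; lra.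
congr (/ sqrt (_ + _ * _)).
have s2 : sin (x + INR k * PI) ^ 2 = sin x ^ 2.
  by rewrite sin_plus sk -[RHS]Rmult_1_r -ck; ring.
by rewrite /geo s2.
Qed.

Lemma travel_scaling (mu a t : R) : 0 < a -> 0 <= t -> -1 < mu / a ->
  travel n mu a 0 t = / sqrt a * travel n (mu / a) 1 0 t.
Proof.
move=> a0 t0 m1; have [m' [M' P]] := pinched_unit m1.
have sa := sqrt_lt_R0 _ a0.
have := RInt_scal _ 0 t (/ sqrt a) (ex_RInt_slowness P 0 t).
rewrite /scal /= /mult /= /travel => <-.
apply: RInt_ext => x _.
have hx := h_gt0 x P; have sx := sqrt_lt_R0 _ hx.
have -> : h n mu a x = a * h n (mu / a) 1 x by rewrite /h; field; lra.
by rewrite sqrt_mult; [exact: Rinv_mult | lra | lra].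
Qed.

Lemma is_derive_half_period (m0 : R) : -1 < m0 ->
  is_derive (half_period n) m0
    (- (/ 2 * RInt (fun t => / (h n m0 1 t * sqrt (h n m0 1 t))) 0 PI)).
Proof.
move=> m1.
pose f m t := / sqrt (h n m 1 t).
pose g x := - / (2 * (x * sqrt x)).
have p0 := PI_RGT_0.
have h1_gt0 u t : -1 < u -> 0 < h n u 1 t.
  by move=> u1; have := geo_sin_bounds n t; rewrite /h; lra.
have D u t : -1 < u -> is_derive (fun z => f z t) u (g (h n u 1 t)).
  move=> /(h1_gt0 u t); rewrite /f /g /h; set G := geo n (sin t) => G0.
  have sG := sqrt_lt_R0 _ G0.
  auto_derive; first by do !split=> //; lra.
  have e := sqrt_sqrt (u + 1 * G) (Rlt_le _ _ G0).
  set s := sqrt _ in sG e *; rewrite -e.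
  by field; lra.
have half1 : 0 < m0 + 1 by lra.
have loc : locally m0 (fun x => -1 < x).
  by exists (mkposreal _ half1) => x /ball_near; rewrite nearP /=; lra.
have cont u t : -1 < u -> continuous (fun q : R * R => g (h n q.1 1 q.2)) (u, t).
  move=> /(h1_gt0 u t) G0.
  apply: (continuous_comp (fun q : R * R => h n q.1 1 q.2) g).
    apply: (continuous_plus (fun q : R * R => q.1) (fun q => 1 * geo n (sin q.2))).
      exact: continuous_fst.
    apply: (continuous_scal_r 1 (fun q : R * R => geo n (sin q.2))).
    apply: (continuous_comp (fun q : R * R => sin q.2) (geo n)).
      by apply: (continuous_comp (fun q : R * R => q.2) sin);
        [exact: continuous_snd | exact: continuous_sin].
    exact: continuous_geo.
  apply: ex_derive_continuous; rewrite /g; auto_derive.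
  have sG := sqrt_lt_R0 _ G0; do !split=> //.
  by apply: Rgt_not_eq; rewrite /=; nra.
have := @is_derive_RInt_param f 0 PI m0 _ _ _.
have -> : RInt (fun t => Derive (fun u => f u t) m0) 0 PI =
    - (/ 2 * RInt (fun t => / (h n m0 1 t * sqrt (h n m0 1 t))) 0 PI).
  have gc t : continuous (fun t => / (h n m0 1 t * sqrt (h n m0 1 t))) t.
    apply: (continuous_comp (h n m0 1) (fun x => / (x * sqrt x))).
      exact: continuous_h.
    apply: ex_derive_continuous; auto_derive.
    have G0 := h1_gt0 m0 t m1; have sG := sqrt_lt_R0 _ G0; do !split=> //.
    by apply: Rgt_not_eq; nra.
  have ex : ex_RInt (fun t => / (h n m0 1 t * sqrt (h n m0 1 t))) 0 PI.
    by apply: ex_RInt_continuous => t _; exact: gc.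
  have := RInt_scal _ 0 PI (- / 2) ex.
  rewrite /scal /= /mult /= -Ropp_mult_distr_l => <-.
  apply: RInt_ext => t _.
  rewrite (is_derive_unique _ _ _ (D m0 t m1)) /g.
  by rewrite Rinv_mult Ropp_mult_distr_l.
apply.
- by apply: (locally_weaken loc) => u u1 t _; exists (g (h n u 1 t)); apply: D.
- move=> t _.
  apply: (continuity_2d_pt_ext_loc (fun u v => g (h n u 1 v))).
    exists (mkposreal _ half1) => u v /= uh _.
    symmetry; apply: is_derive_unique; apply: D.
    by move/Rabs_def2: uh; lra.
  by apply/continuity_2d_pt_filterlim; apply: (cont m0 t).
- apply: (locally_weaken loc) => u u1; apply: ex_RInt_continuous => t _.
  have [m' [M' P]] := pinched_unit u1.
  exact: (continuous_slowness P).
Qed.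

Lemma continuous_comp_geo (g : R -> R) (t : R) :
  (forall x, 1 <= x -> ex_derive g x) -> continuous (fun t => g (geo n (sin t))) t.
Proof.
move=> Hg; apply: (continuous_comp (fun t => geo n (sin t)) g).
  by apply: (continuous_comp sin (geo n)); [exact: continuous_sin | exact: continuous_geo].
by apply: ex_derive_continuous; apply: Hg; case: (geo_sin_bounds n t).
Qed.

(* Integrating [d/dt (sin t * cos t / sqrt S)] over a half period, where
   [S = geo n (sin t)]. *)
Lemma half_period_0_identity :
  INR n * half_period n 0 -
  (INR n + 1) * RInt (fun t => / (geo n (sin t) * sqrt (geo n (sin t)))) 0 PI =
  (INR n - 2) * RInt (fun t => sin t ^ 2 * / sqrt (geo n (sin t))) 0 PI.
Proof.
pose S t := geo n (sin t).
have S0 t : 0 < S t by have := geo_sin_bounds n t; rewrite /S; lra.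
have c1 t : continuous (fun t => / sqrt (S t)) t.
  apply: (@continuous_comp_geo (fun x => / sqrt x)) => x x1; auto_derive.
  have x0 : 0 < x by lra.
  by have := sqrt_lt_R0 _ x0; do !split=> //; lra.
have c2 t : continuous (fun t => / (S t * sqrt (S t))) t.
  apply: (@continuous_comp_geo (fun x => / (x * sqrt x))) => x x1; auto_derive.
  have x0 : 0 < x by lra.
  have := sqrt_lt_R0 _ x0; do !split=> //.
  by apply: Rgt_not_eq; nra.
have c3 t : continuous (fun t => sin t ^ 2 * / sqrt (S t)) t.
  apply: (continuous_mult (fun t => sin t ^ 2) (fun t => / sqrt (S t))) => //.
  by apply: ex_derive_continuous; auto_derive.
have ex (f : R -> R) : (forall t, continuous f t) -> ex_RInt f 0 PI.
  by move=> fc; apply: ex_RInt_continuous => t _; apply: fc.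
have i1 := RInt_correct _ _ _ (ex _ c1).
have i2 := RInt_correct _ _ _ (ex _ c2).
have i3 := RInt_correct _ _ _ (ex _ c3).
have J : half_period n 0 = RInt (fun t => / sqrt (S t)) 0 PI.
  by apply: RInt_ext => t _; rewrite /h Rplus_0_l Rmult_1_l.
pose F t := sin t * cos t * / sqrt (S t).
pose F' t := / sqrt (S t) * (- INR n + (INR n - 2) * sin t ^ 2) +
  (INR n + 1) * / (S t * sqrt (S t)).
have DS t : is_derive S t (geo' n (sin t) * cos t).
  have := is_derive_comp (geo n) sin t _ _ (is_derive_geo n (sin t)) (is_derive_sin t).
  by rewrite /scal /= /mult /= Rmult_comm.
have DF t : is_derive F t (F' t).
  have sS := sqrt_lt_R0 _ (S0 t).
  rewrite /F /F'; auto_derive.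
    do !split=> //; last lra.
    by exists (geo' n (sin t) * cos t).
  rewrite (is_derive_unique _ _ _ (DS t)).
  have c2' : cos t * cos t = 1 - sin t ^ 2.
    by have := sin2_cos2 t; rewrite /Rsqr /=; lra.
  have g1 := geo_ode n (sin t); have g2 := geo_closed_form n (sin t).
  have sq := sqrt_sqrt (S t) (Rlt_le _ _ (S0 t)).
  set s := sqrt (S t) in sS sq *.
  rewrite -/(S t) -sq in g1 g2 *.
  set x := sin t in g1 g2 c2' *; set y := cos t in c2' *.
  set G := geo' n x in g1 *; set X := (x ^ 2) ^ n in g1 g2.
  (* Eliminates the power [(sin t ^ 2) ^ n] between [geo_ode] and [geo_closed_form], so that the
     derivative contains only [S] and the sine. *)
  have key : x * y * (G * y) =
     2 * (x ^ 2 * (s * s) - (INR n + 1) * (1 - (1 - x ^ 2) * (s * s))).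
    transitivity (x * ((y * y) * G)); first by ring.
    rewrite c2'.
    have -> : (1 - x ^ 2) * G = 2 * (x * (s * s) - (INR n + 1) * (x * X)) by lra.
    have -> : 1 - (1 - x ^ 2) * (s * s) = x ^ 2 * X by lra.
    by ring.
  have s0 : s <> 0 by lra.
  transitivity ((y * y - x ^ 2) * / s - x * y * (G * y) / (2 * s * (s * s))).
    by field.
  by rewrite key c2'; field.
have cF' t : continuous F' t.
  apply: (continuous_plus (fun t => / sqrt (S t) * (- INR n + (INR n - 2) * sin t ^ 2))
    (fun t => (INR n + 1) * / (S t * sqrt (S t)))).
    apply: (continuous_mult (fun t => / sqrt (S t))
      (fun t => - INR n + (INR n - 2) * sin t ^ 2)) => //.
    by apply: ex_derive_continuous; auto_derive.
  exact: (continuous_scal_r (INR n + 1) (fun t => / (S t * sqrt (S t)))).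
have iF := is_RInt_derive F F' 0 PI (fun t _ => DF t) (fun t _ => cF' t).
(* [F] vanishes at both ends of the half period, so the integral of [F'] is zero; this is the linear
   relation claimed among the three integrals. *)
have F0 : minus (F PI) (F 0) = 0.
  by rewrite /F sin_PI sin_0 /minus /plus /opp /=; ring.
rewrite F0 in iF.
have iL := is_RInt_plus _ _ _ _ _ _ (is_RInt_scal _ _ _ (- INR n) _ i1)
  (is_RInt_plus _ _ _ _ _ _ (is_RInt_scal _ _ _ (INR n - 2) _ i3)
    (is_RInt_scal _ _ _ (INR n + 1) _ i2)).
have E := is_RInt_unique _ _ _ _ iL.
have iF' : is_RInt (fun t => plus (scal (- INR n) (/ sqrt (S t)))
   (plus (scal (INR n - 2) (sin t ^ 2 * / sqrt (S t)))
     (scal (INR n + 1) (/ (S t * sqrt (S t)))))) 0 PI 0.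
  apply: is_RInt_ext iF => t _.
  by rewrite /plus /scal /= /mult /= /F'; ring.
have E' := is_RInt_unique _ _ _ _ iF'.
have EE := eq_trans (esym E) E'.
rewrite J; move: EE; rewrite /plus /scal /= /mult /= -/S.
set A := RInt _ 0 PI; set B := RInt _ 0 PI; set C := RInt _ 0 PI.
by lra.
Qed.

End HalfPeriod.

(* The solutions vanishing at the centre with [k] half waves on an edge of
   length [l] form the curve [mu = m * (k / l * half_period n m) ^ 2],
   [alpha = amplitude m]; their slope at the centre is proportional to
   [(k / l) ^ (1 + 1 / n) * slope_factor n m]. *)
Definition slope_factor (n : nat) (m : R) : R :=
  Rpower (half_period n m) (1 + 1 / INR n) * sqrt (1 + m).

Definition amplitude (nu : R) (n : nat) (kap m : R) : R :=
  Rpower ((kap * half_period n m) ^ 2 / nu) (1 / (2 * INR n)).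

(** * Explicit modes vanishing at the centre *)

Section Amplitude.

Variables (nu : R) (n : nat).
Hypothesis nu0 : 0 < nu.
Hypothesis n0 : (0 < n)%N.

Lemma INR_n_gt0 : 0 < INR n.
Proof. by apply: lt_0_INR; apply/ssrnat.ltP. Qed.

Lemma ex_derive_half_period (m : R) : -1 < m -> ex_derive (half_period n) m.
Proof. by move=> /is_derive_half_period D; eexists; exact: D. Qed.

(** The logarithmic derivative at [0] is [(1 + 1 / n) * J' / J + 1 / 2], which
    [half_period_0_identity] rewrites as [(n - 2) * I3 / (2 * n * J)] with a positive integral
    [I3]. *)
Lemma is_derive_slope_factor : exists R1, is_derive (slope_factor n) 0 R1 /\
  (n <> 2%N -> R1 <> 0).
Proof.
have m1 : -1 < 0 by lra.
have J0 := half_period_gt0 n m1; have nn := INR_n_gt0.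
have D := is_derive_half_period n m1.
have E : RInt (fun t => / (h n 0 1 t * sqrt (h n 0 1 t))) 0 PI =
         RInt (fun t => / (geo n (sin t) * sqrt (geo n (sin t)))) 0 PI.
  by apply: RInt_ext => t _; rewrite /h Rplus_0_l Rmult_1_l.
rewrite E in D; have id := half_period_0_identity n.
set I := RInt _ 0 PI in D id; set I3 := RInt _ 0 PI in id.
set J := half_period n 0 in J0 id.
exists (Rpower J (1 + 1 / INR n) * ((1 + 1 / INR n) * (- (/ 2 * I) / J) + / 2)).
split.
  rewrite /slope_factor /Rpower; auto_derive.
    by do !split=> //; [exists (- (/ 2 * I)) | lra].
  rewrite (is_derive_unique _ _ _ D) -/J Rplus_0_r sqrt_1.
  rewrite (_ : 1 / INR n = 1 * / INR n) //; field; lra.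
move=> n2; apply: Rmult_integral_contrapositive; split.
  by apply: Rgt_not_eq; exact: exp_pos.
have -> : (1 + 1 / INR n) * (- (/ 2 * I) / J) + / 2 =
  (INR n - 2) * I3 / (2 * INR n * J) by rewrite -id; field; lra.
have I30 : 0 < I3.
  apply: RInt_gt_0; first exact: PI_RGT_0.
    move=> t tI; have gb := geo_sin_bounds n t.
    have g0 : 0 < geo n (sin t) by lra.
    apply: Rmult_lt_0_compat; last by apply: Rinv_0_lt_compat; exact: sqrt_lt_R0.
    by apply: pow_lt; apply: sin_gt_0; lra.
  move=> t _; apply: (continuous_mult (fun t => sin t ^ 2) (fun t => / sqrt (geo n (sin t)))).
    by apply: ex_derive_continuous; auto_derive.
  apply: (@continuous_comp_geo n (fun x => / sqrt x)) => x x1; auto_derive.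
  have x0 : 0 < x by lra.
  by have := sqrt_lt_R0 _ x0; do !split=> //; lra.
have n2' : INR n - 2 <> 0.
  move=> z; apply: n2; apply: INR_eq; rewrite /=; lra.
apply: Rmult_integral_contrapositive; split.
  by apply: Rmult_integral_contrapositive; split=> //; lra.
apply: Rinv_neq_0_compat; apply: Rgt_not_eq.
by apply: Rmult_lt_0_compat => //; lra.
Qed.

Lemma continuous_half_period (m : R) : -1 < m -> continuous (half_period n) m.
Proof. by move=> m1; apply: ex_derive_continuous; apply: ex_derive_half_period. Qed.

(** Intermediate values of [m * (kap * half_period n m) ^ 2] on [[- b, b]], at whose ends it has
    opposite signs. Which root is found does not matter; [b <= 1 / 2] keeps [m > -1]. *)
Lemma small_root (kap eta : R) : 0 < kap -> 0 < eta -> exists rho, 0 < rho /\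
  forall mu, Rabs mu < rho -> exists m, Rabs m < eta /\ -1 < m /\
    m * (kap * half_period n m) ^ 2 = mu.
Proof.
move=> k0 eta0.
pose b := Rmin (eta / 2) (1 / 2).
have b0 : 0 < b by apply: Rmin_pos; lra.
have b1 : b <= eta / 2 := Rmin_l _ _; have b2 : b <= 1 / 2 := Rmin_r _ _.
pose M m := m * (kap * half_period n m) ^ 2.
have sq m : -1 < m -> 0 < (kap * half_period n m) ^ 2.
  by move=> m1; apply: pow_lt; apply: Rmult_lt_0_compat => //; exact: half_period_gt0.
have Mlo : M (- b) < 0 by have := sq (- b) ltac:(lra); rewrite /M; nra.
have Mhi : 0 < M b by have := sq b ltac:(lra); rewrite /M; nra.
exists (Rmin (- M (- b)) (M b)); split; first by apply: Rmin_pos; lra.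
move=> mu hmu.
have h1 : Rabs mu < - M (- b) by apply: Rlt_le_trans hmu _; exact: Rmin_l.
have h2 : Rabs mu < M b by apply: Rlt_le_trans hmu _; exact: Rmin_r.
have ra := Rle_abs mu; have rb := Rle_abs (- mu); rewrite Rabs_Ropp in rb.
have lohi : - b < b by lra.
have lo : M (- b) - mu < 0 by lra.
have hi : 0 < M b - mu by lra.
have cont x : - b <= x <= b -> continuity_pt (fun m => M m - mu) x.
  move=> xI; apply/continuity_pt_filterlim.
  apply: (ex_derive_continuous (fun m => M m - mu)).
  have x1 : -1 < x by lra.
  have ed := ex_derive_half_period x1.
  by rewrite /M; auto_derive.
have [m [mI fm]] := Ranalysis5.IVT_interv _ _ _ cont lohi lo hi.
exists m; split; first by apply: Rabs_def1; lra.
by split; [lra | rewrite -/(M m); lra].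
Qed.

Section Mode.

Variables (k : nat) (l m : R).
Hypothesis k0 : (0 < k)%N.
Hypothesis l0 : 0 < l.
Hypothesis m1 : -1 < m.

Let kap := INR k / l.
Let a := (kap * half_period n m) ^ 2.
Let al := amplitude nu n kap m.

Lemma kap_gt0 : 0 < kap.
Proof. by apply: Rdiv_lt_0_compat => //; apply: lt_0_INR; apply/ssrnat.ltP. Qed.

Lemma mode_root_gt0 : 0 < kap * half_period n m.
Proof. by apply: Rmult_lt_0_compat; [exact: kap_gt0 | exact: half_period_gt0]. Qed.

Lemma mode_stiffness_gt0 : 0 < a.
Proof. by apply: pow_lt; exact: mode_root_gt0. Qed.

Lemma amplitude_gt0 : 0 < al.
Proof. exact: exp_pos. Qed.

Lemma stiffness_amplitude : stiffness nu n al = a.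
Proof.
have nn := INR_n_gt0; have a0 := mode_stiffness_gt0.
have an : 0 < a / nu by apply: Rdiv_lt_0_compat.
rewrite /stiffness -pow_mult -Rpower_pow; last exact: amplitude_gt0.
rewrite /al /amplitude -/a Rpower_mult mult_INR.
rewrite (_ : 1 / (2 * INR n) * (INR 2 * INR n) = 1); last by rewrite /=; field; lra.
by rewrite Rpower_1 //; field; lra.
Qed.

Lemma mode_h_gt0 : 0 < m * a + a /\ 0 < m * a + (INR n + 1) * a.
Proof. by have a0 := mode_stiffness_gt0; have nn := INR_n_gt0; split; nra. Qed.

Lemma mode_in_P : in_P nu n (m * a) al.
Proof.
have nu1 : nu <> 0 by lra.
apply/in_P_iff => //; rewrite stiffness_amplitude.
by have [h1 h2] := mode_h_gt0; split=> //; exact: amplitude_gt0.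
Qed.

(** By [travel_scaling] a half period has length [half_period n m / sqrt a], and
    [sqrt a = (k / l) * half_period n m] is chosen so that [k] of them fill the edge. *)
Lemma mode_phase : wave_phase nu n Dirichlet (m * a) al l = INR k * PI.
Proof.
have [h1 h2] := mode_h_gt0; have [m' [M' P]] := pinched_exists h1 h2.
have a0 := mode_stiffness_gt0.
have ma : m * a / a = m by field; lra.
rewrite /wave_phase stiffness_amplitude -(phase_travel P 0 (INR k * PI)).
congr phase; rewrite (travel_half_periods k P) travel_scaling ?ma //; last first.
  by have := PI_RGT_0; lra.
rewrite -/(half_period n m) /a (_ : _ ^ 2 = (kap * half_period n m) * (kap * half_period n m));
  last by ring.
have r0 := mode_root_gt0; have J0 := half_period_gt0 n m1.
rewrite sqrt_square; last lra.
have K0 : 0 < INR k by apply: lt_0_INR; apply/ssrnat.ltP.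
by rewrite /kap; field; lra.
Qed.

(** At a zero [geo] is [1], so the speed is [sqrt (a * (1 + m))]. As [sqrt a] is
    [kap * half_period n m] and [al] is proportional to its power [1 / n], the powers of [kap] and
    of the half period separate. *)
Lemma mode_slope : wave_slope nu n Dirichlet l (m * a) al 0 =
  - (cos (INR k * PI) * (Rpower nu (- (1 / (2 * INR n))) *
    (Rpower kap (1 + 1 / INR n) * slope_factor n m))).
Proof.
have a0 := mode_stiffness_gt0; have nn := INR_n_gt0.
rewrite wave_slope_center /= mode_phase stiffness_amplitude.
have sk : sin (INR k * PI) = 0.
  by apply: sin_eq_0_1; exists (Z.of_nat k); rewrite INR_IZR_INZ.
have r0 := mode_root_gt0; have J0 := half_period_gt0 n m1; have kp := kap_gt0.
have -> : h n (m * a) a (INR k * PI) = a * (1 + m).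
  have g0 : geo n 0 = 1 by elim: (n) => // i IH; rewrite geo_S IH /=; ring.
  by rewrite /h sk g0; ring.
rewrite sqrt_mult; try lra.
have sa : sqrt a = kap * half_period n m.
  rewrite /a (_ : _ ^ 2 = (kap * half_period n m) * (kap * half_period n m)); last by ring.
  by rewrite sqrt_square; lra.
rewrite sa.
have alE : al = Rpower nu (- (1 / (2 * INR n))) * Rpower (kap * half_period n m) (1 / INR n).
  rewrite /al /amplitude /Rpower -exp_plus; congr exp.
  rewrite (ln_div _ _ a0 nu0) /a.
  rewrite (_ : _ ^ 2 = (kap * half_period n m) * (kap * half_period n m)); last by ring.
  by rewrite ln_mult //; field; lra.
have pw : Rpower (kap * half_period n m) (1 / INR n) * (kap * half_period n m) =
    Rpower kap (1 + 1 / INR n) * Rpower (half_period n m) (1 + 1 / INR n).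
  rewrite Rpower_mult_distr // Rpower_plus Rpower_1 //; ring.
rewrite alE /slope_factor.
transitivity (- (cos (INR k * PI) * (Rpower nu (- (1 / (2 * INR n))) *
  (Rpower (kap * half_period n m) (1 / INR n) * (kap * half_period n m) * sqrt (1 + m))))).
  by ring.
by rewrite pw; ring.
Qed.

End Mode.

End Amplitude.

(** * Crossing [mu = 0] *)

Lemma nodal_count_unique (d : nat) (d_gt2 : (2 < d)%N) (l : 'I_d -> R)
    (phi : 'I_d -> R -> R) (Z Z' : nat) :
  nodal_count d_gt2 l phi Z -> nodal_count d_gt2 l phi Z' -> Z = Z'.
Proof.
move=> [s [Ns <- Is]] [s' [Ns' <- Is']].
have le (u v : seq (option ('I_d * R))) : List.NoDup u ->
    (forall p, List.In p u -> List.In p v) -> (size u <= size v)%N.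
  by move=> Nu uv; apply/ssrnat.leP; exact: (List.NoDup_incl_length Nu uv).
by apply/eqP; rewrite eqn_leq !le // => p; rewrite Is Is'.
Qed.

Section DirichletStar.

Variables (d : nat) (l : 'I_d -> R).
Hypothesis l_gt0 : forall j, 0 < l j.
Variables (nu : R) (n : nat) (bc : 'I_d -> boundary_condition).
Hypothesis nu0 : 0 < nu.
Hypothesis n0 : (0 < n)%N.
Hypothesis d_gt2 : (2 < d)%N.
Hypothesis bcD : forall j, bc j = Dirichlet.
Variables (zeta : 'I_d -> R) (k : 'I_d -> nat).
Hypothesis zetaP : signs zeta.
Hypothesis k0 : forall j, (0 < k j)%N.

Let kap j := INR (k j) / l j.

Hypothesis slopes0 : \sumR_(j < d) (zeta j * Rpower (kap j) (1 + 1 / INR n)) = 0.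

Let phase0 := @center_phase d l nu n bc.
Let slope0 (q : R * ('I_d -> R)) (j : 'I_d) :=
  wave_slope nu n (bc j) (l j) q.1 (q.2 j) 0.
(** The central slope has sign [- (e j * cos (k j * PI))], which this choice makes equal to
    [zeta j]. *)
Let e (j : 'I_d) := - (zeta j * cos (INR (k j) * PI)).
Let q_s : R * ('I_d -> R) := (0, fun j => amplitude nu n (kap j) 0).
Let phi_s := waves l nu n bc e q_s.

Lemma nu_neq0' : nu <> 0. Proof. by lra. Qed.

Lemma sin_kPI (i : nat) : sin (INR i * PI) = 0.
Proof. by apply: sin_eq_0_1; exists (Z.of_nat i); rewrite INR_IZR_INZ. Qed.

Lemma mode_signs : signs e.
Proof.
move=> j; have := is_sign_mul (zetaP j) (cos_at_sin_zero (sin_kPI (k j))).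
by rewrite /e; case=> ->; [right | left]; ring.
Qed.

Lemma mode_edge (mu m : R) (A : 'I_d -> R) (j : 'I_d) : -1 < m ->
  m * (kap j * half_period n m) ^ 2 = mu -> A j = amplitude nu n (kap j) m ->
  [/\ in_P nu n mu (A j), phase0 (mu, A) j = INR (k j) * PI &
   e j * slope0 (mu, A) j = Rpower nu (- (1 / (2 * INR n))) *
     (zeta j * (Rpower (kap j) (1 + 1 / INR n) * slope_factor n m))].
Proof.
move=> m1 <- Aj; split.
- by rewrite Aj; apply: mode_in_P.
- by rewrite /phase0 /center_phase /= Aj bcD; apply: mode_phase.
- rewrite /slope0 /= Aj bcD (mode_slope nu0 n0 (k0 j) (l_gt0 j) m1) /e -/(kap j).
  have c2 : cos (INR (k j) * PI) * cos (INR (k j) * PI) = 1.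
    by have := sin2_cos2 (INR (k j) * PI); rewrite sin_kPI /Rsqr; lra.
  set c := cos _ in c2 *; set X := Rpower nu _; set Y := Rpower (kap j) _.
  transitivity (c * c * (X * (zeta j * (Y * slope_factor n m)))); first by ring.
  by rewrite c2; ring.
Qed.

Lemma q_s_edge (j : 'I_d) :
  [/\ in_P nu n 0 (q_s.2 j), phase0 q_s j = INR (k j) * PI &
   e j * slope0 q_s j = Rpower nu (- (1 / (2 * INR n))) *
     (zeta j * (Rpower (kap j) (1 + 1 / INR n) * slope_factor n 0))].
Proof. by apply: mode_edge => //; [lra | ring]. Qed.

Lemma q_s_in_Q : in_Q nu n q_s.
Proof. by move=> j; case: (q_s_edge j). Qed.

Lemma q_s_zero (j : 'I_d) : sin (phase0 q_s j) = 0.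
Proof. by case: (q_s_edge j) => _ -> _; exact: sin_kPI. Qed.

Lemma slope_sum_modes (mu : R) (A m : 'I_d -> R) : (forall j, -1 < m j) ->
  (forall j, m j * (kap j * half_period n (m j)) ^ 2 = mu) ->
  (forall j, A j = amplitude nu n (kap j) (m j)) ->
  \sumR_(j < d) (e j * slope0 (mu, A) j) = Rpower nu (- (1 / (2 * INR n))) *
    \sumR_(j < d) (zeta j * (Rpower (kap j) (1 + 1 / INR n) * slope_factor n (m j))).
Proof.
move=> m1 mmu mA; rewrite -sumR_scal; apply: eq_bigr => j _.
by case: (mode_edge (m1 j) (mmu j) (mA j)).
Qed.

(** At [m = 0] all edges share one [slope_factor], so up to a positive constant the hypothesis
    [slopes0] is the Neumann condition at the centre. *)
Lemma factor_sum_0 (c : R) :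
  \sumR_(j < d) (zeta j * (Rpower (kap j) (1 + 1 / INR n) * c)) = 0.
Proof.
rewrite (eq_bigr (fun j => c * (zeta j * Rpower (kap j) (1 + 1 / INR n)))).
  by rewrite sumR_scal slopes0; ring.
by move=> j _; ring.
Qed.

Lemma q_s_slopes : \sumR_(j < d) (e j * slope0 q_s j) = 0.
Proof.
rewrite (@slope_sum_modes 0 q_s.2 (fun _ => 0)) //.
- by rewrite factor_sum_0; ring.
- by move=> j; lra.
- by move=> j; ring.
Qed.

Lemma phi_s_agrees : agrees l nu n bc e q_s phi_s.
Proof. by []. Qed.

Lemma k_ge1 (j : 'I_d) : 1 <= INR (k j).
Proof. by apply: (le_INR 1); apply/ssrnat.leP. Qed.

Lemma phi_s_is_phi : is_phi nu n l bc phi_s q_s phi_s.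
Proof.
apply: (waves_is_phi l_gt0 nu_neq0' n0 mode_signs q_s_in_Q q_s_in_Q phi_s_agrees) => j.
case: (q_s_edge j) => _; rewrite -/phase0 => -> _.
by have := PI_RGT_0; have := k_ge1 j; nra.
Qed.

Lemma phi_s_center (j : 'I_d) : phi_s j 0 = 0.
Proof.
rewrite (agrees_center l_gt0 j phi_s_agrees) -/phase0 q_s_zero; ring.
Qed.

Lemma phi_s_in_Phi_star : in_Phi_star nu n l bc phi_s.
Proof.
have th j : PI <= phase0 q_s j.
  case: (q_s_edge j) => _ -> _.
  by have := PI_RGT_0; have := k_ge1 j; nra.
apply: (waves_in_Phi_star l_gt0 nu_neq0' n0 mode_signs q_s_in_Q).
- by move=> j; have := th j; rewrite /phase0; have := PI_RGT_0; lra.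
- by exists (Ordinal (ltnW (ltnW d_gt2))); apply: th.
- by move=> i j; rewrite -/phi_s !phi_s_center.
- exact: q_s_slopes.
Qed.

Lemma phi_s_slope_sign (j : 'I_d) : sign (center_slope l phi_s j) = zeta j.
Proof.
rewrite (center_slope_sign l_gt0 nu_neq0' n0 mode_signs q_s_in_Q phi_s_agrees (q_s_zero j)).
case: (q_s_edge j) => _; rewrite -/phase0 => -> _; rewrite /e.
have c2 : cos (INR (k j) * PI) * cos (INR (k j) * PI) = 1.
  by have := sin2_cos2 (INR (k j) * PI); rewrite sin_kPI /Rsqr; lra.
transitivity (zeta j * (cos (INR (k j) * PI) * cos (INR (k j) * PI))); first by ring.
by rewrite c2; ring.
Qed.

Lemma phi_s_nodal_count : exists2 Z : nat, nodal_count d_gt2 l phi_s Z &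
  INR Z = 1 - INR d + \sumR_(j < d) INR (k j).
Proof.
have node j : exists nodes : seq R, [/\ List.NoDup nodes, size nodes = (k j).-1 &
    forall x, List.In x nodes <-> 0 < x < l j /\ phi_s j x = 0].
  have [m [M P]] := in_Q_pinched nu_neq0' n0 j q_s_in_Q.
  have al0 := in_Q_gt0 nu_neq0' n0 j q_s_in_Q.
  apply: (@edge_nodes _ _ (bc j) _ _ _ _ _ P al0 (e j)) => //; first exact: mode_signs.
  rewrite -/(center_phase l nu n bc q_s j) -/phase0.
  case: (q_s_edge j) => _ -> _; rewrite prednK //; split; last exact: Rle_refl.
  apply: Rmult_lt_compat_r; first exact: PI_RGT_0.
  by apply: lt_INR; apply/ssrnat.ltP; rewrite prednK.
have [nodes Hn] := fin_all_exists node.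
have [Z [HZ EZ]] := nodal_count_edges d_gt2 Hn.
exists Z => //; rewrite EZ.
case: Req_EM_T => [z|[]]; last exact: phi_s_center.
rewrite /is_left (eq_bigr (fun j => -1 + INR (k j))).
  rewrite big_split /= sumR_const.
  move: (\big[Rplus/0]_(j < d) INR (k j)) => X; ring.
move=> j _; have := prednK (k0 j) => {2}<-; rewrite S_INR; ring.
Qed.

(* The slope sum is a positive constant times
   [mu * \sumR_(j < d) (zeta j * (k j / l j) ^ (- 1 + 1 / n) * G (m j))],
   where [G] is continuous at 0 and every [m j] tends to 0 with [mu]. *)
Lemma slope_sum_sign : n <> 2%N ->
  \sumR_(j < d) (zeta j * Rpower (kap j) (- 1 + 1 / INR n)) <> 0 ->
  exists L, L <> 0 /\ forall rho, 0 < rho -> exists del, 0 < del /\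
    forall mu, 0 < Rabs mu < del -> exists A : 'I_d -> R,
    [/\ forall j, near rho (q_s.2 j) (A j), forall j, sin (phase0 (mu, A) j) = 0 &
        0 < L * mu * \sumR_(j < d) (e j * slope0 (mu, A) j)].
Proof.
move=> n2 sum_neq0.
have [R1 [DR R1n0]] := is_derive_slope_factor n0; have {R1n0} R10 := R1n0 n2.
have m1 : -1 < 0 by lra.
have J0 := half_period_gt0 n m1.
(* From [mu = m * (kap * half_period n m) ^ 2], the increment of [slope_factor] from [0] to [m] is
   [mu / kap ^ 2] times [G m]. Division by [kap ^ 2] turns the exponent [1 + 1 / n] into
   [- 1 + 1 / n]. *)
pose G m := diff_quotient (slope_factor n) 0 R1 m * / (half_period n m ^ 2).
pose w j := Rpower (kap j) (- 1 + 1 / INR n).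
have w0 j : 0 < w j by exact: exp_pos.
pose L := G 0 * \sumR_(j < d) (zeta j * w j).
have G0 : G 0 <> 0.
  rewrite /G diff_quotient_0; apply: Rmult_integral_contrapositive; split=> //.
  by apply: Rinv_neq_0_compat; apply: pow_nonzero; lra.
have L0 : L <> 0 by apply: Rmult_integral_contrapositive; split.
exists L; split=> // rho rho0.
have cJ := continuous_half_period (n := n) m1.
have cG : continuous G 0.
  apply: (continuous_mult (diff_quotient (slope_factor n) 0 R1)
    (fun m => / (half_period n m ^ 2))); first exact: continuous_diff_quotient.
  apply: (continuous_comp (half_period n) (fun x => / (x ^ 2))) => //.
  apply: ex_derive_continuous; auto_derive.
  by apply: Rgt_not_eq; nra.
have W0 : 0 <= \sumR_(j < d) w j.
  rewrite -[X in X <= _](Rmult_0_r (INR d)) -(sumR_const d 0).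
  by apply: sumR_le => j; apply: Rlt_le.
(* Replacing every [G (m j)] by [G 0] then changes the sum by less than [Rabs L], which preserves
   its sign; the added [1] keeps the denominator positive. *)
pose eps := Rabs L / (1 + \sumR_(j < d) w j).
have aL : 0 < Rabs L by exact: Rabs_pos_lt.
have eps0 : 0 < eps by apply: Rdiv_lt_0_compat; lra.
have epsW : (eps * (\sumR_(j < d) w j) < Rabs L)%R.
  have E : (eps * (1 + \sumR_(j < d) w j))%R = Rabs L by rewrite /eps; field; lra.
  by lra.
have LG := continuous_near cG eps0.
have camp j : continuous (amplitude nu n (kap j)) 0.
  apply: (continuous_comp (half_period n)
    (fun x => Rpower ((kap j * x) ^ 2 / nu) (1 / (2 * INR n)))) => //.
  have kj := kap_gt0 (k0 j) (l_gt0 j).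
  apply: ex_derive_continuous; rewrite /Rpower; auto_derive.
  have kJ : 0 < kap j * half_period n 0 by apply: Rmult_lt_0_compat.
  by apply: Rmult_lt_0_compat; [nra | exact: Rinv_0_lt_compat].
have LA : locally 0 (fun m => forall j, near rho (q_s.2 j) (amplitude nu n (kap j) m)).
  by apply: filter_forall_ord => j; exact: (continuous_near (camp j) rho0).
have [eta Heta] := locally_and LG LA.
have root j := small_root n (kap_gt0 (k0 j) (l_gt0 j)) (cond_pos eta).
have [rt Hrt] := fin_all_exists root.
have [del [del0 Hdel]] := uniform_radius (fun j => (Hrt j).1).
exists del; split=> // mu [mu0 mudel].
have mj j : exists m, Rabs m < eta /\ -1 < m /\ m * (kap j * half_period n m) ^ 2 = mu.
  by apply: (Hrt j).2; apply: Rlt_le_trans mudel (Hdel j).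
have [m Hm] := fin_all_exists mj.
have m_near j : Rabs (G (m j) - G 0) < eps /\
    forall i, near rho (q_s.2 i) (amplitude nu n (kap i) (m j)).
  apply: Heta; apply/ball_near; rewrite /near Rminus_0_r; exact: (Hm j).1.
pose A j := amplitude nu n (kap j) (m j).
have edge j := @mode_edge mu (m j) A j (Hm j).2.1 (Hm j).2.2 erefl.
exists A; split.
- by move=> j; apply: (m_near j).2.
- by move=> j; case: (edge j) => _ -> _; exact: sin_kPI.
rewrite (@slope_sum_modes mu A m) //; try by move=> j; case: (Hm j) => _ [].
set C := Rpower nu _; have C0 : 0 < C by exact: exp_pos.
have mu_neq0 : mu <> 0 by move=> z; rewrite z Rabs_R0 in mu0; lra.
have E : \sumR_(j < d) (zeta j * (Rpower (kap j) (1 + 1 / INR n) * slope_factor n (m j))) =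
    mu * \sumR_(j < d) (zeta j * w j * G (m j)).
  (* Splits off the terms at [m = 0], whose sum vanishes by [factor_sum_0]. *)
  rewrite (eq_bigr (fun j => mu * (zeta j * w j * G (m j)) +
    zeta j * (Rpower (kap j) (1 + 1 / INR n) * slope_factor n 0))).
    by rewrite big_split /= sumR_scal factor_sum_0 Rplus_0_r.
  move=> j _.
  have [_ [mj1 mjE]] := Hm j.
  have Jm := half_period_gt0 n mj1; have kj := kap_gt0 (k0 j) (l_gt0 j).
  rewrite -/(kap j) in kj.
  (* The value filled in by [diff_quotient] at [0] never occurs, as [mu <> 0] excludes [m j = 0]. *)
  have mj0 : m j <> 0 by move=> z; apply: mu_neq0; rewrite -mjE z; ring.
  rewrite /G /diff_quotient; case: Req_EM_T => [z|mj0']; first by [].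
  rewrite /is_left Rplus_0_l.
  have -> : Rpower (kap j) (1 + 1 / INR n) = kap j ^ 2 * w j.
    rewrite /w -(Rpower_pow 2) // -Rpower_plus; congr Rpower; rewrite /=; ring.
  by rewrite -{1}mjE; field; lra.
rewrite E.
set X := \sumR_(j < d) (zeta j * w j * G (m j)).
have XL : Rabs (X - L) < Rabs L.
  have bound j : - eps * w j <= zeta j * w j * G (m j) - G 0 * (zeta j * w j) <= eps * w j.
    have [/Rabs_def2 [g1 g2] _] := m_near j; have wj := w0 j.
    have -> : zeta j * w j * G (m j) - G 0 * (zeta j * w j) =
      zeta j * (G (m j) - G 0) * w j by ring.
    by case: (zetaP j) => ->; split; apply: Rmult_le_compat_r; lra.
  have XLE : X - L = \sumR_(j < d) (zeta j * w j * G (m j) - G 0 * (zeta j * w j)).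
    rewrite (eq_bigr (fun j => zeta j * w j * G (m j) + (- G 0) * (zeta j * w j))).
      by rewrite big_split /= sumR_scal -Ropp_mult_distr_l.
    by move=> j _; ring.
  have up := sumR_le (fun j => (bound j).2); have lo := sumR_le (fun j => (bound j).1).
  rewrite !sumR_scal -XLE in up lo.
  by apply: Rabs_def1; lra.
have XL0 : 0 < X * L.
  case: (Rtotal_order L 0) => [s|[//|s]].
    rewrite (Rabs_left L) // in XL; move/Rabs_def2: XL => XL.
    by rewrite -[X * L]Rmult_opp_opp; apply: Rmult_lt_0_compat; lra.
  rewrite (Rabs_pos_eq L) in XL; last lra.
  by move/Rabs_def2: XL => XL; apply: Rmult_lt_0_compat; lra.
have mu2 : 0 < mu * mu by exact: Rsqr_pos_lt.
rewrite (_ : L * mu * (C * (mu * X)) = C * (mu * mu) * (X * L)); last by ring.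
by apply: Rmult_lt_0_compat => //; apply: Rmult_lt_0_compat.
Qed.

(** For [n <> 2] the central value near [q_s] has the sign of [L * mu], hence opposite signs at
    [q_p] and [q_m]. Both counts are compared with the reference count by [curve_nodal_change]; the
    parts even in the sign cancel and the odd parts differ by the sum of [zeta], up to sign. *)
Lemma crossing_curve :
  \sumR_(j < d) (zeta j * Rpower (kap j) (- 1 + 1 / INR n)) <> 0 ->
  exists gamma : R -> R * ('I_d -> R),
  [/\ local_spectral_curve nu n l bc phi_s gamma, on_curve gamma q_s,
    (exists eps : posreal, forall q_p q_m : R * ('I_d -> R),
      on_curve gamma q_p -> on_curve gamma q_m ->
      ball q_s eps q_p -> ball q_s eps q_m -> q_m.1 < 0 < q_p.1 ->
      forall phi_p phi_m : 'I_d -> R -> R,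
      is_phi nu n l bc phi_s q_p phi_p -> is_phi nu n l bc phi_s q_m phi_m ->
      exists Z_p Z_m : nat,
        [/\ nodal_count d_gt2 l phi_p Z_p, nodal_count d_gt2 l phi_m Z_m &
            Rabs (INR Z_p - INR Z_m) = Rabs (\sumR_(j < d) zeta j)]) &
    (n <> 2%N -> forall eps : posreal, exists q_p q_m : R * ('I_d -> R),
      [/\ on_curve gamma q_p, on_curve gamma q_m, ball q_s eps q_p,
          ball q_s eps q_m & q_m.1 < 0 < q_p.1])].
Proof.
move=> sum_neq0.
have [Hup _] := phi_s_is_phi; have HPhi := phi_s_in_Phi_star.
case: (eqVneq n 2%N) => [n2|/eqP n2].
  exists (fun _ => q_s); split.
  - split=> [tau|tau]; first exact: continuous_const.
    by split; [exact: q_s_in_Q | exists phi_s; [exact: phi_s_is_phi |]].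
  - by exists 0.
  - exists (mkposreal _ Rlt_0_1) => q_p q_m [t1 <-] _ _ _ /=; lra.
  - by move=> /(_ n2).
have [L [L0 HL]] := slope_sum_sign n2 sum_neq0.
have [r [rho [gamma [[r0 rho0] Hg g0 g1 gS]]]] :=
  spectral_curve l_gt0 nu_neq0' n0 d_gt2 mode_signs q_s_in_Q q_s_zero q_s_slopes phi_s_agrees.
have [del [del0 Hdel]] := HL rho rho0.
have [e1 He1] := curve_nodal_change l_gt0 nu_neq0' n0 q_s_in_Q Hup HPhi
  (phi_s_center _) Hg.
exists gamma; split=> //; first by exists 0.
- have eps0 : 0 < Rmin e1 del by apply: Rmin_pos => //; exact: cond_pos.
  exists (mkposreal _ eps0) => q_p q_m on_p on_m b_p b_m mu_pm phi_p phi_m is_p is_m.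
  have be1 q : ball q_s (mkposreal _ eps0) q -> ball q_s e1 q.
    by apply: ball_le => /=; exact: Rmin_l.
  have bdel q : ball q_s (mkposreal _ eps0) q -> Rabs q.1 < del.
    move=> [/ball_near b1 _]; rewrite /near /= Rminus_0_r in b1.
    by apply: Rlt_le_trans b1 _; exact: Rmin_r.
  have center_sign q phi : on_curve gamma q -> Rabs q.1 < del -> q.1 <> 0 ->
      is_phi nu n l bc phi_s q phi -> 0 < L * q.1 * center d_gt2 phi.
    move=> [tau <-] qd q0 Hphi.
    have qI : 0 < Rabs (gamma tau).1 < del by split=> //; exact: Rabs_pos_lt.
    have [A [nA zA S]] := Hdel _ qI.
    have := gS tau phi Hphi A nA zA; rewrite (sign_eq_1 _ nu0) Rmult_1_l.
    set S0 := \sumR_(j < d) _ in S * => -[up down].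
    set Y := L * (gamma tau).1 in S *.
    case: (Rtotal_order S0 0) => [s|[s|s]].
    - have := down s; have Y0 : Y < 0 by nra.
      by nra.
    - by rewrite s in S; lra.
    - have := up s; have : 0 < Y by nra.
      by nra.
  have mp0 : q_p.1 <> 0 by lra.
  have mm0 : q_m.1 <> 0 by lra.
  have c_p := center_sign _ _ on_p (bdel _ b_p) mp0 is_p.
  have c_m := center_sign _ _ on_m (bdel _ b_m) mm0 is_m.
  have [Z_p [Z_s [N_p N_s E_p]]] := He1 _ (be1 _ b_p) on_p _ is_p.
  have [Z_m [Z_s' [N_m N_s' E_m]]] := He1 _ (be1 _ b_m) on_m _ is_m.
  rewrite (nodal_count_unique N_s' N_s) in E_m.
  rewrite (eq_bigr zeta) in E_p; last by move=> j _; exact: phi_s_slope_sign.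
  rewrite (eq_bigr zeta) in E_m; last by move=> j _; exact: phi_s_slope_sign.
  exists Z_p, Z_m; split=> //.
  set S := \sumR_(j < d) zeta j in E_p E_m *.
  case: (Rlt_le_dec 0 L) => sL.
    have Kpp : 0 < L * q_p.1 by nra.
    have pp : 0 < center d_gt2 phi_p by nra.
    have Kmm : L * q_m.1 < 0 by nra.
    have mm : center d_gt2 phi_m < 0 by nra.
    rewrite (sign_eq_1 _ pp) in E_p; rewrite (sign_eq_m1 _ mm) in E_m.
    rewrite (_ : INR Z_p - INR Z_m = - S); last by lra.
    exact: Rabs_Ropp.
  have sL' : L < 0 by lra.
  have Kpp : L * q_p.1 < 0 by nra.
    have pp : center d_gt2 phi_p < 0 by nra.
  have Kmm : 0 < L * q_m.1 by nra.
    have mm : 0 < center d_gt2 phi_m by nra.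
  rewrite (sign_eq_m1 _ pp) in E_p; rewrite (sign_eq_1 _ mm) in E_m.
  by congr Rabs; lra.
- move=> _ eps.
  have Lg : locally 0 (fun tau => ball q_s eps (gamma tau)).
    by rewrite -{1}g0; apply: continuous_ball; apply: Hg.1.
  have [t0 Ht0] := Lg.
  have p0 := PI_RGT_0.
  (* [t <= PI / 2] makes [sin t > 0], so [gamma t] and [gamma (- t)] lie on opposite sides of
     [mu = 0]; [t0 / 2] keeps both in the ball. *)
  pose t := Rmin (t0 / 2) (PI / 2).
  have tpos : 0 < t by apply: Rmin_pos; [have := cond_pos t0; lra | lra].
  have t1 : t <= t0 / 2 := Rmin_l _ _; have t2 : t <= PI / 2 := Rmin_r _ _.
  have st : 0 < sin t by apply: sin_gt_0; lra.
  exists (gamma t), (gamma (- t)); split.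
  + by exists t.
  + by exists (- t).
  + by apply: Ht0; apply/ball_near/nearP; have := cond_pos t0; lra.
  + by apply: Ht0; apply/ball_near/nearP; have := cond_pos t0; lra.
  + by rewrite !g1 sin_neg /=; have := Rmult_lt_0_compat _ _ r0 st; lra.
Qed.

End DirichletStar.

Unset Implicit Arguments.

Theorem theorem2p9 (d : nat) (d_gt2 : (2 < d)%N) (l : 'I_d -> R)
    (l_gt0 : forall j, 0 < l j) (nu : R) (nu_neq0 : nu <> 0)
    (sigma : nat) (sigma_gt0 : (0 < sigma)%N)
    (bc : 'I_d -> boundary_condition) :
  (forall (q_s : R * ('I_d -> R)) (phi_s : 'I_d -> R -> R),
    in_Q nu sigma q_s ->
    is_phi_upto_signs nu sigma l bc q_s phi_s ->
    in_Phi_star nu sigma l bc phi_s ->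
    center d_gt2 phi_s = 0 ->
    (exists gamma : R -> R * ('I_d -> R),
      [/\ local_spectral_curve nu sigma l bc phi_s gamma,
          on_curve gamma q_s &
          exists tau, gamma tau <> q_s]) /\
    (forall gamma : R -> R * ('I_d -> R),
      local_spectral_curve nu sigma l bc phi_s gamma ->
      on_curve gamma q_s ->
      locally q_s (fun q : R * ('I_d -> R) =>
        on_curve gamma q ->
        forall phi : 'I_d -> R -> R,
          is_phi nu sigma l bc phi_s q phi ->
          exists Z Z_s : nat,
            [/\ nodal_count d_gt2 l phi Z,
                nodal_count d_gt2 l phi_s Z_s &
                INR Z - INR Z_s =
                sign (center d_gt2 phi) ^ 2 *
                (- 1 + INR d / 2 -
                 1 / 2 * sign (center d_gt2 phi) *
                 \sumR_(j < d) sign (center_slope l phi_s j))])))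
  /\
  ((forall j, bc j = Dirichlet) ->
    0 < nu ->
    forall (zeta : 'I_d -> R) (n : 'I_d -> nat),
      (forall j, zeta j = -1 \/ zeta j = 1) ->
      (forall j, (0 < n j)%N) ->
      \sumR_(j < d) (zeta j * Rpower (INR (n j) / l j) (1 + 1 / INR sigma)) = 0 ->
      exists (q_s : R * ('I_d -> R)) (phi_s : 'I_d -> R -> R),
        (in_Q nu sigma q_s /\
         is_phi_upto_signs nu sigma l bc q_s phi_s /\
         in_Phi_star nu sigma l bc phi_s /\
         q_s.1 = 0 /\
         center d_gt2 phi_s = 0 /\
         (forall j, zeta j = sign (center_slope l phi_s j)) /\
         (exists2 Z_s : nat, nodal_count d_gt2 l phi_s Z_s &
            INR Z_s = 1 - INR d + \sumR_(j < d) INR (n j)))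
        /\
        (\sumR_(j < d) (zeta j * Rpower (INR (n j) / l j) (- 1 + 1 / INR sigma)) <> 0 ->
         exists gamma : R -> R * ('I_d -> R),
           [/\ local_spectral_curve nu sigma l bc phi_s gamma,
               on_curve gamma q_s,
               (exists eps : posreal,
                 forall q_p q_m : R * ('I_d -> R),
                   on_curve gamma q_p -> on_curve gamma q_m ->
                   ball q_s eps q_p -> ball q_s eps q_m ->
                   q_m.1 < 0 < q_p.1 ->
                   forall phi_p phi_m : 'I_d -> R -> R,
                     is_phi nu sigma l bc phi_s q_p phi_p ->
                     is_phi nu sigma l bc phi_s q_m phi_m ->
                     exists Z_p Z_m : nat,
                       [/\ nodal_count d_gt2 l phi_p Z_p,
                           nodal_count d_gt2 l phi_m Z_m &
                           Rabs (INR Z_p - INR Z_m) =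
                           Rabs (\sumR_(j < d) zeta j)]) &
               (sigma <> 2%N ->
                 forall eps : posreal,
                 exists q_p q_m : R * ('I_d -> R),
                   [/\ on_curve gamma q_p, on_curve gamma q_m,
                       ball q_s eps q_p, ball q_s eps q_m &
                       q_m.1 < 0 < q_p.1])])).
Proof.
split=> [q_s phi_s Hqs Hphi HPhi z|bcD nu_gt0 zeta n zetaP n_gt0 slopes0].
  split; last by move=> gamma Hg _; exact: curve_nodal_change.
  have [[mu [_ cont sum0 _]] _ _] := HPhi.
  have [e He As] := upto_signs_agrees nu_neq0 sigma_gt0 Hqs Hphi.
  have s0 := proj1 (center_zero_phase l_gt0 nu_neq0 sigma_gt0 d_gt2 He Hqs As cont) z.
  have slopes : \sumR_(j < d)
      (e j * wave_slope nu sigma (bc j) (l j) q_s.1 (q_s.2 j) 0) = 0.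
    rewrite -[RHS]sum0; apply: eq_bigr => j _.
    by rewrite (agrees_center_slope l_gt0 nu_neq0 sigma_gt0 He Hqs As).
  have [r [rho [gamma [[r0 _] Hg g0 g1 _]]]] :=
    spectral_curve l_gt0 nu_neq0 sigma_gt0 d_gt2 He Hqs s0 slopes As.
  exists gamma; split=> //; first by exists 0.
  (* There [mu] is shifted by [r / 2], so the curve is not constant. *)
  by exists (PI / 2) => E; have := g1 (PI / 2); rewrite E sin_PI2; lra.
have {}zetaP : signs zeta by move=> j; case: (zetaP j); [right | left].
have H := crossing_curve l_gt0 nu_gt0 sigma_gt0 d_gt2 bcD zetaP n_gt0 slopes0.
eexists; eexists; split; last exact: H.
split; first exact: q_s_in_Q.
split; first by case: (phi_s_is_phi l_gt0 nu_gt0 sigma_gt0 bcD zetaP n_gt0).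
split; first exact: phi_s_in_Phi_star.
split; first by [].
split; first exact: phi_s_center.
split; first by move=> j; rewrite phi_s_slope_sign.
exact: phi_s_nodal_count.
Qed.
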